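(* Let $K$ be an algebraically closed field of characteristic $0$ and $A$ an $(n+1)$-dimensional $K$-vector space. The leading coefficient of the predegree polynomial of a smooth quadric hypersurface $Q\subset\mathbb{P}A\cong\mathbb{P}^n$ is the degree of $\operatorname{PO}(A)$.
   Context: Here $n\ge1$. Choose coordinates $x_0,\dots,x_n$ on $A$; up to change of coordinates $Q$ is $x_0^2+\cdots+x_n^2=0$. $\operatorname{O}(A)\subset\operatorname{GL}(A)$ is the orthogonal group of this quadratic form, and $\operatorname{PO}(A)$ is its image in $\mathbb{P}\operatorname{GL}(A)$. The degree of a subgroup of $\mathbb{P}\operatorname{GL}(A)$ is the degree of its closure in $\mathbb{P}\operatorname{End}(A)\cong\mathbb{P}^{n^2+2n}$. Predegree polynomial: for a hypersurface $X\subset\mathbb{P}A$ of degree $d$ with equation $f\in\operatorname{Sym}^d(A^\vee)$, let $\alpha:\mathbb{P}\operatorname{End}(A)\dashrightarrow\mathbb{P}\operatorname{Sym}^d(A^\vee)$ be the rational map $\varphi\mapsto[f(\varphi(\cdot))]$, let $\overline{\Gamma}$ be the closure of its graph, let $p_1,p_2$ be the projections of $\mathbb{P}\operatorname{End}(A)\times\mathbb{P}\operatorname{Sym}^d(A^\vee)$ to its factors, and let $h_1,h_2$ be the hyperplane classes of the two factors. Then the predegree polynomial of $X$ is $\sum_{i=0}^{n^2+2n}a_it^i$ with $a_i=\int p_1^*h_1^{\,n^2+2n-i}p_2^*h_2^{\,i}\cap[\overline{\Gamma}]$. For a quadric, $d=2$. *)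

(* Defs.v *)
(* Intersection numbers of hyperplane classes on products of projective spaces,
   in the style of Fulton's _Intersection theory_ (chapters 1 and 2), and the
   predegree polynomial of a hypersurface. *)
From HB Require Import structures.
From mathcomp Require Import all_boot all_order all_algebra.
From mathcomp Require Import mpoly.

Set Implicit Arguments.
Unset Strict Implicit.
Unset Printing Implicit Defensive.

Import GRing.Theory.
Local Open Scope ring_scope.

Section Families.
Variable X : Type.
Implicit Types (V W : X -> Prop) (P : (X -> Prop) -> Prop).

Definition incl V W := forall x, V x -> W x.
Definition same V W := forall x, V x <-> W x.
Definition strict_incl V W := incl V W /\ ~ incl W V.

Definition strict_chain P (r : nat) (c : nat -> X -> Prop) :=
  (forall i, (i <= r)%N -> P (c i)) /\
  (forall i, (i < r)%N -> strict_incl (c i) (c i.+1)).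

(* r is the maximal number of strict inclusions in a chain of members of P *)
Definition max_chain_length P (r : nat) :=
  (exists c, strict_chain P r c) /\
  (forall k c, strict_chain P k c -> (k <= r)%N).

(* W is a list without repetition of all the members of P *)
Definition enumerates P (r : nat) (W : 'I_r -> X -> Prop) :=
  [/\ forall k, P (W k),
      forall k l, same (W k) (W l) -> k = l &
      forall V, P V -> exists k, same V (W k)].

End Families.

(* The product over b : B of the projective spaces with homogeneous coordinates
   {t : T | blk t = b}.  A point is given by vectors of homogeneous coordinates,
   nonzero in each block, and a subset of the product by the set of all the
   representatives of its points. *)
Section MultiProjective.
Variables (K : closedFieldType) (T B : finType) (blk : T -> B).

Notation vect := {ffun T -> K}.
Notation S := {mpoly K[#|T|]}.
Implicit Types (v w : vect) (V W Z : vect -> Prop) (p q g : S) (Q : S -> Prop).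

Definition peval p v : K := p.@[fun i => v (enum_val i)].

Definition is_point v := forall b, exists2 t, blk t = b & v t != 0.

Definition rescale (c : B -> K) v : vect := [ffun t => c (blk t) * v t].

Definition mp_set V :=
  (forall v, V v -> is_point v) /\
  (forall c v, (forall b, c b != 0) -> V v -> V (rescale c v)).

Definition vanishing V : S -> Prop := fun p => forall v, V v -> peval p v = 0.

(* When V is an mp_set, its vanishing ideal is multihomogeneous (K is infinite),
   so this is the Zariski closure in the product of projective spaces. *)
Definition zclosure V : vect -> Prop :=
  fun v => is_point v /\ (forall p, vanishing V p -> peval p v = 0).

Definition subvariety V :=
  [/\ mp_set V,
      exists v, V v,
      incl (zclosure V) V &
      forall p q, vanishing V (p * q) -> vanishing V p \/ vanishing V q].

Definition single_point V :=
  exists2 v, is_point v &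
    forall w, V w <-> exists2 c, (forall b, c b != 0) & w = rescale c v.

Definition dimension Z (r : nat) :=
  max_chain_length (fun V => subvariety V /\ incl V Z) r.

Definition codim1 V W :=
  [/\ subvariety W, strict_incl W V &
      forall Y, subvariety Y -> incl W Y -> incl Y V -> same Y W \/ same Y V].

Definition is_ideal Q :=
  [/\ Q 0, forall p q, Q p -> Q q -> Q (p + q) & forall p q, Q q -> Q (p * q)].

(* The ideals of S containing l and the ideal of V and saturated with respect
   to the complement of the prime ideal of W are the contractions of the ideals
   of O / (l), where O is the local ring, along W, of the (multi)cone over V.
   As O is a localization of a Laurent polynomial ring over O_{V,W} at the
   extension of the maximal ideal, the length of O / (l) is that of
   O_{V,W} / (l), i.e. the order of vanishing of l on V along W. *)
Definition local_ideal V W (l : S) Q :=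
  [/\ is_ideal Q, incl (vanishing V) Q, Q l &
      forall g p, ~ vanishing W g -> Q (g * p) -> Q p].

Definition ord_along V W (l : S) (m : nat) :=
  max_chain_length (local_ideal V W l) m.

Definition linear_form (b : B) (c : T -> K) : S :=
  \sum_(t | blk t == b) c t *: 'X_(enum_rank t).

(* hyperplane_number [:: b1; ...; br] V z says that V has dimension r and
   z is the degree of h_b1 ... h_br \cap [V], h_b being the pullback of the
   hyperplane class of the factor b:  h_b \cap [V] is the Weil divisor
   \sum_W ord_W(l) [W]  on V of any section l of the pullback of O(1) that is
   not identically zero on V. *)
Fixpoint hyperplane_number (bs : seq B) V (z : nat) : Prop :=
  if bs is b :: bs' then
    exists (c : T -> K) (r : nat) (W : 'I_r -> vect -> Prop)
           (m y : 'I_r -> nat),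
      let l := linear_form b c in
      [/\ ~ vanishing V l,
          enumerates (fun W' => codim1 V W' /\ vanishing W' l) W,
          forall k, ord_along V (W k) l (m k),
          forall k, hyperplane_number bs' (W k) (y k) &
          z = (\sum_(k < r) m k * y k)%N]
  else single_point V /\ z = 1%N.

End MultiProjective.

(* Degree of a closed subset Z of a single projective space: its subvarieties
   of dimension dim Z are its irreducible components of maximal dimension. *)
Definition proj_degree (K : closedFieldType) (T : finType)
    (Z : {ffun T -> K} -> Prop) (d : nat) :=
  let blk := fun _ : T => tt in
  exists (r k : nat) (Y : 'I_k -> {ffun T -> K} -> Prop) (z : 'I_k -> nat),
    [/\ dimension blk Z r,
        enumerates (fun V => [/\ subvariety blk V, incl V Z &
                                 dimension blk V r]) Y,
        forall i, hyperplane_number blk (nseq r tt) (Y i) (z i) &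
        d = (\sum_(i < k) z i)%N].

(* The coordinates x_0, ..., x_n on A are dual to the basis e; polynomials in
   {mpoly K[n.+1]} are polynomials in these coordinates. *)
Section Coordinates.
Variables (K : closedFieldType) (n : nat) (A : vectType K) (e : n.+1.-tuple A).
Implicit Types (f : {mpoly K[n.+1]}) (phi g : 'End(A)) (d : nat).

Definition form_at f (x : A) : K := f.@[fun i => coord e i x].

Definition smooth_hypersurface f :=
  forall x : A, x != 0 -> form_at f x = 0 -> exists i, form_at f^`M(i) x != 0.

Definition end_coord phi : {ffun 'I_n.+1 * 'I_n.+1 -> K} :=
  [ffun ij : 'I_n.+1 * 'I_n.+1 => coord e ij.1 (phi e`_ij.2)].

Definition precomp f phi : {mpoly K[n.+1]} :=
  f \mPo [tuple \sum_(j < n.+1) end_coord phi (i, j) *: 'X_j | i < n.+1].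

(* Monomials of degree d, indexing the coordinates on Sym^d(A^\vee) *)
Definition monom d := {m : 'X_{1..n.+1 < d.+1} | mdeg m == d}.

Definition graph_coord d := (('I_n.+1 * 'I_n.+1) + monom d)%type.

(* false is the factor P End(A), true is the factor P Sym^d(A^\vee) *)
Definition graph_block d (t : graph_coord d) : bool :=
  if t is inr _ then true else false.

Definition predegree_graph d f (v : {ffun graph_coord d -> K}) : Prop :=
  exists phi (a : K),
    [/\ precomp f phi != 0, a != 0,
        forall ij, v (inl ij) = end_coord phi ij &
        forall m : monom d, v (inr m) = a * (precomp f phi)@_(val m)].

Definition predegree_polynomial d f (P : {poly int}) : Prop :=
  let N := (n ^ 2 + 2 * n)%N in
  exists2 a : nat -> nat,
    forall i, (i <= N)%N ->
      hyperplane_number (@graph_block d) (nseq (N - i) false ++ nseq i true)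
        (zclosure (@graph_block d) (@predegree_graph d f)) (a i) &
    P = \poly_(i < N.+1) (a i)%:Z.

Definition orthogonal_group f g : Prop :=
  lker g = 0%VS /\ (forall x, form_at f (g x) = form_at f x).

(* The subset of P End(A) which is the image of a set G of endomorphisms *)
Definition proj_image (G : 'End(A) -> Prop) (v : {ffun 'I_n.+1 * 'I_n.+1 -> K}) :
    Prop :=
  exists g (a : K), [/\ G g, a != 0 & forall ij, v ij = a * end_coord g ij].

Definition group_degree (G : 'End(A) -> Prop) (d : nat) : Prop :=
  proj_degree (zclosure (fun=> tt) (proj_image G)) d.

End Coordinates.

(* Main.v *)
Require Import Defs.
From HB Require Import structures.
From mathcomp Require Import all_boot all_order all_algebra.
From mathcomp Require Import mpoly.
From mathcomp Require Import zify ring.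
From Stdlib Require Import Classical ClassicalEpsilon.
From Stdlib Require Import FunctionalExtensionality PropExtensionality.

(* Hyperplane numbers are read off Hilbert functions: if l is a form of multidegree
   e_b not vanishing on V, then the Hilbert function of I(V) + (l) is the difference
   of that of V in the direction b; along a prime filtration it is a sum of shifted
   Hilbert functions of primes, in which the prime of W occurs as often as the
   length of the local ring along W, and primes of lower dimension do not matter.
   Hence h_b1 ... h_br on V is the iterated difference of the Hilbert function of V
   in the directions b1, ..., br, which does not depend on the order.

   Let f = x^T F x with F = C^T C, let H(a, b) be the Hilbert function of the closure
   of the graph of X |-> X^T F X, and h(a) that of the closure of PO.  Let M be the
   dimension of the space of quadrics and N that of P End(A).  Then
     h(a) binom(b+M, M) <= H(a, b) <= h(a) binom(b + kappa a + M, M).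
   The lower bound holds because forms of degree a that are independent on O(F)
   are independent on O(F) X for generic X, hence over the functions of X^T F X.
   For the upper bound write X = C^-1 g T with g orthogonal and T upper triangular
   and take a basis of the forms of degree a on the orthogonal group that consists of
   monomials: by invariance under sign changes, the coefficients of a form on this
   basis are polynomials in T that are even in each row after multiplication by a
   monomial in the diagonal of T, and t_ij t_ik is a rational function of T^T T.
   So the M-th difference of H in b is h, and moreover h has degree N - M. *)

Set Implicit Arguments.
Unset Strict Implicit.
Unset Printing Implicit Defensive.

Import Order.TTheory GRing.Theory Num.Theory.
Local Open Scope ring_scope.

(** The map X |-> X^T F X is onto the symmetric matrices, so more than M general hyperplanes of
    quadrics do not meet, while M of them meet in a point, over which the graph is a translate O(F)
    X: hence the polynomial ends in degree M with the degree of PO. But [hyperplane_number] cuts by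
    arbitrary sections, not general ones; Hilbert functions do not see the choice. The delicate
    point is uniformity. For fixed a the two bounds differ by a function of b of degree less than M,
    so the M-th difference in b equals h(a) from some b on that depends on a. A threshold common to
    all large a exists because H is a polynomial on a whole translated quadrant. The slope kappa is
    delta + 1, where delta is the degree of a common denominator of the products t_ij t_ik as
    functions of T^T T. The dimension N - M of PO is not computed from the group: the total degree N
    of H bounds it above, and binom(a + N, N) <= H(a, 0) bounds it below. *)

Lemma functional_choice A B (Rel : A -> B -> Prop) :
  (forall x, exists y, Rel x y) -> exists f, forall x, Rel x (f x).
Proof.
move=> h; exists (fun x => proj1_sig (constructive_indefinite_description _ (h x))) => x.
exact: (proj2_sig (constructive_indefinite_description _ (h x))).
Qed.

(** * Functions of a multidegree with eventually vanishing differences *)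

Section EventuallyPolynomial.
Variable k : nat.
Local Notation deg := 'X_{1..k}.
Implicit Types (F G : deg -> int) (d e : deg) (j : 'I_k) (bs : seq 'I_k).

(** Two translates of the orthant contain a third, so finitely many eventual properties hold with
    one threshold. *)
Definition ev (Q : deg -> Prop) := exists d0, forall d, Q (d0 + d)%MM.

Lemma evT (Q : deg -> Prop) : (forall d, Q d) -> ev Q.
Proof. by move=> h; exists 0%MM. Qed.

Lemma ev_mono (Q Q' : deg -> Prop) : (forall d, Q d -> Q' d) -> ev Q -> ev Q'.
Proof. by move=> h [d0 hd]; exists d0 => d; apply/h/hd. Qed.

Lemma ev_shift e (Q : deg -> Prop) : ev Q -> ev (fun d => Q (d + e)%MM).
Proof. by case=> d0 h; exists d0 => d; rewrite -addmA; apply: h. Qed.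

Lemma ev_and (Q Q' : deg -> Prop) : ev Q -> ev Q' -> ev (fun d => Q d /\ Q' d).
Proof.
case=> d0 h [d1 h']; exists (d0 + d1)%MM => d; split; first by rewrite -addmA.
by rewrite (addmC d0) -addmA.
Qed.

Lemma ev_and2 (Q1 Q2 Q : deg -> Prop) :
  (forall d, Q1 d -> Q2 d -> Q d) -> ev Q1 -> ev Q2 -> ev Q.
Proof. by move=> h h1 h2; apply: ev_mono (ev_and h1 h2) => d []; apply: h. Qed.

Lemma ev_all (I : finType) (Q : I -> deg -> Prop) :
  (forall i, ev (Q i)) -> ev (fun d => forall i, Q i d).
Proof.
move=> h.
suff H (s : seq I) : ev (fun d => forall i, i \in s -> Q i d).
  by case: (H (enum I)) => d0 hd; exists d0 => d i; apply: hd; rewrite mem_enum.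
elim: s => [|i s IHs]; first by exists 0%MM.
by apply: ev_and2 (h i) IHs => d hi hs i'; rewrite inE => /predU1P[->|/hs].
Qed.

Lemma ev_const (P : Prop) : ev (fun=> P) -> P.
Proof. by case=> d0 /(_ 0%MM). Qed.

Definition df j F : deg -> int := fun d => F (d + U_(j))%MM - F d.
(** Subtraction of multidegrees is truncated, so this is the shift by e only on e + N^k; identities
    about it are stated under [ev]. *)
Definition sh e F : deg -> int := fun d => F (d - e)%MM.
Definition diffs bs F := foldl (fun F j => df j F) F bs.

(* Eventually, F coincides with a polynomial of degree less than r. *)
Fixpoint deglt r F : Prop :=
  if r is r'.+1 then forall j, deglt r' (df j F) else ev (fun d => F d = 0).

Lemma mnm_ind (Q : deg -> Prop) :
  Q 0%MM -> (forall d j, Q d -> Q (d + U_(j))%MM) -> forall d, Q d.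
Proof.
move=> h0 hS d; move e: (mdeg d) => n; elim: n d e => [|n IHn] d.
  by move/eqP; rewrite mdeg_eq0 => /eqP->.
move=> hd; have [j hj] : exists j, (0 < d j)%N.
  case: (pickP (fun j => 0 < d j)%N) => [j hj|h]; first by exists j.
  suff d0 : d = 0%MM by rewrite d0 mdeg0 in hd.
  by apply/mnmP=> j; rewrite mnm0E; apply/eqP; rewrite -leqn0 leqNgt h.
have le : (U_(j) <= d)%MM by rewrite lep1mP -lt0n.
rewrite -(submK le); apply/hS/IHn.
by move: hd; rewrite -{1}(submK le) mdegD mdeg1 addn1 => -[].
Qed.

Lemma df_ev j F G : ev (fun d => F d = G d) -> ev (fun d => df j F d = df j G d).
Proof. by move=> h; apply: ev_and2 h (ev_shift U_(j) h) => d; rewrite /df => -> ->. Qed.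

Lemma deglt_ev r F G : ev (fun d => F d = G d) -> deglt r F -> deglt r G.
Proof.
elim: r F G => [|r IHr] F G h /=; first by apply: ev_and2 h => d ->.
by move=> hF j; apply: IHr (hF j); apply: df_ev.
Qed.

Lemma deglt_eq r F G : F =1 G -> deglt r F -> deglt r G.
Proof. by move=> h; apply/deglt_ev/evT. Qed.

Lemma deglt0 r : deglt r (fun=> 0).
Proof.
elim: r => [|r IHr] /=; first by exists 0%MM.
by move=> j; apply: deglt_eq IHr => d; rewrite /df subrr.
Qed.

Lemma deglt_comb r (a b : int) F G :
  deglt r F -> deglt r G -> deglt r (fun d => a * F d + b * G d).
Proof.
elim: r F G => [|r IHr] F G /=.
  by apply: ev_and2 => d -> ->; rewrite !mulr0 addr0.
move=> hF hG j; apply: deglt_eq (IHr _ _ (hF j) (hG j)) => d; rewrite /df; ring.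
Qed.

Lemma degltZ r (a : int) F : deglt r F -> deglt r (fun d => a * F d).
Proof. by move=> h; apply: deglt_eq (deglt_comb a 0 h h) => d; rewrite mul0r addr0. Qed.

Lemma degltD r F G : deglt r F -> deglt r G -> deglt r (fun d => F d + G d).
Proof. by move=> hF hG; apply: deglt_eq (deglt_comb 1 1 hF hG) => d; ring. Qed.

Lemma degltB r F G : deglt r F -> deglt r G -> deglt r (fun d => F d - G d).
Proof. by move=> hF hG; apply: deglt_eq (deglt_comb 1 (-1) hF hG) => d; ring. Qed.

Lemma degltS r F : deglt r F -> deglt r.+1 F.
Proof.
elim: r F => [|r IHr] F h j; last exact/IHr/h.
by apply: ev_and2 h (ev_shift U_(j) h) => d; rewrite /df => -> ->; rewrite subrr.
Qed.

Lemma deglt_leq r s F : (r <= s)%N -> deglt r F -> deglt s F.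
Proof.
by move/subnK<-; elim: (s - r)%N => // m IHm /IHm; rewrite addSn; apply: degltS.
Qed.

Lemma ev_sh e (Q : deg -> Prop) : ev Q -> ev (fun d => Q (d - e)%MM).
Proof. by case=> d0 h; exists (d0 + e)%MM => d; rewrite -addmA (addmC e) addmA addmK. Qed.

Lemma df_sh e j F : ev (fun d => df j (sh e F) d = sh e (df j F) d).
Proof.
by exists e => d; rewrite /df /sh -addmA !(addmC e) !addmK.
Qed.

Lemma deglt_sh e r F : deglt r F -> deglt r (sh e F).
Proof.
elim: r F => [|r IHr] F /=; first exact: (@ev_sh e (fun d => F d = 0)).
move=> h j; apply: deglt_ev (IHr _ (h j)).
by apply: ev_mono (df_sh e j F) => d ->.
Qed.

Lemma deglt_shN e r F : deglt r (sh e F) -> deglt r F.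
Proof.
elim: r F => [|r IHr] F /=.
  by move/(ev_shift e); apply: ev_mono => d; rewrite /sh addmK.
by move=> h j; apply: IHr; apply: deglt_ev (h j); apply: df_sh.
Qed.

Lemma deglt_add e r F : deglt r F -> deglt r (fun d => F (d + e)%MM).
Proof.
elim: r F => [|r IHr] F /=; first exact: (ev_shift e).
move=> h j; apply: deglt_eq (IHr _ (h j)) => d; rewrite /df.
by rewrite -!addmA (addmC e).
Qed.

Lemma deglt_addB e r F : deglt r.+1 F -> deglt r (fun d => F (d + e)%MM - F d).
Proof.
move=> h; elim/mnm_ind: e => [|e j IHe].
  by apply: deglt_eq (deglt0 r) => d; rewrite addm0 subrr.
apply: deglt_eq (degltD (deglt_add e (h j)) IHe) => d.
by rewrite /df addrA addmA subrK.
Qed.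

Lemma deglt_Bsh e r F : deglt r.+1 F -> deglt r (fun d => F d - sh e F d).
Proof.
move=> h; apply: (@deglt_shN (0%MM)); apply: deglt_ev (deglt_sh e (deglt_addB e h)).
by exists e => d; rewrite /sh !subm0 [(e + d)%MM]addmC addmK.
Qed.

Lemma const_ev F : (forall j, ev (fun d => df j F d = 0)) ->
  exists c, ev (fun d => F d = c).
Proof.
move=> /ev_all [d0 h]; exists (F d0), d0; elim/mnm_ind => [|d j IHd].
  by rewrite addm0.
by have /eqP := h d j; rewrite /df subr_eq0 -addmA => /eqP->.
Qed.

Lemma diffs_ev bs F G :
  ev (fun d => F d = G d) -> ev (fun d => diffs bs F d = diffs bs G d).
Proof. by elim: bs F G => //= j bs IHb F G h; apply/IHb/df_ev. Qed.

Lemma eq_diffs bs F G : F =1 G -> diffs bs F =1 diffs bs G.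
Proof.
elim: bs F G => //= j bs IHb F G h; apply: IHb => d; by rewrite /df !h.
Qed.

Lemma diffs_deglt bs r F : deglt (size bs + r) F -> deglt r (diffs bs F).
Proof. by elim: bs F => //= j bs IHb F h; apply/IHb/h. Qed.

Lemma diffs_deglt0 bs F : deglt (size bs) F -> ev (fun d => diffs bs F d = 0).
Proof. by rewrite -{1}[size bs]addn0; apply: (@diffs_deglt _ 0). Qed.

Lemma deglt_diffs r F :
  (forall bs, size bs = r -> ev (fun d => diffs bs F d = 0)) -> deglt r F.
Proof.
elim: r F => [|r IHr] F h; first exact: (h [::]).
by move=> j; apply: IHr => bs hb; apply: (h (j :: bs)); rewrite /= hb.
Qed.

Lemma diffs_const bs F : deglt (size bs).+1 F ->
  exists c, ev (fun d => diffs bs F d = c).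
Proof. by rewrite -addn1 => /diffs_deglt h; apply: const_ev. Qed.

Lemma diffs_comb bs (a b : int) F G d :
  diffs bs (fun d => a * F d + b * G d) d = a * diffs bs F d + b * diffs bs G d.
Proof.
elim: bs F G => //= j bs IHb F G; rewrite -IHb; apply: eq_diffs => d'.
rewrite /df; ring.
Qed.

Lemma diffsD bs F G d :
  diffs bs (fun d => F d + G d) d = diffs bs F d + diffs bs G d.
Proof.
rewrite -[in RHS](mul1r (diffs bs F d)) -[in RHS](mul1r (diffs bs G d)) -diffs_comb.
by apply: eq_diffs => d'; rewrite !mul1r.
Qed.

Lemma diffs0 bs d : diffs bs (fun=> 0) d = 0.
Proof.
elim: bs => //= j bs IHb; rewrite -{2}IHb; exact: eq_diffs.
Qed.

Lemma diffs_sum bs (I : Type) (s : seq I) (F : I -> deg -> int) d :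
  diffs bs (fun d => \sum_(i <- s) F i d) d = \sum_(i <- s) diffs bs (F i) d.
Proof.
elim: s => [|i s IHs].
  by rewrite big_nil -[RHS](diffs0 bs d); apply: eq_diffs => d'; rewrite big_nil.
rewrite big_cons -IHs -diffsD; apply: eq_diffs => d'; by rewrite big_cons.
Qed.

Lemma diffs_sh bs e F c : deglt (size bs).+1 F ->
  ev (fun d => diffs bs F d = c) -> ev (fun d => diffs bs (sh e F) d = c).
Proof.
move=> h hc; have := diffs_deglt0 (deglt_Bsh e h).
apply: ev_and2 hc => d <- h0; apply/eqP.
rewrite eq_sym -subr_eq0 -h0 -mulN1r -(mul1r (diffs bs F d)) -diffs_comb.
by apply/eqP/eq_diffs => d'; rewrite mul1r mulN1r.
Qed.

Lemma diffs_add bs e F d :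
  diffs bs (fun d => F (d + e)%MM) d = diffs bs F (d + e)%MM.
Proof.
elim: bs F => //= j bs IHb F; rewrite -IHb; apply: eq_diffs => d'.
by rewrite /df -!addmA (addmC e).
Qed.

Lemma dfC i j F : df i (df j F) =1 df j (df i F).
Proof. by move=> d; rewrite /df -!addmA (addmC U_(j)%MM); ring. Qed.

Lemma diffs_df bs j F : diffs bs (df j F) =1 df j (diffs bs F).
Proof.
elim: bs F => //= i bs IHb F d; rewrite -IHb; apply: eq_diffs => d'; exact: dfC.
Qed.

Lemma diffs_cat bs bs' F : diffs (bs ++ bs') F = diffs bs' (diffs bs F).
Proof. by rewrite /diffs foldl_cat. Qed.

Lemma diffsC bs bs' F : diffs (bs ++ bs') F =1 diffs (bs' ++ bs) F.
Proof.
move=> d; rewrite !diffs_cat; elim: bs F => //= j bs IHb F; rewrite IHb.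
by apply: eq_diffs => d'; apply: diffs_df.
Qed.

(** The bound O(|d|^(r-1)); the factor |d| + 1 on the left avoids the exponent r - 1 at r = 0. *)
Definition growth r F := exists (C : nat) (d0 : deg), forall d,
  (`|F (d0 + d)%MM| * (mdeg d).+1 <= C * (mdeg d).+1 ^ r)%N.

Lemma mdegDU d j : mdeg (d + U_(j))%MM = (mdeg d).+1.
Proof. by rewrite mdegD mdeg1 addn1. Qed.

Lemma leq_mulX (C a b r : nat) : (a <= b)%N -> (C * a ^ r <= C * b ^ r)%N.
Proof. by case: r => // r h; rewrite leq_mul2l leq_exp2r // h orbT. Qed.

(** On a path of |d| unit steps from d0 to d0 + d, every step changes F by a difference of one
    degree less, and the sum gains one power of |d|. *)
Lemma deglt_growth r F : deglt r F -> growth r F.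
Proof.
elim: r F => [|r IHr] F.
  by case=> d0 h; exists 0%N, d0 => d; rewrite h.
move=> h; case: r IHr h => [|r] IHr h.
  have [c [d0 hc]] := const_ev h.
  by exists `|c|%N, d0 => d; rewrite hc expn1.
have {}h j : exists C : nat, ev (fun d => `|df j F d| <= C * (mdeg d).+1 ^ r)%N.
  have [C [d0 hC]] := IHr _ (h j); exists C, d0 => d.
  have := hC d; rewrite expnSr mulnA leq_pmul2r // => /leq_trans; apply.
  by apply: leq_mulX; rewrite ltnS mdegD leq_addl.
have [C hC] := functional_choice h.
have [d0 h0] := ev_all hC; pose D := (\sum_j C j)%N.
have {hC}hD j d : (`|df j F (d0 + d)%MM| <= D * (mdeg d0 + mdeg d).+1 ^ r)%N.
  rewrite -mdegD; apply: leq_trans (h0 d j) _.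
  by rewrite leq_mul2r /D (bigD1 j) //= leq_addr orbT.
pose A := (`|F d0| + D * (mdeg d0).+1 ^ r)%N.
exists A, d0 => d; rewrite (expnSr _ r.+1) mulnA leq_pmul2r //.
suff : (`|F (d0 + d)%MM| <= `|F d0| + mdeg d * (D * (mdeg d0 + mdeg d).+1 ^ r))%N.
  move/leq_trans; apply; rewrite /A mulnDl; apply: leq_add.
    by rewrite leq_pmulr // expn_gt0.
  have : (D * (mdeg d0 + mdeg d).+1 ^ r <= D * ((mdeg d0).+1 * (mdeg d).+1) ^ r)%N.
    by apply: leq_mulX; nia.
  rewrite (expnSr _ r) expnMn; set X := (_ ^ r)%N; set Y := (_ ^ r)%N.
  set Z := (_ ^ r)%N; nia.
elim/mnm_ind: d => [|d j IHd]; first by rewrite addm0 leq_addr.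
have e : F (d0 + (d + U_(j)))%MM = F (d0 + d)%MM + df j F (d0 + d)%MM.
  by rewrite /df addmA addrC subrK.
have le : (D * (mdeg d0 + mdeg d).+1 ^ r <= D * (mdeg d0 + mdeg (d + U_(j))).+1 ^ r)%N.
  by rewrite leq_mulX // mdegDU addnS.
have := hD j d; rewrite e mdegDU in le *; move: IHd le.
set X := (D * _)%N; set Y := (D * _)%N; nia.
Qed.

(* Differences of step t; on a function whose iterated difference is a constant
   c, r of them give t ^ r * c. *)
Definition dft t j F : deg -> int := fun d => F (d + U_(j) *+ t)%MM - F d.

Lemma diffs_dft bs t F c d0 : (forall d, diffs bs F (d0 + d)%MM = c) -> forall d,
  foldl (fun F j => dft t j F) F bs (d0 + d)%MM = c * (t ^ size bs)%:Z.
Proof.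
have dftC i j G : dft t i (df j G) =1 df j (dft t i G).
  by move=> d; rewrite /df /dft -!addmA (addmC U_(j)%MM); ring.
have eqf s G H : G =1 H -> foldl (fun F j => dft t j F) G s =1
    foldl (fun F j => dft t j F) H s.
  by elim: s G H => //= j s IHs G H h; apply: IHs => d; rewrite /dft !h.
have dftsC s j G : foldl (fun F j => dft t j F) (df j G) s =1
    df j (foldl (fun F j => dft t j F) G s).
  elim: s G => //= i s IHs G d; rewrite -IHs; exact: eqf.
elim/last_ind: bs F c => [|bs j IHb] F c; first by move=> h d; rewrite mulr1; apply: h.
rewrite size_rcons -cats1 diffs_cat /= => h d.
have h1 : forall d, diffs bs (df j F) (d0 + d)%MM = c.
  by move=> d'; rewrite -(h d'); apply: diffs_df.
have {}h1 := IHb _ _ h1; rewrite foldl_cat /=.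
set G := foldl _ F bs; set b := (c * (t ^ size bs)%:Z) in h1.
have hG d' : G (d0 + d' + U_(j))%MM = b + G (d0 + d')%MM.
  by rewrite -[b](h1 d') dftsC /df subrK.
suff E s : G (d0 + d + U_(j) *+ s)%MM = b * s%:Z + G (d0 + d)%MM.
  by rewrite /dft E addrK /b expnSr PoszM mulrA.
elim: s => [|s IHs]; first by rewrite mulm0n addm0 mulr0 add0r.
have -> : (d0 + d + U_(j) *+ s.+1)%MM = (d0 + (d + U_(j) *+ s) + U_(j))%MM.
  by rewrite mulmSr !addmA.
by rewrite hG addmA IHs; ring.
Qed.

(** Each difference of step t at most doubles the bound and moves the argument by at most t. *)
Lemma leq_dft bs t F d0 (B : nat) :
  (forall d, (mdeg d <= t * size bs)%N -> (`|F (d0 + d)%MM| <= B)%N) ->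
  (`|foldl (fun F j => dft t j F) F bs d0| <= 2 ^ size bs * B)%N.
Proof.
elim: bs F B => [|j bs IHb] F B h /=.
  by have := h 0%MM; rewrite addm0 mdeg0 mul1n => ->.
rewrite expnSr -mulnA; apply: IHb => d' hd; rewrite /dft.
have h1 := h d'; have h2 := h (d' + U_(j) *+ t)%MM; rewrite addmA in h2.
have {}h1 := h1 (leq_trans hd _); have {}h2 : (`|F (d0 + d' + U_(j) *+ t)%MM| <= B)%N.
  by apply: h2; rewrite mdegD mdegMn mdeg1 mul1n /= mulnS addnC leq_add2l.
have {}h1 : (`|F (d0 + d')%MM| <= B)%N by apply: h1; rewrite /= mulnS leq_addl.
move: h1 h2; lia.
Qed.

(** The differences of order r + 1 are eventually constants c. With steps of length t they become c
    t^(r+1), whereas the growth of F bounds them by O(t^r); so c = 0. *)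
Lemma deglt_drop r F : deglt r.+2 F -> growth r.+1 F -> deglt r.+1 F.
Proof.
move=> h [C [d0 hC]]; apply: deglt_diffs => bs hbs.
have [c [d1 hc]] : exists c, ev (fun d => diffs bs F d = c).
  by apply: diffs_const; rewrite hbs.
suff c0 : c = 0 by rewrite c0 in hc; exists d1.
(* B bounds |c| t for t >= 1: the difference involves 2^(r+1) values of F, each at most C (t (A + r
   + 1))^r, and t^r cancels. *)
pose A := (mdeg d1).+1; pose B := (2 ^ r.+1 * C * (A + r.+1) ^ r)%N.
have H t : (`|c| * t.+1 <= B)%N.
  have h1 := diffs_dft t.+1 hc d0; rewrite hbs in h1.
  have h2 d : (mdeg d <= t.+1 * size bs)%N ->
      (`|F (d1 + d0 + d)%MM| <= C * (t.+1 * (A + r.+1)) ^ r)%N.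
    rewrite hbs => hd; have := hC (d1 + d)%MM; rewrite (expnSr _ r) mulnA leq_pmul2r //.
    rewrite addmA (addmC d0) => /leq_trans; apply; apply: leq_mulX.
    by rewrite mdegD /A; nia.
  have := leq_dft h2; rewrite h1 hbs abszM absz_nat expnMn.
  rewrite expnSr mulnA [(_ * (C * _))%N]mulnCA !mulnA -/A.
  have -> : (C * 2 ^ r.+1 * t.+1 ^ r * (A + r.+1) ^ r = B * t.+1 ^ r)%N.
    by rewrite /B; ring.
  by rewrite -mulnA mulnCA mulnC leq_pmul2r // expn_gt0.
(* With step B + 1 the bound reads |c| (B + 1) <= B. *)
by have := H B; nia.
Qed.

Lemma growth_leq r s F : (r <= s)%N -> growth r F -> growth s F.
Proof.
move=> h [C [d0 hC]]; exists C, d0 => d; apply: leq_trans (hC d) _.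
by rewrite leq_mul2l leq_pexp2l // orbT.
Qed.

Lemma deglt_of_growth r s F : (0 < r)%N -> deglt s F -> growth r F -> deglt r F.
Proof.
move=> r0; elim: s => [|s IHs] hs hr; first exact: deglt_leq hs.
have [le|lt] := leqP s.+1 r; first exact: deglt_leq hs.
apply: IHs => //; case: s lt hs => [|s] lt hs; first by lia.
exact: deglt_drop hs (growth_leq _ hr).
Qed.

(** A bound alone does not make F polynomial: [deglt s F] gives some degree, which the growth of G
    then lowers to that of G. *)
Lemma deglt_dom r s F G : deglt s F -> deglt r G ->
  ev (fun d => 0 <= F d <= G d) -> deglt r F.
Proof.
move=> hF hG h; case: r hG => [|r] hG.
  by apply: ev_and2 hG h => d -> ; rewrite -eq_le eq_sym => /eqP.
apply: deglt_of_growth hF _ => //; have [C [d0 hC]] := deglt_growth hG.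
have [d1 {}h] := h; exists (C * (mdeg d1).+1 ^ r.+1)%N, (d0 + d1)%MM => d.
have := hC (d1 + d)%MM; have := h (d0 + d)%MM; rewrite !addmA (addmC d1 d0) => h1 h2.
have le : ((mdeg d).+1 <= (mdeg (d1 + d)).+1 <= (mdeg d1).+1 * (mdeg d).+1)%N.
  by rewrite mdegD; nia.
rewrite -mulnA -expnMn; case/andP: le => le1 le2.
apply: leq_trans (leq_mulX _ _ le2); apply: leq_trans h2.
by apply: leq_mul => //; move: h1; lia.
Qed.

End EventuallyPolynomial.

Lemma pred_ext X (P Q : X -> Prop) : same P Q -> P = Q.
Proof. by move=> h; apply: functional_extensionality => x; apply/propositional_extensionality. Qed.

(** * Dimensions of quotients of predicates *)

Section RelativeDimension.
Variables (K : fieldType) (E : lmodType K).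
Implicit Types (V W J : E -> Prop).

Definition subsp J := J 0 /\ forall a x y, J x -> J y -> J (a *: x + y).

Definition indep J n (b : 'I_n -> E) :=
  forall c : 'I_n -> K, J (\sum_i c i *: b i) -> forall i, c i = 0.

Definition spans V J n (b : 'I_n -> E) :=
  forall x, V x -> exists c : 'I_n -> K, J (x - \sum_i c i *: b i).

(** The dimension of V modulo J, through a basis, as V and J are bare predicates. *)
Definition rdim V J n := exists b : 'I_n -> E,
  [/\ forall i, V (b i), indep J b & spans V J b].

Lemma subspD J x y : subsp J -> J x -> J y -> J (x + y).
Proof. by move=> [_ h] hx hy; have := h 1 _ _ hx hy; rewrite scale1r. Qed.

Lemma subspZ J a x : subsp J -> J x -> J (a *: x).
Proof. by move=> [h0 h] hx; have := h a _ _ hx h0; rewrite addr0. Qed.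

Lemma subspB J x y : subsp J -> J x -> J y -> J (x - y).
Proof. by move=> hJ hx hy; rewrite -scaleN1r; apply: subspD => //; apply: subspZ. Qed.

Lemma subsp_sum J (I : finType) (F : I -> E) :
  subsp J -> (forall i, J (F i)) -> J (\sum_i F i).
Proof.
move=> hJ h; elim/big_ind: _ => //; first by case: hJ.
by move=> x y; apply: subspD.
Qed.

Lemma indep_le J m n (a : 'I_m -> E) (b : 'I_n -> E) : subsp J -> indep J a ->
  (forall i, exists c : 'I_n -> K, J (a i - \sum_j c j *: b j)) -> (m <= n)%N.
Proof.
move=> hJ ha /(_ _) h; rewrite leqNgt; apply/negP => lt.
have [c hc] := functional_choice h.
pose A := \matrix_(i < m, j < n) c i j.
have : kermx A != 0.
  by rewrite kermx_eq0 /row_free neq_ltn (leq_ltn_trans (rank_leq_col A) lt).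
case/rowV0Pn => u /sub_kermxP hu; case/rV0Pn => i0; case/negP; apply/eqP.
apply: (ha (fun i => u 0 i)).
have -> : \sum_i u 0 i *: a i = \sum_i u 0 i *: (a i - \sum_j c i j *: b j).
  under [RHS]eq_bigr do rewrite scalerBr scaler_sumr.
  rewrite sumrB exchange_big /= [X in _ - X]big1 ?subr0 // => j _.
  under eq_bigr do rewrite scalerA.
  rewrite -scaler_suml; move/rowP: hu => /(_ j); rewrite !mxE => hu.
  by rewrite (eq_bigr (fun i => u 0 i * A i j)) ?hu ?scale0r // => i _; rewrite mxE.
by apply: subsp_sum => // i; apply: subspZ.
Qed.

Lemma rdim_uniq V J m n : subsp J -> rdim V J m -> rdim V J n -> m = n.
Proof.
move=> hJ [a [aV ia sa]] [b [bV ib sb]]; apply/eqP; rewrite eqn_leq.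
apply/andP; split; first by apply: (indep_le hJ ia (b := b)) => i; apply: sb.
by apply: (indep_le hJ ib (b := a)) => i; apply: sa.
Qed.

Lemma indep_rdim V J m n (a : 'I_m -> E) : subsp J -> rdim V J n ->
  (forall i, V (a i)) -> indep J a -> (m <= n)%N.
Proof. by move=> hJ [b [_ _ sb]] aV ia; apply: indep_le hJ ia _ => i; apply: sb. Qed.

Lemma rdim_ex V J n (b : 'I_n -> E) : subsp J -> (forall i, V (b i)) ->
  spans V J b -> exists m, rdim V J m.
Proof.
elim: n b => [|n IHn] b hJ bV sb.
  by exists 0%N, b; split=> // c _; case.
have [ib|/not_all_ex_not [c hc]] := classic (indep J b); first by exists n.+1, b.
have {hc} [Jc /not_all_ex_not [i0 /eqP ci0]] := imply_to_and _ _ hc.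
apply: (IHn (b \o lift i0)) => //; first by move=> i; apply: bV.
move=> x /sb [e he]; exists (fun j => e (lift i0 j) - e i0 / c i0 * c (lift i0 j)).
rewrite (bigD1_ord i0) //= in he; rewrite (bigD1_ord i0) //= in Jc.
have -> : \sum_i (e (lift i0 i) - e i0 / c i0 * c (lift i0 i)) *: (b \o lift i0) i =
    \sum_i e (lift i0 i) *: b (lift i0 i)
      - (e i0 / c i0) *: \sum_i c (lift i0 i) *: b (lift i0 i).
  by rewrite scaler_sumr -sumrB; apply: eq_bigr => i _; rewrite scalerA -scalerBl.
have := subspD hJ he (subspZ (e i0 / c i0) hJ Jc).
rewrite scalerDr scalerA divfK // !opprD !addrA opprK; congr (J (_ + _)).
by rewrite addrAC subrK.
Qed.

(** Representatives of bases of V / J' and of the part of V / J inside J' concatenate to a basis. *)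
Lemma rdimD V J J' m n : subsp V -> subsp J -> subsp J' -> incl J J' ->
  rdim V J' n -> rdim (fun x => V x /\ J' x) J m -> rdim V J (n + m).
Proof.
move=> hV hJ hJ' le [b [bV ib sb]] [a [aV ia sa]].
pose d (i : 'I_(n + m)) := match split i with inl i => b i | inr i => a i end.
have dl i : d (lshift m i) = b i by rewrite /d (unsplitK (inl i)).
have dr i : d (rshift n i) = a i by rewrite /d (unsplitK (inr i)).
exists d; split.
- by move=> i; rewrite /d; case: split => // j; case: (aV j).
- move=> c; rewrite big_split_ord /=.
  under eq_bigr do rewrite dl; under [X in _ + X]eq_bigr do rewrite dr.
  move=> h; have c1 i : c (lshift m i) = 0.
    apply: (ib (fun i => c (lshift m i))).
    rewrite -[X in J' X](addrK (\sum_i c (rshift n i) *: a i)).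
    apply: subspB => //; first exact: le.
    by apply: subsp_sum => // j; apply: subspZ => //; case: (aV j).
  move: h; rewrite big1 ?add0r; last by move=> i _; rewrite c1 scale0r.
  move=> /ia c2 i; case: (split_ordP i) => j ->; [exact: c1 | exact: c2].
- move=> x Vx; have [c hc] := sb x Vx.
  have hy : V (x - \sum_i c i *: b i) /\ J' (x - \sum_i c i *: b i).
    by split=> //; apply: subspB => //; apply: subsp_sum => // i; apply: subspZ.
  have [e he] := sa _ hy.
  exists (fun i => match split i with inl i => c i | inr i => e i end).
  rewrite big_split_ord /=; move: he; rewrite -addrA -opprD; congr (J (_ - (_ + _))).
    by apply: eq_bigr => i _; rewrite dl (unsplitK (inl i)).
  by apply: eq_bigr => i _; rewrite dr (unsplitK (inr i)).
Qed.

End RelativeDimension.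

Lemma rdim_iso (K : fieldType) (E E' : lmodType K) (V J : E -> Prop)
    (V' J' : E' -> Prop) (f : {linear E -> E'}) n :
  subsp V -> subsp J' -> (forall x, V x -> V' (f x)) -> (forall x, V x -> J x <-> J' (f x)) ->
  (forall y, V' y -> exists2 x, V x & J' (y - f x)) ->
  rdim V J n -> rdim V' J' n.
Proof.
move=> hV hJ' VV' JJ' surj [b [bV ib sb]]; exists (f \o b).
have fs (c : 'I_n -> K) : f (\sum_i c i *: b i) = \sum_i c i *: f (b i).
  by rewrite linear_sum; apply: eq_bigr => i _; rewrite linearZ.
have Vs (c : 'I_n -> K) : V (\sum_i c i *: b i).
  by apply: subsp_sum => // i; apply: subspZ.
split; first by move=> i; apply/VV'.
- by move=> c; rewrite /= -fs => /JJ' h; apply: ib; apply: h.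
- move=> y /surj [x Vx hx]; have [c hc] := sb x Vx; exists c => /=.
  rewrite -fs -(subrK (f x) y) -addrA -linearB; apply: subspD => //.
  by apply/JJ' => //; apply: subspB.
Qed.

(** * Ideals, chain condition, zeros of primes *)

Section Ideals.
Variable A : comNzRingType.
Implicit Types (J Q P : A -> Prop).

Definition ideal Q :=
  [/\ Q 0, forall p q, Q p -> Q q -> Q (p + q) & forall p q, Q q -> Q (p * q)].

Definition prime_ideal P :=
  [/\ ideal P, ~ P 1 & forall p q, P (p * q) -> P p \/ P q].

Definition adjoin J x : A -> Prop := fun p => exists2 q, J q & exists a, p = q + a * x.
Definition colon J x : A -> Prop := fun p => J (p * x).

Lemma ideal0 J : ideal J -> J 0. Proof. by case. Qed.

Lemma idealD J p q : ideal J -> J p -> J q -> J (p + q).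
Proof. by case=> _ h _; apply: h. Qed.

Lemma ideal_mull J p q : ideal J -> J q -> J (p * q).
Proof. by case=> _ _ h; apply: h. Qed.

Lemma ideal_mulr J p q : ideal J -> J p -> J (p * q).
Proof. by rewrite mulrC; apply: ideal_mull. Qed.

Lemma idealN J p : ideal J -> J p -> J (- p).
Proof. by rewrite -mulN1r; apply: ideal_mull. Qed.

Lemma idealB J p q : ideal J -> J p -> J q -> J (p - q).
Proof. by move=> hJ hp hq; apply: idealD => //; apply: idealN. Qed.

Lemma idealDr J p q : ideal J -> J q -> J (p + q) <-> J p.
Proof.
move=> hJ hq; split=> h; last exact: idealD.
by rewrite -(addrK q p); apply: idealB.
Qed.

Lemma ideal_sum J I (s : seq I) (Q : pred I) (F : I -> A) :
  ideal J -> (forall i, Q i -> J (F i)) -> J (\sum_(i <- s | Q i) F i).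
Proof.
move=> hJ h; elim/big_ind: _ => //; first exact: ideal0.
by move=> x y; apply: idealD.
Qed.

Lemma ideal_adjoin J x : ideal J -> ideal (adjoin J x).
Proof.
move=> hJ; split.
- by exists 0; [exact: ideal0 | exists 0; rewrite mul0r addr0].
- move=> _ _ [q hq [a ->]] [q' hq' [a' ->]].
  by exists (q + q'); [exact: idealD | exists (a + a'); ring].
- move=> p _ [q hq [a ->]]; exists (p * q); first exact: ideal_mull.
  by exists (p * a); ring.
Qed.

Lemma ideal_colon J x : ideal J -> ideal (colon J x).
Proof.
move=> hJ; rewrite /colon; split; first by rewrite mul0r; apply: ideal0.
- by move=> p q hp hq; rewrite mulrDl; apply: idealD.
- by move=> p q hq; rewrite -mulrA; apply: ideal_mull.
Qed.

Lemma sub_adjoin J x : incl J (adjoin J x).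
Proof. by move=> p hp; exists p => //; exists 0; rewrite mul0r addr0. Qed.

Lemma mem_adjoin J x : ideal J -> adjoin J x x.
Proof. by move=> /ideal0 h; exists 0 => //; exists 1; rewrite mul1r add0r. Qed.

Lemma adjoin_sub J J' x : ideal J' -> incl J J' -> J' x -> incl (adjoin J x) J'.
Proof. by move=> hJ le hx _ [q /le hq [a ->]]; apply: idealD => //; apply: ideal_mull. Qed.

Lemma sub_colon J x : ideal J -> incl J (colon J x).
Proof. by move=> hJ p; apply: ideal_mulr. Qed.

Lemma prime_exp P p k : prime_ideal P -> P (p ^+ k) -> P p.
Proof.
move=> [hP h1 hM]; elim: k => [|k IHk]; first by rewrite expr0.
by rewrite exprS => /hM [].
Qed.

Definition acc := forall J : nat -> A -> Prop, (forall n, ideal (J n)) ->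
  (forall n, incl (J n) (J n.+1)) -> exists n, forall m, (n <= m)%N -> incl (J m) (J n).

Lemma incl_nat X (J : nat -> X -> Prop) m n :
  (forall n, incl (J n) (J n.+1)) -> (m <= n)%N -> incl (J m) (J n).
Proof.
move=> h /subnK <-; elim: (n - m)%N => [|i IHi] x //.
by rewrite addSn => /IHi /h.
Qed.

(** A counterexample would have a strictly larger counterexample, and repeated choice would give a
    chain that never becomes stationary. *)
Lemma noeth_ind (Phi : (A -> Prop) -> Prop) : acc ->
  (forall J, ideal J -> (forall J', ideal J' -> strict_incl J J' -> Phi J') -> Phi J) ->
  forall J, ideal J -> Phi J.
Proof.
move=> ha step J0 hJ0; apply: NNPP => n0.
have ex (J : {J | ideal J /\ ~ Phi J}) :
    exists J' : {J | ideal J /\ ~ Phi J}, strict_incl (sval J) (sval J').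
  case: J => J [hJ nJ] /=; apply: NNPP => h; apply/nJ/step => // J' hJ' lt.
  by apply: NNPP => n'; apply: h; exists (exist _ J' (conj hJ' n')).
have [next hnext] := functional_choice ex.
pose c n := iter n next (exist _ J0 (conj hJ0 n0)).
have [n hn] := ha (fun n => sval (c n)) (fun n => proj1 (svalP (c n)))
  (fun n => proj1 (hnext (c n))).
exact: (proj2 (hnext (c n))) (hn n.+1 (leqnSn n)).
Qed.

End Ideals.

Lemma acc_surj (A B : comNzRingType) (f : {rmorphism A -> B}) :
  (forall y, exists x, f x = y) -> acc A -> acc B.
Proof.
move=> sf ha J hJ le.
have [||n hn] := ha (fun n x => J n (f x)).
- move=> n; split; rewrite ?rmorph0; first exact: ideal0.
    by move=> p q hp hq; rewrite rmorphD; apply: idealD.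
  by move=> p q hq; rewrite rmorphM; apply: ideal_mull.
- by move=> n x; apply: le.
- by exists n => m hm y hy; have [x xy] := sf y; rewrite -xy; apply: (hn m) => //=; rewrite xy.
Qed.

(* The ideals of leading coefficients L i d form a chain in both i and d. *)
Lemma acc_poly (A : comNzRingType) : acc A -> acc {poly A}.
Proof.
move=> ha J hJ le.
pose L i d a := exists p : {poly A}, [/\ J i p, (size p <= d.+1)%N & p`_d = a].
have hL i d : ideal (L i d).
  split; first by exists 0; rewrite size_poly0 coef0; split=> //; apply: ideal0.
  - move=> _ _ [p [Jp sp <-]] [q [Jq sq <-]]; exists (p + q); rewrite coefD; split=> //.
      exact: idealD.
    by rewrite (leq_trans (size_polyD _ _)) // geq_max sp.
  - move=> a _ [q [Jq sq <-]]; exists (a%:P * q); rewrite coefCM; split=> //.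
      exact: ideal_mull.
    by rewrite mul_polyC (leq_trans (size_scale_leq _ _)).
have Li d i j : (i <= j)%N -> incl (L i d) (L j d).
  move=> ij x [p [Jp sp <-]]; exists p; split=> //; exact: (incl_nat le ij).
have Ld i d : incl (L i d) (L i d.+1).
  move=> x [p [Jp sp <-]]; exists ('X * p); split; first exact: ideal_mull.
    by rewrite (leq_trans (size_polyMleq _ _)) // size_polyX.
  by rewrite coefXM.
have [n0 hn0] := ha (fun n => L n n) (fun n => hL n n)
  (fun n x h => Ld n.+1 n x (Li n n n.+1 (leqnSn n) x h)).
have st d : exists n, forall m, (n <= m)%N -> incl (L m d) (L n d).
  by apply: (ha (fun n => L n d)) => // n; apply: Li.
have [s hs] := functional_choice st.
(* For d < n0 the ideals [L m d] are stationary from [s d] on. For d >= n0 they lie in the diagonal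
   ideal of index max m d, and the diagonal is stationary from n0 on. *)
pose N := maxn n0 (\max_(d < n0) s d).
have hN m d : (N <= m)%N -> incl (L m d) (L N d).
  rewrite geq_max => /andP[h1 h2] x hx; have [lt|ge] := ltnP d n0.
    apply: (Li d (s d)); first by rewrite leq_max (leq_bigmax (Ordinal lt)) orbT.
    by apply: hs hx; apply: leq_trans h2; apply: (leq_bigmax (Ordinal lt)).
  apply: (Li d n0); first by rewrite leq_maxl.
  have : L (maxn m d) (maxn m d) x.
    apply: (Li _ m); rewrite ?leq_maxl //.
    exact: (incl_nat (Ld m) (leq_maxr m d)).
  move/(hn0 _ (leq_trans h1 (leq_maxl m d))); exact: (incl_nat (Ld n0) ge).
exists N => m hm p; move: {2}(size p).+1 (ltnSn (size p)) => k.
elim: k p => // k IHk p sp Jp; have [->|p0] := eqVneq p 0; first exact: ideal0.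
have : L m (size p).-1 (lead_coef p) by exists p; split=> //; rewrite prednK // size_poly_gt0.
case/(hN m _ hm) => q [Jq sq cq].
rewrite -(subrK q p); apply: idealD => //; apply: IHk; last first.
  by apply: idealB => //; apply: (incl_nat le hm).
rewrite ltnS in sp; apply: leq_trans sp; rewrite -[X in (_ < X)%N](@prednK (size p)) ?size_poly_gt0 //.
rewrite ltnS; rewrite prednK ?size_poly_gt0 // in sq.
apply/leq_sizeP => j; rewrite leq_eqVlt => /predU1P[<-|lt].
  by rewrite coefB cq /lead_coef subrr.
have le' : (size p <= j)%N by rewrite -[size p]prednK ?size_poly_gt0.
by rewrite coefB !nth_default ?subrr // (leq_trans sq).
Qed.

(** * Adding a variable *)

Section LastVariable.
Variables (n : nat) (R : comNzRingType).

Definition mjoin (p : {poly {mpoly R[n]}}) : {mpoly R[n.+1]} :=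
  (horner_eval ('X_ord_max : {mpoly R[n.+1]}) \o map_poly (@mwiden n R)) p.

HB.instance Definition _ := GRing.RMorphism.copy mjoin
  (horner_eval ('X_ord_max : {mpoly R[n.+1]}) \o map_poly (@mwiden n R)).

Lemma mjoinC p : mjoin p%:P = mwiden p.
Proof. by rewrite /mjoin /= /horner_eval map_polyC hornerC. Qed.

Lemma mjoinX : mjoin 'X = 'X_ord_max.
Proof. by rewrite /mjoin /= /horner_eval map_polyX hornerX. Qed.

Lemma mjoin_surj p : exists q, mjoin q = p.
Proof.
elim/mpolyind: p => [|c m p _ _ [q <-]]; first by exists 0; rewrite rmorph0.
exists ((c *: 'X_[[multinom m (widen_ord (leqnSn n) i) | i < n]])%:P * 'X^(m ord_max) + q).
rewrite rmorphD rmorphM rmorphXn /= mjoinX mjoinC mwidenZ mwidenX -scalerAl.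
congr (_ *: _ + _); rewrite mpolyXn -mpolyXD; congr 'X_[_].
apply/mnmP => i; rewrite mnmDE mulmnE mnm1E.
case: (unliftP ord_max i) => [j ->|->].
  have -> : lift ord_max j = widen_ord (leqnSn n) j.
    by apply/val_inj; rewrite /= /bump leqNgt ltn_ord.
  by rewrite mnmwiden_widen mnmE -val_eqE /= gtn_eqF // mul0n addn0.
by rewrite mnmwiden_ordmax eqxx mul1n.
Qed.

Lemma meval_mwiden (p : {mpoly R[n]}) v :
  (mwiden p).@[v] = p.@[fun i => v (widen_ord (leqnSn n) i)].
Proof.
elim/mpolyind: p => [|c m p _ _ IHp]; first by rewrite mwiden0 !meval0.
rewrite mwidenD mwidenZ mwidenX !mevalD !mevalZ IHp !mevalX.
congr (_ * _ + _); rewrite big_ord_recr /= mnmwiden_ordmax expr0 mulr1.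
by apply: eq_bigr => i _; rewrite mnmwiden_widen.
Qed.

Lemma meval_mjoin p v : (mjoin p).@[v] =
  (map_poly (meval (fun i => v (widen_ord (leqnSn n) i))) p).[v ord_max].
Proof.
elim/poly_ind: p => [|p c IHp]; first by rewrite !rmorph0 horner0.
rewrite !rmorphD !rmorphM /= mjoinX mjoinC map_polyX map_polyC /=.
by rewrite !hornerE -IHp mevalXU meval_mwiden.
Qed.

End LastVariable.

Lemma acc_mpoly (K : fieldType) n : acc {mpoly K[n]}.
Proof.
elim: n => [|n IHn]; last exact: acc_surj (@mjoin_surj n K) (acc_poly IHn).
move=> J hJ le; have [h|h] := classic (exists n, J n 1).
  case: h => n hn; exists n => m _ x _; rewrite -[x]mulr1; exact: ideal_mull.
exists 0%N => m _ x hx; have [->|x0] := eqVneq x 0; first exact: ideal0.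
case: h; exists m; rewrite (nvar0_mpolyC x) in hx x0 *; rewrite mpolyC_eq0 in x0.
rewrite -[1]/(1%:MP) -(mulVf x0) mpolyCM; exact: ideal_mull.
Qed.

(** * Zeros of prime ideals *)

Section ExtendZero.
Variables (A : idomainType) (P : {poly A} -> Prop) (g : {poly A}).
Hypotheses (primeP : prime_ideal P) (Pg : ~ P g).

Let P' (a : A) : Prop := P a%:P.
(** The extension P' A[X] of the contraction P' of P to A. *)
Let Px (p : {poly A}) : Prop := forall i, P' p`_i.
Let idP : ideal P := let: And3 h _ _ := primeP in h.
Let prP p q : P (p * q) -> P p \/ P q := let: And3 _ _ h := primeP in h p q.

Lemma contraction_prime : prime_ideal P'.
Proof.
rewrite /P'; split; last by move=> p q; rewrite polyCM; apply: prP.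
- split; first by rewrite polyC0; apply: ideal0.
    by move=> p q hp hq; rewrite polyCD; apply: idealD.
  by move=> p q hq; rewrite polyCM; apply: ideal_mull.
- by rewrite polyC1; case: primeP.
Qed.

Let idP' : ideal P' := let: And3 h _ _ := contraction_prime in h.

Let Px_sub : incl Px P.
Proof.
move=> p hp; rewrite -[p]coefK poly_def; apply: ideal_sum => // i _.
by rewrite -mul_polyC; apply: ideal_mulr => //; apply: hp.
Qed.

Let PxM p q : Px p -> Px (p * q).
Proof. by move=> h i; rewrite coefM; apply: ideal_sum => // j _; apply: ideal_mulr. Qed.

Let powP' a k : P' (a ^+ k) -> P' a.
Proof. exact: (prime_exp contraction_prime). Qed.

(** An element of least degree outside P' A[X] cannot have its leading coefficient in P': otherwise
    removing its leading term, which lies in P, would leave an element of smaller degree outside P'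
    A[X]. *)
Let minimal (Q : {poly A} -> Prop) : ideal Q -> incl P Q -> (exists2 q, Q q & ~ Px q) ->
  exists q, [/\ Q q, ~ P' (lead_coef q) & forall r, Q r -> (size r < size q)%N -> Px r].
Proof.
move=> hQ PQ [q0 Qq0 nq0].
have [q [Qq nq min]] : exists q, [/\ Q q, ~ Px q &
    forall r, Q r -> (size r < size q)%N -> Px r].
  elim/ltn_ind: {q0}(size q0) {-2}q0 (erefl (size q0)) Qq0 nq0 => s IHs q sq Qq nq.
  have [h|h] := classic (forall r, Q r -> (size r < size q)%N -> Px r); first by exists q.
  have [r hr] := not_all_ex_not _ _ h; have [Qr h1] := imply_to_and _ _ hr.
  have [lt nr] := imply_to_and _ _ h1; apply: (IHs (size r)) (erefl _) Qr nr.
  by rewrite -sq.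
exists q; split=> // hl; apply: (nq).
have qn0 : q != 0.
  apply/negP => /eqP qz; apply: nq => i; rewrite qz coef0; exact: ideal0.
have e : q = (q - lead_coef q *: 'X^((size q).-1)) + lead_coef q *: 'X^((size q).-1).
  by rewrite subrK.
have h1 : Px (lead_coef q *: 'X^((size q).-1)).
  by move=> i; rewrite coefZ; apply: ideal_mulr.
suff h2 : Px (q - lead_coef q *: 'X^((size q).-1)).
  by move=> i; rewrite e coefD; apply: idealD.
apply: min; first by apply: idealB => //; apply/PQ/Px_sub.
rewrite -[X in (_ < X)%N](@prednK (size q)) ?size_poly_gt0 // ltnS.
apply/leq_sizeP => j; rewrite coefB coefZ coefXn leq_eqVlt => /predU1P[<-|lt].
  by rewrite eqxx mulr1 subrr.
rewrite gtn_eqF // mulr0 nth_default ?subr0 //.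
by rewrite -[size q](@prednK) ?size_poly_gt0.
Qed.

Let pseudo (p q : {poly A}) : q != 0 -> exists k u r,
  lead_coef q ^+ k *: p = u * q + r /\ (size r < size q)%N.
Proof.
move=> q0; exists (Pdiv.Ring.rscalp p q), (Pdiv.Ring.rdivp p q), (Pdiv.Ring.rmodp p q).
by rewrite Pdiv.ComRing.rdivp_eq Pdiv.Ring.ltn_rmodpN0.
Qed.

Let nlead0 q : ~ P' (lead_coef q) -> q != 0.
Proof. by move=> h; apply/negP => /eqP e; apply: h; rewrite e lead_coef0; apply: ideal0. Qed.

(** A specialization phi of A / P' extends to A[X] / P by sending X to t. If P = P' A[X], then g' is
    a coefficient of g outside P', and t avoids the roots of phi(g). Otherwise t is a root of
    phi(p), for p of least degree in P outside P' A[X]; by pseudo-division p generates P up to P'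
    A[X] and powers of its leading coefficient. *)
Lemma extend_zero (K : closedFieldType) : exists2 g', ~ P' g' &
  forall phi : {rmorphism A -> K}, (forall a, P' a -> phi a = 0) -> phi g' != 0 ->
  exists2 t, forall p, P p -> (map_poly phi p).[t] = 0 & (map_poly phi g).[t] != 0.
Proof.
have [h|h] := classic (forall p, P p -> Px p).
  have /not_all_ex_not [i gi] : ~ Px g by move/Px_sub.
  exists g`_i => // phi h0 hg.
  have /closed_nonrootP [t ht] : map_poly phi g != 0.
    by apply: contraNneq hg => e; rewrite -coef_map e coef0.
  exists t => // p /h hp; rewrite (_ : map_poly phi p = 0) ?horner0 //.
  by apply/polyP => j; rewrite coef_map coef0 /= h0 //; apply: hp.
have exP : exists2 q, P q & ~ Px q.
  by have [q hq] := not_all_ex_not _ _ h; have [] := imply_to_and _ _ hq; exists q.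
have [p [Pp np minp]] := minimal idP (fun _ h => h) exP.
have p0 := nlead0 np.
have sp : (1 < size p)%N.
  rewrite ltn_neqAle eq_sym size_poly_gt0 p0 andbT; apply/negP => /size_poly1P [c _ e].
  by apply: np; rewrite e lead_coefC; rewrite e in Pp.
have idQ := ideal_adjoin g idP; have PQ := @sub_adjoin _ P g.
have [|q [Qq nq minq]] := minimal idQ PQ; first by case: exP => q /PQ; exists q.
have q0 := nlead0 nq.
(* If q is not constant, pseudo-division of p by q gives u q in P. Either q is in P, and then
   dividing g by q puts g in P; or u is in P, hence in P' A[X] by its degree, and so is the leading
   coefficient of p up to a factor outside P'. *)
have sq : size q = 1%N.
  apply/eqP; rewrite eqn_leq size_poly_gt0 q0 andbT leqNgt; apply/negP => sq1.
  have divQ x : adjoin P g x -> exists k u r,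
      [/\ lead_coef q ^+ k *: x = u * q + r, (size r < size q)%N & Px r].
    move=> Qx; have [k [u [r [e sr]]]] := pseudo x q0; exists k, u, r; split=> //.
    apply: minq => //; rewrite (_ : r = lead_coef q ^+ k *: x - u * q).
      by rewrite -mul_polyC; apply: idealB => //; apply: ideal_mull.
    by rewrite e addrC addKr.
  have [k [u [r [e sr xr]]]] := divQ p (PQ _ Pp).
  have Puq : P (u * q).
    rewrite (_ : u * q = lead_coef q ^+ k *: p - r); last by rewrite e addrK.
    by rewrite -mul_polyC; apply: idealB => //; [apply: ideal_mull | apply: Px_sub].
  case/prP: (Puq) => [Pu|Pq]; last first.
    have [k' [u' [r' [e' sr' xr']]]] := divQ g (mem_adjoin g idP).
    have : P ((lead_coef q ^+ k')%:P * g).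
      rewrite mul_polyC e'; apply: idealD => //; [exact: ideal_mull | exact: Px_sub].
    by case/prP => // /powP'.
  have xu : Px u.
    apply: minp => //; have [->|u0] := eqVneq u 0; first by rewrite size_poly0; lia.
    have : (size ((u * q)%R) <= size p)%N.
      rewrite (_ : u * q = lead_coef q ^+ k *: p - r); last by rewrite e addrK.
      rewrite (leq_trans (size_polyD _ _)) // size_polyN geq_max size_scale_leq /=.
      by rewrite (leq_trans (ltnW sr)) // leqNgt; apply/negP => lt; case: np; exact: (minq p (PQ _ Pp) lt).
    by rewrite size_mul //; move: sq1; case: (size q) => [|[]] //; lia.
  have : P' (lead_coef q ^+ k * lead_coef p).
    rewrite [lead_coef p]lead_coefE -coefZ e coefD; apply: idealD => //.
    exact: PxM.
  by rewrite /P' polyCM => /prP [/powP'|].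
have [c _ ec] := size_poly1P _ (introT eqP sq).
rewrite ec lead_coefC in nq; rewrite ec in Qq; case: Qq => p' Pp' [w ew].
(* The factor [lead_coef p] preserves the degree of p under phi, so that phi(p) has a root; c = p' +
   w g forces phi(g) to be nonzero there. *)
exists (lead_coef p * c); first by rewrite /P' polyCM => /prP [].
move=> phi h0; rewrite rmorphM mulf_eq0 negb_or => /andP[a0 c0].
have /closed_rootP [t /rootP ht] : size (map_poly phi p) != 1%N.
  by rewrite size_map_poly_id0 //; case: (size p) sp => [|[]].
have hP x : P x -> (map_poly phi x).[t] = 0.
  move=> Px'; have [k [u [r [e sr]]]] := pseudo x p0.
  have xr : Px r.
    apply: minp sr; rewrite (_ : r = lead_coef p ^+ k *: x - u * p).
      by rewrite -mul_polyC; apply: idealB => //; apply: ideal_mull.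
    by rewrite e addrC addKr.
  have := congr1 (fun y => (map_poly phi y).[t]) e.
  rewrite map_polyZ /= rmorphD rmorphM /= hornerZ hornerD hornerM ht mulr0 add0r.
  rewrite (_ : map_poly phi r = 0) ?horner0; last first.
    by apply/polyP => j; rewrite coef_map coef0 /= h0 //; apply: xr.
  by move/eqP; rewrite mulf_eq0 rmorphXn expf_eq0 (negPf a0) andbF /= => /eqP.
exists t => //; apply: contraNneq c0 => g0.
have := congr1 (fun y => (map_poly phi y).[t]) ew.
by rewrite map_polyC hornerC rmorphD rmorphM /= hornerD hornerM g0 mulr0 addr0 hP // => ->.
Qed.

End ExtendZero.

Lemma prime_preim (A B : comNzRingType) (f : {rmorphism A -> B}) (P : B -> Prop) :
  prime_ideal P -> prime_ideal (fun x => P (f x)).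
Proof.
case=> hP h1 hM; split; rewrite ?rmorph1 //.
  split; rewrite ?rmorph0; first exact: ideal0.
    by move=> p q hp hq; rewrite rmorphD; apply: idealD.
  by move=> p q hq; rewrite rmorphM; apply: ideal_mull.
by move=> p q; rewrite rmorphM; apply: hM.
Qed.

(** The Nullstellensatz, by induction on the number of variables: a zero of the contraction of P is
    extended by one coordinate. Avoiding g is part of the induction because the extension works only
    off the zeros of some g'. *)
Lemma prime_zero (K : closedFieldType) n (P : {mpoly K[n]} -> Prop) g :
  prime_ideal P -> ~ P g -> exists2 v, forall p, P p -> p.@[v] = 0 & g.@[v] != 0.
Proof.
elim: n P g => [|n IHn] P g prP Pg.
  have h p : P p -> p = 0.
    rewrite (nvar0_mpolyC p) => hp; have [->|p0] := eqVneq p@_0%MM 0; first exact: mpolyC0.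
    case: prP => hP h1 _; case: h1; rewrite -[1]/(1%:MP) -(mulVf p0) mpolyCM; exact: ideal_mull.
  exists (fun=> 0) => [p /h->|]; first exact: meval0.
  rewrite (nvar0_mpolyC g) mevalC; apply: contra_notN Pg => /eqP g0.
  by rewrite (nvar0_mpolyC g) g0 mpolyC0; case: prP => /ideal0.
have [h hg] := mjoin_surj g.
have prQ := prime_preim (@mjoin n K) prP.
have Qh : ~ P (mjoin h) by rewrite hg.
have [g' Pg' ext] := extend_zero prQ Qh K.
have [v hv hg'] := IHn _ g' (contraction_prime prQ) Pg'.
have [t ht htg] := ext (meval v) hv hg'.
pose w (i : 'I_n.+1) := if unlift ord_max i is Some j then v j else t.
have wv : (fun i => w (widen_ord (leqnSn n) i)) = v.
  apply: functional_extensionality => i.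
  have -> : widen_ord (leqnSn n) i = lift ord_max i.
    by apply/val_inj; rewrite /= /bump leqNgt ltn_ord.
  by rewrite /w liftK.
have wt : w ord_max = t by rewrite /w unlift_none.
exists w; last by rewrite -hg meval_mjoin wv wt.
by move=> p; have [q <-] := mjoin_surj p; rewrite meval_mjoin wv wt; apply: ht.
Qed.

Lemma mpoly_nonzero (K : closedFieldType) n (p : {mpoly K[n]}) :
  p != 0 -> exists v, p.@[v] != 0.
Proof.
move=> p0; have [||v _ hv] := @prime_zero K n (fun x => x = 0) p; last by exists v.
- split; last by move=> x y /eqP; rewrite mulf_eq0 => /orP[]/eqP; [left|right].
    by split=> [|x y -> ->|x y ->]; rewrite ?addr0 ?mulr0.
  by apply/eqP/oner_neq0.
- exact/eqP.
Qed.

(** * Multigraded Hilbert functions *)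

Lemma seq_max disp (T : orderType disp) (s : seq T) (Q : T -> Prop) :
  (exists2 x, x \in s & Q x) ->
  exists x, [/\ x \in s, Q x & forall y, y \in s -> Q y -> (y <= x)%O].
Proof.
elim: s => [[x //]|a s IHs] [x]; have [hs|hs] := classic (exists2 x, x \in s & Q x).
  have [y [ys Qy max]] := IHs hs.
  have [[Qa lt]|h] := classic (Q a /\ (y <= a)%O).
    exists a; rewrite mem_head; split=> // z; rewrite inE => /predU1P[->//|zs Qz].
    exact: le_trans (max _ zs Qz) lt.
  exists y; rewrite inE ys orbT; split=> // z; rewrite inE => /predU1P[->|/max//] Qa.
  by case: leP => // /ltW ya; case: h.
rewrite inE => /predU1P[->|xs] Qx; last by case: hs; exists x.
exists a; rewrite mem_head; split=> // y; rewrite inE => /predU1P[->//|ys Qy].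
by case: hs; exists y.
Qed.

Section Graded.
Variables (K : closedFieldType) (N k : nat) (g : 'I_N -> 'I_k).
Local Notation S := {mpoly K[N]}.
Local Notation deg := 'X_{1..k}.
Implicit Types (J P : S -> Prop) (p q x : S) (d e : deg) (m : 'X_{1..N}).

Definition multideg m : deg := [multinom \sum_(i | g i == j) m i | j < k]%N.

Lemma multidegD m m' : multideg (m + m')%MM = (multideg m + multideg m')%MM.
Proof.
apply/mnmP => j; rewrite mnmDE !mnmE -big_split /=.
by apply: eq_bigr => i _; rewrite mnmDE.
Qed.

Lemma multideg0 : multideg 0%MM = 0%MM.
Proof. by apply/mnmP => j; rewrite mnmE mnm0E big1 // => i _; rewrite mnm0E. Qed.

Lemma multidegU i : multideg U_(i)%MM = U_(g i)%MM.
Proof.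
apply/mnmP => j; rewrite mnmE mnm1E; have [e|ne] := eqVneq (g i) j.
  rewrite (bigD1 i) ?e //= mnm1E eqxx big1 ?addn0 // => i' /andP[_ ne].
  by rewrite mnm1E eq_sym (negPf ne).
rewrite big1 // => i' /eqP e; rewrite mnm1E; case: eqP => // ii'.
by rewrite ii' e eqxx in ne.
Qed.

Lemma mdeg_multideg m : mdeg (multideg m) = mdeg m.
Proof.
rewrite !mdegE [RHS](partition_big g xpredT) //=.
by apply: eq_bigr => j _; rewrite mnmE.
Qed.

Definition mhomog d p := forall m, p@_m != 0 -> multideg m = d.

Definition hpart d p : S := \sum_(m <- msupp p | multideg m == d) p@_m *: 'X_[m].

Lemma mcoeff_hpart d p m : (hpart d p)@_m = if multideg m == d then p@_m else 0.
Proof.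
rewrite /hpart raddf_sum /=.
under eq_bigr do rewrite mcoeffZ mcoeffX.
have [mp|mp] := boolP (m \in msupp p); last first.
  rewrite big_seq_cond big1 ?(memN_msupp_eq0 mp) ?if_same // => m' /andP[h _].
  by rewrite (_ : m' == m = false) ?mulr0 //; apply: contraNF mp => /eqP <-.
rewrite -big_filter; have [hm|hm] := boolP (multideg m == d).
  rewrite (bigD1_seq m) /= ?mem_filter ?hm ?filter_uniq ?msupp_uniq // eqxx mulr1.
  by rewrite big1 ?addr0 // => m' ne; rewrite (negPf ne) mulr0.
rewrite big_seq big1 // => m'; rewrite mem_filter => /andP[h _].
by rewrite (_ : m' == m = false) ?mulr0 //; apply: contraNF hm => /eqP <-.
Qed.

Lemma hpart_homog d p : mhomog d (hpart d p).
Proof. by move=> m; rewrite mcoeff_hpart; case: (multideg m =P d) => //; rewrite eqxx. Qed.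

Lemma hpart_id d p : mhomog d p -> hpart d p = p.
Proof.
move=> h; apply/mpolyP => m; rewrite mcoeff_hpart; case: eqP => // ne.
by apply/eqP; rewrite eq_sym; apply: contra_notT ne => /h.
Qed.

Lemma hpart_neq d e p : mhomog e p -> e != d -> hpart d p = 0.
Proof.
move=> h ne; apply/mpolyP => m; rewrite mcoeff_hpart mcoeff0; case: eqP => // md.
by apply/eqP; apply: contraNT ne => /h <-; rewrite md.
Qed.

Lemma hpartD d p q : hpart d (p + q) = hpart d p + hpart d q.
Proof.
apply/mpolyP => m; rewrite mcoeffD !mcoeff_hpart mcoeffD.
by case: eqP => // _; rewrite addr0.
Qed.

Lemma hpart0 d : hpart d 0 = 0.
Proof. by apply/mpolyP => m; rewrite mcoeff_hpart mcoeff0 if_same. Qed.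

Lemma hpart_sum d I (s : seq I) (F : I -> S) :
  hpart d (\sum_(i <- s) F i) = \sum_(i <- s) hpart d (F i).
Proof. by apply: (big_morph _ (hpartD d) (hpart0 d)). Qed.

Definition degs p := undup (map multideg (msupp p)).

Lemma hpart_degs d p : hpart d p != 0 -> d \in degs p.
Proof.
apply: contraNT; rewrite mem_undup => h; apply/eqP/mpolyP => m.
rewrite mcoeff_hpart mcoeff0; case: eqP => // hm; apply: memN_msupp_eq0.
by apply: contra h => h; apply/mapP; exists m.
Qed.

Lemma hpartE p : p = \sum_(d <- degs p) hpart d p.
Proof.
apply/mpolyP => m; rewrite raddf_sum /=.
under eq_bigr do rewrite mcoeff_hpart.
have [mp|mp] := boolP (m \in msupp p); last first.
  by rewrite big1 ?(memN_msupp_eq0 mp) // => d _; rewrite if_same.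
rewrite (bigD1_seq (multideg m)) ?undup_uniq /= ?mem_undup ?map_f // eqxx.
by rewrite big1 ?addr0 // => d /negPf ne; rewrite eq_sym ne.
Qed.

Lemma mhomogM d e p q : mhomog d p -> mhomog e q -> mhomog (d + e)%MM (p * q).
Proof.
move=> hp hq m; rewrite -mcoeff_msupp => /msuppM_le /allpairsP [[m1 m2] /= [h1 h2 ->]].
by rewrite multidegD (hp m1) ?(hq m2) -?mcoeff_msupp.
Qed.

Lemma subsp_mhomog d : subsp (mhomog d).
Proof.
split; first by move=> m; rewrite mcoeff0 eqxx.
move=> a p q hp hq m; rewrite mcoeffD mcoeffZ.
have [/eqP->|/hp//] := boolP (p@_m == 0); rewrite mulr0 add0r; exact: hq.
Qed.

Lemma mhomogX m : mhomog (multideg m) 'X_[m].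
Proof. by move=> m'; rewrite mcoeffX; case: (m =P m') => [->//|_]; rewrite eqxx. Qed.

Lemma mhomogU i : mhomog U_(g i)%MM 'X_i.
Proof. rewrite -multidegU; exact: mhomogX. Qed.

Lemma mhomog1 : mhomog 0%MM 1.
Proof. by rewrite -multideg0 -mpolyX0; apply: mhomogX. Qed.

Lemma hpartM d e p x : mhomog e x -> hpart (d + e)%MM (p * x) = hpart d p * x.
Proof.
move=> hx; rewrite {1}[p]hpartE mulr_suml hpart_sum.
have h d' : hpart (d + e)%MM (hpart d' p * x) = if d' == d then hpart d p * x else 0.
  case: eqP => [->|/eqP ne]; first by apply: hpart_id; apply: mhomogM => //; apply: hpart_homog.
  apply: (@hpart_neq _ (d' + e)%MM); first by apply: mhomogM => //; apply: hpart_homog.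
  by rewrite eqm_add2r.
under eq_bigr do rewrite h.
have [hd|hd] := boolP (d \in degs p).
  rewrite (bigD1_seq d) ?undup_uniq //= eqxx big1 ?addr0 // => d' /negPf-> //.
rewrite big_seq big1 => [|d' hd']; last first.
  by rewrite (_ : d' == d = false) //; apply: contraNF hd => /eqP <-.
have [->|/hpart_degs] := eqVneq (hpart d p) 0; first by rewrite mul0r.
by rewrite (negPf hd).
Qed.

Definition hideal J := ideal J /\ forall d p, J p -> J (hpart d p).

Lemma ideal_subsp J : ideal J -> subsp J.
Proof.
move=> hJ; split; first exact: ideal0.
by move=> a p q hp hq; apply: idealD => //; rewrite -mul_mpolyC; apply: ideal_mull.
Qed.

Lemma hideal_sub J J' : hideal J -> ideal J' ->
  (forall d p, mhomog d p -> J p -> J' p) -> incl J J'.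
Proof.
move=> [hJ hh] hJ' h p Jp; rewrite [p]hpartE; apply: ideal_sum => // d _.
by apply: (h d); [apply: hpart_homog | apply: hh].
Qed.

Lemma hideal_adjoin J x e : hideal J -> mhomog e x -> hideal (adjoin J x).
Proof.
move=> [hJ hh] hx; split; first exact: ideal_adjoin.
move=> d _ [q Jq [a ->]]; rewrite hpartD.
have [le|nle] := boolP (e <= d)%MM.
  by rewrite -(submK le) hpartM //; exists (hpart (d - e + e)%MM q); [apply: hh | exists (hpart (d - e)%MM a)].
suff -> : hpart d (a * x) = 0 by rewrite addr0; apply/sub_adjoin/hh.
rewrite [a]hpartE mulr_suml hpart_sum big1 // => d' _.
apply: (@hpart_neq _ (d' + e)%MM); first by apply: mhomogM => //; apply: hpart_homog.
by apply: contraNneq nle => <-; rewrite lem_addl.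
Qed.

Lemma hideal_colon J x e : hideal J -> mhomog e x -> hideal (colon J x).
Proof.
move=> [hJ hh] hx; split; first exact: ideal_colon.
by move=> d p; rewrite /colon => h; rewrite -(hpartM d _ hx); apply: hh.
Qed.

(* The multidegrees are totally ordered compatibly with addition, so the product
   of the components of largest degree outside P is a component of the product. *)
Lemma hprime_prime P : hideal P -> ~ P 1 ->
  (forall d e p q, mhomog d p -> mhomog e q -> P (p * q) -> P p \/ P q) ->
  prime_ideal P.
Proof.
move=> [hP hh] P1 hM; split=> // p q Ppq; apply: NNPP => h.
have [np nq] : ~ P p /\ ~ P q by split=> ?; apply: h; [left | right].
have top x : ~ P x -> exists d, ~ P (hpart d x) /\
    forall d', ~ P (hpart d' x) -> (d' <= d)%O.
  move=> nx; have [|d [_ hd hmax]] := @seq_max _ 'X_{1..k} (degs x) (fun d => ~ P (hpart d x)).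
    apply: NNPP => h0; apply: nx; rewrite [x]hpartE big_seq; apply: ideal_sum => // d hd.
    by apply: NNPP => h1; apply: h0; exists d.
  exists d; split=> // d' hd'; apply: hmax => //; apply: hpart_degs.
  by apply: contra_not_neq hd' => ->; apply: ideal0.
have [d [hd maxd]] := top p np; have [e [he maxe]] := top q nq.
have := hh (d + e)%MM _ Ppq.
have in_degs x d' : ~ P (hpart d' x) -> d' \in degs x.
  by move=> h'; apply: hpart_degs; apply: contra_not_neq h' => ->; apply: ideal0.
rewrite {1}[p]hpartE mulr_suml hpart_sum (bigD1_seq d) ?undup_uniq ?in_degs //=.
rewrite {1}[q]hpartE mulr_sumr hpart_sum (bigD1_seq e) ?undup_uniq ?in_degs //=.
rewrite [hpart _ (hpart d p * _)]hpart_id; last by apply: mhomogM; apply: hpart_homog.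
set R1 := \sum_(e' <- _ | _) _; set R2 := \sum_(d' <- _ | _) _.
have prod0 d' e' : (d' + e' != d + e)%MM -> hpart (d + e)%MM (hpart d' p * hpart e' q) = 0.
  by apply: hpart_neq; apply: mhomogM; apply: hpart_homog.
have hR1 : P R1.
  apply: ideal_sum => // e' ne; rewrite prod0 ?eqm_add2l //; exact: ideal0.
have hR2 : P R2.
  apply: ideal_sum => // d' ne; rewrite [q]hpartE mulr_sumr hpart_sum.
  apply: ideal_sum => // e' _; have [/eqP eq|/prod0->] := boolP (d' + e' == d + e)%MM; last exact: ideal0.
  apply: hh; have [pd'|nd'] := classic (P (hpart d' p)); first exact: ideal_mulr.
  apply: ideal_mull => //; apply: NNPP => /maxe le.
  have lt : (d' < d)%O by rewrite lt_neqAle ne maxd.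
  by have := ltmc_le_add lt le; rewrite eq ltxx.
move/(idealDr _ hP hR2)/(idealDr _ hP hR1).
by case/(hM d e _ _ (@hpart_homog d p) (@hpart_homog e q)).
Qed.

Lemma mhomog_span d : exists n (b : 'I_n -> S), (forall i, mhomog d (b i)) /\
  forall x, mhomog d x -> exists c : 'I_n -> K, x = \sum_i c i *: b i.
Proof.
pose I := 'X_{1..N < (mdeg d).+1}.
exists #|{: I}|, (fun i => if multideg (enum_val i : I) == d then 'X_[(enum_val i : I)] else 0).
split=> [i|x hx].
  have hX := @mhomogX (enum_val i : I).
  by case: eqP => [h|_]; [rewrite h in hX | case: (subsp_mhomog d)].
exists (fun i => x@_(enum_val i : I)).
have sx : (msize x <= (mdeg d).+1)%N.
  rewrite msizeE; apply/bigmax_leqP_seq => m; rewrite mcoeff_msupp => /hx <- _.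
  by rewrite mdeg_multideg.
rewrite [LHS](mpolywE sx) (reindex (@enum_val _ (xpredT : {pred I}))) /=.
  apply: eq_bigr => i _; case: (multideg _ =P d) => // h; rewrite scaler0.
  suff -> : x@_(enum_val i : I) = 0 by rewrite scale0r.
  by apply/eqP; apply: contra_notT h => /hx.
by exists enum_rank => i _; rewrite ?enum_valK ?enum_rankK.
Qed.

(** For an ideal J the value is meaningful, the degree d part of S / J having finite dimension
    ([hilbP]). *)
Definition hilb J d : nat := epsilon (inhabits 0%N) (rdim (mhomog d) J).

Lemma hilbP J d : ideal J -> rdim (mhomog d) J (hilb J d).
Proof.
move=> /ideal_subsp hJ; apply: epsilon_spec.
have [n [b [hb sb]]] := mhomog_span d; apply: (rdim_ex (b := b)) => //.
by move=> x /sb [c ->]; exists c; rewrite subrr; case: hJ.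
Qed.

Lemma hilb_eq J d n : ideal J -> rdim (mhomog d) J n -> hilb J d = n.
Proof. by move=> hJ; apply: rdim_uniq (ideal_subsp hJ) (hilbP d hJ). Qed.

Lemma hilb_indep J d n (b : 'I_n -> S) : ideal J -> (forall i, mhomog d (b i)) ->
  indep J b -> (n <= hilb J d)%N.
Proof. by move=> hJ; apply: indep_rdim (ideal_subsp hJ) (hilbP d hJ). Qed.

Lemma hilb_mono J J' d : ideal J -> ideal J' -> incl J J' -> (hilb J' d <= hilb J d)%N.
Proof.
move=> hJ hJ' le; have [b [bV ib _]] := hilbP d hJ'.
by apply: (hilb_indep (b := b)) => // c /le; apply: ib.
Qed.

Lemma hilb_full J d : ideal J -> incl (mhomog d) J -> hilb J d = 0%N.
Proof.
move=> hJ le; apply: hilb_eq => //; exists (fun=> 0); split; first by case.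
  by move=> c _ [].
move=> x /le Jx; exists (fun=> 0); rewrite big_ord0 subr0; exact: Jx.
Qed.

(** Multiplication by x identifies the degree d part of S / (J : x) with the kernel of S / J -> S /
    (J + (x)) in degree d + e. *)
Lemma hilb_adjoin J x d e : hideal J -> mhomog e x ->
  hilb J (d + e)%MM = (hilb (adjoin J x) (d + e)%MM + hilb (colon J x) d)%N.
Proof.
move=> hJ hx; have [iJ hh] := hJ; apply: hilb_eq => //.
have hV := subsp_mhomog (d + e)%MM.
apply: (rdimD (J' := adjoin J x)) => //; try exact: ideal_subsp; try exact: sub_adjoin.
- exact/ideal_subsp/ideal_adjoin.
- exact/hilbP/ideal_adjoin.
have [hC _] := hideal_colon hJ hx.
have f_lin : linear (fun p : S => p * x) by move=> a p q; rewrite mulrDl scalerAl.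
pose fL : {linear S -> S} := HB.pack (fun p : S => p * x) (GRing.isLinear.Build _ _ _ _ _ f_lin).
apply: (rdim_iso (f := fL)) (hilbP d hC) => /=.
- exact: subsp_mhomog.
- exact: ideal_subsp.
- by move=> p hp; split; [exact: mhomogM | exists 0; [exact: ideal0 | exists p; rewrite add0r]].
- by move=> p _.
- move=> y [hy [q Jq [a ey]]]; exists (hpart d a); first exact: hpart_homog.
  by rewrite -(hpart_id hy) ey hpartD hpartM // addrK; apply: hh.
Qed.

Definition HF J : deg -> int := fun d => (hilb J d)%:Z.

Lemma HFE J d : HF J d = (hilb J d)%:Z. Proof. by []. Qed.

Lemma HF_adjoin J x e : hideal J -> mhomog e x ->
  ev (fun d => HF J d = HF (adjoin J x) d + sh e (HF (colon J x)) d).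
Proof.
move=> hJ hx; exists e => d.
by rewrite /HF /sh addmC addmK (hilb_adjoin d hJ hx) PoszD.
Qed.

Lemma HF_adjoin_prime P x e : hideal P -> prime_ideal P -> mhomog e x -> ~ P x ->
  ev (fun d => HF P d = HF (adjoin P x) d + sh e (HF P) d).
Proof.
move=> hP [iP _ hM] hx nx; have := HF_adjoin hP hx.
suff -> : colon P x = P by [].
apply: pred_ext => p; split; first by case/hM.
exact: sub_colon.
Qed.

(** No block of variables lies entirely in P: among the multihomogeneous primes, these are the
    ideals of subvarieties of the product. *)
Definition relevant P := forall j, exists2 i, g i = j & ~ P 'X_i.

Lemma irrelevant_HF P : ideal P -> ~ relevant P -> ev (fun d => HF P d = 0).
Proof.
move=> iP /not_all_ex_not [j hj]; exists U_(j)%MM => d.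
rewrite /HF hilb_full // => x hx.
rewrite [x]mpolyE; apply: ideal_sum => // m _.
have [->|/hx hm] := eqVneq x@_m 0; first by rewrite scale0r; apply: ideal0.
rewrite -mul_mpolyC; apply: ideal_mull => //.
have : multideg m j != 0%N by rewrite hm mnmDE mnm1E eqxx.
rewrite mnmE sum_nat_eq0 negb_forall => /existsP [i]; rewrite negb_imply => /andP[/eqP gi mi].
rewrite -(@submK _ U_(i) m) ?lep1mP // mpolyXD; apply: ideal_mull => //.
by apply: NNPP => nX; apply: hj; exists i.
Qed.

Lemma full_HF J : ideal J -> J 1 -> ev (fun d => HF J d = 0).
Proof.
by move=> iJ J1; apply: evT => d; rewrite /HF hilb_full // => x _; rewrite -[x]mulr1; apply: ideal_mull.
Qed.

(** Noetherian induction. If a homogeneous x outside J is a zero divisor modulo J, then J + (x) and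
    J : x are both larger and their Hilbert functions add up to that of J. Otherwise J is prime, and
    the difference in direction j is, up to a shift, the Hilbert function of J + (x_i) for a
    variable x_i of block j outside J. *)
Theorem hilbert_serre J : hideal J -> exists r, deglt r (HF J).
Proof.
have base J0 : ev (fun d => HF J0 d = 0) -> exists r, deglt r (HF J0) by exists 0%N.
move=> hJ; have [iJ _] := hJ; move: J iJ hJ.
apply: (noeth_ind (Phi := fun J => hideal J -> exists r, deglt r (HF J))).
  exact: acc_mpoly.
move=> J iJ IH hJ; have [J1|J1] := classic (J 1); first exact/base/full_HF.
have big x e : mhomog e x -> ~ J x -> exists r, deglt r (HF (adjoin J x)).
  move=> hx nx; apply: IH; first exact: ideal_adjoin.
    by split; [apply: sub_adjoin | move=> h; apply/nx/h/mem_adjoin].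
  exact: hideal_adjoin hx.
have [[x [e [hx nx [y hy ny]]]]|h] := classic (exists x e, [/\ mhomog e x, ~ J x &
    exists2 y, colon J x y & ~ J y]).
  have [r1 h1] := big x e hx nx; have [|||r2 h2] := IH (colon J x).
  - exact: ideal_colon.
  - by split; [apply: sub_colon | move=> h; apply/ny/h].
  - exact: hideal_colon hx.
  exists (maxn r1 r2).
  apply: (@deglt_ev _ _ (fun d => HF (adjoin J x) d + sh e (HF (colon J x)) d)).
    by apply: ev_mono (HF_adjoin hJ hx) => d ->.
  apply: degltD; first exact: deglt_leq (leq_maxl _ _) h1.
  by apply: deglt_sh; apply: deglt_leq (leq_maxr _ _) h2.
have prJ : prime_ideal J.
  apply: hprime_prime => // d e p q hp hq Jpq; apply: NNPP => n; apply: h.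
  exists p, d; split=> //; first by move=> Jp; apply: n; left.
  by exists q; [rewrite /colon mulrC | move=> Jq; apply: n; right].
have [rel|nrel] := classic (relevant J); last exact/base/irrelevant_HF.
have hj j : exists r, deglt r (df j (HF J)).
  have [i gi nX] := rel j; have [r hr] := big _ _ (@mhomogU i) nX; exists r.
  apply: deglt_eq (deglt_add U_(j)%MM hr) => d; rewrite /df /HF -gi.
  rewrite (hilb_adjoin d hJ (@mhomogU i)).
  rewrite (_ : colon J 'X_i = J); first by rewrite PoszD addrK.
  case: prJ => _ _ hM; apply: pred_ext => p; split; first by case/hM.
  exact: sub_colon.
have [r hr] := functional_choice hj.
exists (\max_j r j).+1 => j; apply: deglt_leq (hr j); exact: leq_bigmax.
Qed.

End Graded.

(** * Prime filtrations *)

Definition decide_prop (Q : Prop) : bool := if excluded_middle_informative Q then true else false.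

Lemma pdecP (Q : Prop) : reflect Q (decide_prop Q).
Proof. by rewrite /decide_prop; case: excluded_middle_informative => h; constructor. Qed.

Lemma max_chain_uniq X (F : (X -> Prop) -> Prop) r r' :
  max_chain_length F r -> max_chain_length F r' -> r = r'.
Proof.
move=> [[c hc] hr] [[c' hc'] hr']; apply/eqP; rewrite eqn_leq.
by rewrite (hr' _ _ hc) (hr _ _ hc').
Qed.

Section PrimeFiltration.
Variables (K : closedFieldType) (N k : nat) (g : 'I_N -> 'I_k).
Local Notation S := {mpoly K[N]}.
Local Notation deg := 'X_{1..k}.
Local Notation mhomog := (mhomog g).
Local Notation hideal := (hideal g).
Local Notation HF := (HF g).
Implicit Types (J P Q : S -> Prop) (p q x : S) (d e : deg).
Implicit Types (s : seq (deg * (S -> Prop))).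

Lemma HF_sub J J' r : hideal J -> hideal J' -> incl J J' ->
  deglt r (HF J) -> deglt r (HF J').
Proof.
move=> [iJ _] hJ' le hr; have [r' hr'] := hilbert_serre hJ'.
apply: (deglt_dom hr' hr); apply: evT => d; rewrite /HF lez_nat /=.
by apply: hilb_mono => //; case: hJ'.
Qed.

Lemma HF_adjoin_drop P x e r : hideal P -> prime_ideal P -> mhomog e x -> ~ P x ->
  deglt r.+1 (HF P) -> deglt r (HF (adjoin P x)).
Proof.
move=> hP prP hx nx hr; apply: deglt_ev (deglt_Bsh e hr).
by apply: ev_mono (HF_adjoin_prime hP prP hx nx) => d ->; rewrite addrK.
Qed.

Lemma homog_witness J J' : hideal J -> hideal J' -> ~ incl J' J ->
  exists x e, [/\ mhomog e x, J' x & ~ J x].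
Proof.
move=> [iJ _] hJ' nle; apply: NNPP => h; apply: nle.
apply: (hideal_sub hJ') => // d p hp J'p; apply: NNPP => np.
by apply: h; exists p, d.
Qed.

(** A homogeneous element of J outside P is not a zero divisor modulo P, so cutting by it takes a
    difference; S / J is a quotient of what remains. *)
Lemma HF_drop P J r : hideal P -> prime_ideal P -> hideal J -> strict_incl P J ->
  deglt r.+1 (HF P) -> deglt r (HF J).
Proof.
move=> hP prP hJ [le nle] hr; have [x [e [hx Jx nx]]] := homog_witness hP hJ nle.
apply: HF_sub (HF_adjoin_drop hP prP hx nx hr) => //; first exact: hideal_adjoin hx.
by apply: adjoin_sub => //; case: hJ.
Qed.

(** The list records the shifted factors S / P of a filtration of S / J: the submodule generated by
    x is S / (J : x), and J : x is prime. *)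
Inductive pfilt : (S -> Prop) -> seq (deg * (S -> Prop)) -> Prop :=
| pfilt_nil J : J 1 -> pfilt J [::]
| pfilt_cons J x e s : mhomog e x -> prime_ideal (colon J x) ->
    pfilt (adjoin J x) s -> pfilt J ((e, colon J x) :: s).

(** A maximal ideal of the form J : x, with x homogeneous outside J, is prime: if p q x is in J but
    p x and q x are not, then J : (q x) is strictly larger. *)
Lemma colon_prime_ex J : hideal J -> ~ J 1 ->
  exists x e, mhomog e x /\ prime_ideal (colon J x).
Proof.
move=> hJ J1; have [iJ _] := hJ.
suff H : forall I, ideal I -> (exists x e, [/\ mhomog e x, ~ J x & I = colon J x]) ->
    exists x e, mhomog e x /\ prime_ideal (colon J x).
  apply: (H J) => //; exists 1, 0%MM; split=> //; first exact: mhomog1.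
  by apply: pred_ext => p; rewrite /colon mulr1.
apply: (noeth_ind (Phi := fun I => (exists x e, [/\ mhomog e x, ~ J x & I = colon J x]) ->
  exists x e, mhomog e x /\ prime_ideal (colon J x))); first exact: acc_mpoly.
move=> I _ IH [x [e [hx nx eI]]]; rewrite {}eI in IH; apply: NNPP => no; apply: (no); exists x, e; split=> //.
apply: (hprime_prime (g := g)); first exact: hideal_colon hx.
  by rewrite /colon mul1r.
move=> d d' p q hp hq hpq; apply: NNPP => h; apply: no.
apply: (IH (colon J (q * x))); first exact: ideal_colon.
  split; first by move=> y; rewrite /colon => hy; rewrite mulrCA; apply: ideal_mull.
  move=> le; apply: h; left; apply: le; by rewrite /colon mulrA.
exists (q * x), (d' + e)%MM; split=> //; first exact: mhomogM.
by move=> h1; apply: h; right.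
Qed.

Lemma pfilt_ex J : hideal J -> exists s, pfilt J s.
Proof.
move=> hJ; have [iJ _] := hJ; move: J iJ hJ.
apply: (noeth_ind (Phi := fun J => hideal J -> exists s, pfilt J s)); first exact: acc_mpoly.
move=> J iJ IH hJ; have [J1|J1] := classic (J 1); first by exists [::]; apply: pfilt_nil.
have [x [e [hx prx]]] := colon_prime_ex hJ J1.
have [|||s hs] := IH (adjoin J x).
- exact: ideal_adjoin.
- split; first exact: sub_adjoin.
  move=> /(_ _ (mem_adjoin x iJ)) Jx; case: prx => _ h _; apply: h.
  by rewrite /colon mul1r.
- exact: hideal_adjoin hx.
by exists ((e, colon J x) :: s); apply: pfilt_cons.
Qed.

Lemma pfilt_mem J s : pfilt J s -> hideal J -> forall a, List.In a s ->
  [/\ hideal a.2, prime_ideal a.2 & incl J a.2].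
Proof.
elim=> {J s} [J _ _ a []|J x e s hx prx _ IH hJ a /= [<-|ha]].
  by split=> //; [exact: hideal_colon hx | apply: sub_colon; case: hJ].
have [h1 h2 h3] := IH (hideal_adjoin hJ hx) a ha.
by split=> // p /(@sub_adjoin _ J x); apply: h3.
Qed.

Lemma pfilt_HF J s : pfilt J s -> hideal J ->
  ev (fun d => HF J d = \sum_(a <- s) sh a.1 (HF a.2) d).
Proof.
elim=> {J s} [J J1 [iJ _]|J x e s hx prx _ IH hJ].
  by apply: ev_mono (full_HF g iJ J1) => d ->; rewrite big_nil.
apply: ev_and2 (IH (hideal_adjoin hJ hx)) (HF_adjoin hJ hx) => d h1 ->.
by rewrite big_cons h1 addrC.
Qed.

(** * Lengths at a prime, read off a filtration *)

Definition occurrences P s := count (fun a => decide_prop (a.2 = P)) s.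

Definition saturated P Q := forall a p, ~ P a -> Q (a * p) -> Q p.
(** The contraction to S of the localization of J at P. *)
Definition satur P J : S -> Prop := fun p => exists2 a, ~ P a & J (a * p).

Lemma satur_ideal P J : prime_ideal P -> ideal J -> ideal (satur P J).
Proof.
move=> [_ P1 prP] iJ; split.
- by exists 1 => //; rewrite mulr0; apply: ideal0.
- move=> p q [a na ha] [b nb hb]; exists (a * b); first by case/prP.
  rewrite mulrDr; apply: idealD => //.
    by rewrite mulrAC mulrC; apply: ideal_mull.
  by rewrite -mulrA; apply: ideal_mull.
- by move=> p q [a na ha]; exists a => //; rewrite mulrCA; apply: ideal_mull.
Qed.

Lemma saturP P J : prime_ideal P -> saturated P (satur P J).
Proof.
move=> [_ _ prP] a p na [b nb hb]; exists (b * a); first by case/prP.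
by rewrite -mulrA.
Qed.

Lemma sub_satur P J : prime_ideal P -> incl J (satur P J).
Proof. by move=> [_ P1 _] p hp; exists 1 => //; rewrite mul1r. Qed.

Lemma satur_sub P J Q : saturated P Q -> incl J Q -> incl (satur P J) Q.
Proof. by move=> sQ le p [a na /le]; apply: sQ. Qed.

Definition sat_over P J Q := [/\ ideal Q, saturated P Q & incl J Q].

Lemma pfilt_chain J s P : pfilt J s -> ideal J -> prime_ideal P ->
  exists c, strict_chain (sat_over P J) (occurrences P s) c.
Proof.
move=> hs iJ prP; elim: hs iJ => {J s} [J J1 iJ|J x e s hx prx _ IH iJ].
  exists (fun _ _ => True); split=> // _ _; split=> //.
have [c [hc sc]] := IH (ideal_adjoin x iJ).
rewrite /occurrences /=; case: pdecP => [eP|_]; last first.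
  exists c; split=> // i hi; have [h1 h2 h3] := hc i hi; split=> // p /(@sub_adjoin _ J x).
  exact: h3.
exists (fun i => if i is i'.+1 then c i' else satur P J); split.
  case=> [|i] hi.
    by split; [exact: satur_ideal | exact: saturP | exact: sub_satur].
  have [h1 h2 h3] := hc i hi; split=> // p /(@sub_adjoin _ J x); exact: h3.
case=> [|i] hi; last exact: sc.
have [h1 h2 h3] := hc 0%N (leq0n _); split.
  by apply: satur_sub => // p /(@sub_adjoin _ J x); exact: h3.
have cx : c 0%N x by apply/h3/mem_adjoin.
by move=> /(_ _ cx) [a na ha]; apply: na; rewrite -eP.
Qed.

(** By the hypothesis on the list, localization at P kills the factors other than S / P, and a
    factor S / P lengthens a chain by at most one. *)
Lemma pfilt_chain_max J s P : pfilt J s -> ideal J -> prime_ideal P ->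
  (forall a, List.In a s -> incl a.2 P -> a.2 = P) ->
  forall r c, strict_chain (sat_over P J) r c -> (r <= occurrences P s)%N.
Proof.
move=> hs iJ prP; elim: hs iJ => {J s} [J J1 iJ _ r c [hc sc]|J x e s hx prx _ IH iJ hP r c [hc sc]].
  case: r hc sc => // r hc sc; have [h1 h2] := sc 0%N (ltn0Sn r).
  by case: h2 => p _; rewrite -[p]mulr1; have [i1 _ /(_ _ J1)] := hc 0%N (leq0n _); apply: ideal_mull.
have iJ' := ideal_adjoin x iJ.
have {}IH : forall r c, strict_chain (sat_over P (adjoin J x)) r c -> (r <= occurrences P s)%N.
  by apply: IH => // a ha; apply: hP; right.
rewrite /occurrences /=; case: pdecP => [eP|nP].
  rewrite -/(occurrences P s) add1n; case: r hc sc => // r hc sc; rewrite ltnS.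
  have Px a : P a <-> J (a * x) by rewrite -[in P a]eP.
  (* A chain over J becomes a chain over J + (x) with one inclusion less: x is adjoined to the
     members without x, and the first member containing x is skipped. Members without x stay
     distinct because J : x is exactly P. *)
  apply: (IH r (fun i => if decide_prop (c i x) then c i.+1 else satur P (adjoin (c i) x))).
  split=> [i hi|i hi].
    have [i1 s1 le1] := hc i (leqW hi); have [i2 s2 le2] := hc i.+1 hi.
    case: pdecP => hcx.
      by split=> //; apply: adjoin_sub => //; apply: (sc i hi).1.
    split; [exact/satur_ideal/ideal_adjoin | exact: saturP |].
    move=> p [q /le1 hq [a ->]]; apply: sub_satur => //; by exists q => //; exists a.
  have hi1 : (i < r.+1)%N by rewrite ltnS ltnW.
  have [i1 s1 le1] := hc i (ltnW hi1); have [i2 s2 le2] := hc i.+1 hi1.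
  have [i3 s3 le3] := hc i.+2 hi; have [l12 n12] := sc i hi1; have [l23 n23] := sc i.+1 hi.
  have sub2 : c i.+1 x -> incl (satur P (adjoin (c i) x)) (c i.+1).
    by move=> hx1; apply: satur_sub => //; apply: adjoin_sub.
  case: (pdecP (c i x)) => h0; case: (pdecP (c i.+1 x)) => h1.
  - exact: sc.
  - by case: h1; apply: l12.
  - split; first by move=> p /(sub2 h1); apply: l23.
    by move=> le; apply: n23 => p /le; apply: sub2.
  - split.
      apply: satur_sub; first exact: saturP.
      move=> p [q /l12 hq [a ->]]; apply: sub_satur => //; by exists q => //; exists a.
    move=> le; apply: n12 => y hy.
    have [|b nb [q hq [a eq]]] := le y.
      by apply: sub_satur => //; apply: sub_adjoin.
    apply: (s1 b) => //; rewrite eq; apply: idealD => //; apply/le1/Px.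
    apply: NNPP => na; apply: h1; apply: (s2 a) => //.
    by rewrite -(addKr q (a * x)) -eq addrC; apply: idealB; [| apply: ideal_mull |apply: l12].
rewrite -/(occurrences P s) add0n; apply: (IH r c); split=> // i hi; have [h1 h2 h3] := hc i hi.
split=> //; apply: adjoin_sub => //.
(* Some a outside P has a x in J, so x lies in every saturated ideal over J. *)
have [a ha na] : exists2 a, colon J x a & ~ P a.
  apply: NNPP => h; apply: nP; apply: (hP (e, colon J x)); first by left.
  by move=> a ha; apply: NNPP => na; apply: h; exists a.
exact: (h2 a) (h3 _ ha).
Qed.

Lemma pfilt_length J s P : pfilt J s -> ideal J -> prime_ideal P ->
  (forall a, List.In a s -> incl a.2 P -> a.2 = P) ->
  max_chain_length (sat_over P J) (occurrences P s).
Proof.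
move=> hs iJ prP hP; split; first exact: pfilt_chain.
exact: pfilt_chain_max.
Qed.

Lemma pfilt_ndeg J s r : pfilt J s -> hideal J -> ~ deglt r (HF J) ->
  exists a, List.In a s /\ ~ deglt r (HF a.2).
Proof.
move=> hs hJ nr; apply: NNPP => h; apply: nr.
apply: (@deglt_ev _ _ (fun d => \sum_(a <- s) sh a.1 (HF a.2) d)).
  by apply: ev_mono (pfilt_HF hs hJ) => d ->.
have {}h a : List.In a s -> deglt r (HF a.2).
  by move=> ha; apply: NNPP => n; apply: h; exists a.
elim: s {hs} h => [|a s IHs] h.
  by apply: deglt_eq (deglt0 _ r) => d; rewrite big_nil.
apply: deglt_eq (degltD (deglt_sh a.1 (h a (or_introl erefl))) (IHs _)) => [d|a' ha'].
  by rewrite big_cons.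
by apply: h; right.
Qed.

(** Some difference of the Hilbert function is not of degree less than r. Up to a shift it belongs
    to P + (x_i), and one of the prime factors keeps this degree. Iterated, this produces chains of
    primes as long as the degree predicts. *)
Lemma prime_ndeg_step P r : hideal P -> prime_ideal P -> ~ deglt r.+1 (HF P) ->
  exists P', [/\ hideal P', prime_ideal P', strict_incl P P' & ~ deglt r (HF P')].
Proof.
move=> hP prP nr; have [iP _] := hP.
have rel : relevant g P.
  by apply: NNPP => /(irrelevant_HF iP) h; apply: nr; apply: (@deglt_leq _ 0).
have [j nj] : exists j, ~ deglt r (df j (HF P)).
  by apply: not_all_ex_not => h; apply: nr.
have [i gi nX] := rel j; have hX := @mhomogU K _ _ g i.
have [s hs] := pfilt_ex (hideal_adjoin hP hX).
have [|a [ha na]] := pfilt_ndeg (r := r) hs (hideal_adjoin hP hX).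
  move=> hr; apply: nj; apply: deglt_eq (deglt_add U_(j)%MM hr) => d; rewrite /df /HF -gi.
  rewrite (hilb_adjoin d hP hX) (_ : colon P 'X_i = P); first by rewrite PoszD addrK.
  case: prP => _ _ hM; apply: pred_ext => p; split; first by case/hM.
  exact: sub_colon.
have [h1 h2 h3] := pfilt_mem hs (hideal_adjoin hP hX) ha.
exists a.2; split=> //; split; first by move=> p /(@sub_adjoin _ P 'X_i); apply: h3.
by move=> le; apply/nX/le/h3/mem_adjoin.
Qed.

End PrimeFiltration.

(** * Subvarieties and their Hilbert functions *)

Section Varieties.
Variables (K : closedFieldType) (T B : finType) (blk : T -> B).
Local Notation vect := {ffun T -> K}.
Local Notation S := {mpoly K[#|T|]}.
Implicit Types (v w : vect) (V W Z : vect -> Prop) (p q x : S) (P J Q : S -> Prop).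
Implicit Types (s : seq ('X_{1..#|B|} * (S -> Prop))).

Definition grd (i : 'I_#|T|) : 'I_#|B| := enum_rank (blk (enum_val i)).

Lemma grdE i : grd i = enum_rank (blk (enum_val i)). Proof. by []. Qed.

Local Notation hideal := (hideal grd).
Local Notation HF := (HF grd).
Local Notation relevant := (relevant grd).

Definition zeros P : vect -> Prop := fun v => is_point blk v /\ forall p, P p -> peval p v = 0.

Lemma pevalD p q v : peval (p + q) v = peval p v + peval q v.
Proof. exact: mevalD. Qed.

Lemma pevalM p q v : peval (p * q) v = peval p v * peval q v.
Proof. exact: mevalM. Qed.

Lemma pevalZ c p v : peval (c *: p) v = c * peval p v.
Proof. exact: mevalZ. Qed.

Lemma peval_sum I (r : seq I) (F : I -> S) v :
  peval (\sum_(i <- r) F i) v = \sum_(i <- r) peval (F i) v.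
Proof. by rewrite /peval rmorph_sum. Qed.

Lemma pevalX i v : peval 'X_i v = v (enum_val i).
Proof. exact: mevalXU. Qed.

Lemma ideal_vanishing V : ideal (vanishing V).
Proof.
split; first by move=> v _; apply: meval0.
- by move=> p q hp hq v Vv; rewrite pevalD hp // hq // addr0.
- by move=> p q hq v Vv; rewrite pevalM hq // mulr0.
Qed.

Lemma peval_rescale_homog d p c v : mhomog grd d p ->
  peval p (rescale blk c v) = (\prod_j c (enum_val j) ^+ d j) * peval p v.
Proof.
move=> hp; rewrite /peval !mevalE mulr_sumr; apply: eq_big_seq => m mp.
have hd : multideg grd m = d by apply: hp; rewrite -mcoeff_msupp.
rewrite mulrCA; congr (_ * _); under eq_bigr do rewrite ffunE exprMn.
rewrite big_split /=; congr (_ * _).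
rewrite (partition_big grd xpredT) //=; apply: eq_bigr => j _.
rewrite -hd mnmE -prodrXr; apply: eq_bigr => i /eqP <-.
by rewrite /grd enum_rankK.
Qed.

Lemma peval_rescale p c v : peval p (rescale blk c v) =
  \sum_(d <- degs grd p) (\prod_j c (enum_val j) ^+ d j) * peval (hpart grd d p) v.
Proof.
rewrite {1}[p](hpartE grd) peval_sum; apply: eq_bigr => d _.
by apply: peval_rescale_homog; apply: hpart_homog.
Qed.

(** For p vanishing on V and v in V, the value of p at a rescaling of v is a polynomial in the
    scaling factors, with the values at v of the components of p as coefficients. It vanishes on the
    torus, hence is zero. *)
Lemma hideal_vanishing V : mp_set blk V -> hideal (vanishing V).
Proof.
move=> [_ hV]; split; first exact: ideal_vanishing.
move=> d p hp v Vv.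
pose Q : {mpoly K[#|B|]} := \sum_(e <- degs grd p) peval (hpart grd e p) v *: 'X_[e].
have Q0 : Q = 0.
  apply/eqP; apply: contraT => Q0.
  (* The product of the variables forces a nonzero value to occur at invertible scaling factors. *)
  have : Q * \prod_(j < #|B|) 'X_j != 0.
    by rewrite mulf_neq0 //; apply/prodf_neq0 => j _; rewrite -msize_poly_eq0 msizeX.
  case/mpoly_nonzero => c; rewrite mevalM rmorph_prod /= mulf_eq0 negb_or => /andP[+ /prodf_neq0 hc].
  have hc' b : c (enum_rank b) != 0 by have := hc (enum_rank b) isT; rewrite mevalXU.
  rewrite -[X in X != 0](_ : peval p (rescale blk (fun b => c (enum_rank b)) v) = _).
    by rewrite hp ?eqxx //; apply: hV.
  rewrite peval_rescale raddf_sum /=; apply: eq_bigr => e _.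
  by rewrite mevalZ mevalX mulrC; congr (_ * _); apply: eq_bigr => j _; rewrite enum_valK.
have [hd|] := boolP (d \in degs grd p); last first.
  move=> nd; have [->|/hpart_degs hd] := eqVneq (hpart grd d p) 0; first exact: meval0.
  by rewrite hd in nd.
have := congr1 (mcoeff d) Q0; rewrite mcoeff0 raddf_sum /= (bigD1_seq d) ?undup_uniq //=.
rewrite mcoeffZ mcoeffX eqxx mulr1 big1 ?addr0 // => e ne.
by rewrite mcoeffZ mcoeffX (negPf ne) mulr0.
Qed.

Lemma prime_vanishing V : subvariety blk V -> prime_ideal (vanishing V).
Proof.
move=> [_ [v Vv] _ hM]; split=> //; first exact: ideal_vanishing.
by move=> /(_ v Vv) /eqP; rewrite [peval _ _]meval1 oner_eq0.
Qed.

Lemma subvariety_hideal V : subvariety blk V -> hideal (vanishing V).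
Proof. by case=> h _ _ _; apply: hideal_vanishing. Qed.

Lemma relevant_vanishing V : subvariety blk V -> relevant (vanishing V).
Proof.
move=> [[hV _] [v Vv] _ _] j; have [t tj vt] := hV v Vv (enum_val j).
exists (enum_rank t); first by rewrite /grd enum_rankK tj enum_valK.
by move=> /(_ v Vv); rewrite pevalX enum_rankK => v0; rewrite v0 eqxx in vt.
Qed.

(** The zero has to be a point of the product, nonzero in each block; so it must avoid, besides p,
    one variable outside P for each block. *)
Lemma vanishing_zeros P : prime_ideal P -> relevant P -> vanishing (zeros P) = P.
Proof.
move=> prP rel; apply: pred_ext => p; split; last by move=> hp v [_]; apply.
move=> hp; apply: NNPP => np; have [iP P1 hM] := prP.
have rel' j : exists i, grd i = j /\ ~ P 'X_i by have [i h1 h2] := rel j; exists i.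
have [f hf] := functional_choice rel'.
have nprod : ~ P (p * \prod_j 'X_(f j)).
  move=> /hM [//|]; elim/big_ind: _ => //.
    by move=> x y hx hy /hM [].
  by move=> j _; case: (hf j).
have [c hc] := prime_zero prP nprod.
rewrite mevalM mulf_eq0 negb_or rmorph_prod /= => /andP[pc /prodf_neq0 fc].
pose v : vect := [ffun t => c (enum_rank t)].
have ev q : peval q v = q.@[c].
  by apply: meval_eq => i; rewrite ffunE enum_valK.
case/negP: pc; rewrite -ev hp //; split; last by move=> q /hc; rewrite ev.
move=> b; exists (enum_val (f (enum_rank b))).
  by have [h _] := hf (enum_rank b); apply: enum_rank_inj; exact: h.
by have := fc (enum_rank b) isT; rewrite mevalXU ffunE enum_valK.
Qed.

Lemma zeros_subvariety P : hideal P -> prime_ideal P -> relevant P -> subvariety blk (zeros P).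
Proof.
move=> hP prP rel; have [iP P1 hM] := prP; have van := vanishing_zeros prP rel; split.
- split; first by move=> v [].
  move=> c v c0 [pv hv]; split.
    by move=> b; have [t tb vt] := pv b; exists t => //; rewrite ffunE mulf_neq0.
  move=> p hp; rewrite peval_rescale big1 // => d _; rewrite hv ?mulr0 //.
  by case: hP => _; apply.
- apply: NNPP => h; apply: P1; rewrite -van => v hv; by case: h; exists v.
- by move=> v [pv hv]; split=> // p; rewrite -{1}van; apply: hv.
- by rewrite van.
Qed.

Lemma zeros_vanishing V : subvariety blk V -> zeros (vanishing V) = V.
Proof.
move=> [[hp _] _ cl _]; apply: pred_ext => v; split; first exact: cl.
by move=> Vv; split; [exact: hp | move=> p; apply].
Qed.

Lemma vanishing_incl V W : incl V W -> incl (vanishing W) (vanishing V).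
Proof. by move=> le p hp v /le; apply: hp. Qed.

Lemma zeros_incl P Q : incl P Q -> incl (zeros Q) (zeros P).
Proof. by move=> le v [pv hv]; split=> // p /le; apply: hv. Qed.

Lemma subvariety_incl V W : subvariety blk W -> incl (vanishing W) (vanishing V) ->
  mp_set blk V -> incl V W.
Proof.
move=> [_ _ cl _] le [hV _] v Vv; apply: cl; split; first exact: hV.
by move=> p /le; apply.
Qed.

Lemma strict_vanishing V W : subvariety blk V -> subvariety blk W -> strict_incl V W ->
  strict_incl (vanishing W) (vanishing V).
Proof.
move=> sV sW [le nle]; split; first exact: vanishing_incl.
by move=> h; apply: nle; apply: subvariety_incl => //; case: sW.
Qed.

Lemma relevant_monomial P d : prime_ideal P -> relevant P ->
  exists2 m, multideg grd m = d & ~ P 'X_[m].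
Proof.
move=> [iP P1 hM] rel.
have rel' j : exists i, grd i = j /\ ~ P 'X_i by have [i h1 h2] := rel j; exists i.
have [f hf] := functional_choice rel'.
exists (\sum_j U_(f j) *+ d j)%MM.
  have multidegMn u n : multideg grd (u *+ n)%MM = (multideg grd u *+ n)%MM.
    by elim: n => [|n IHn]; rewrite ?mulm0n ?multideg0 // !mulmS multidegD IHn.
  rewrite (big_morph _ (multidegD grd) (multideg0 grd)) [RHS]multinomUE_id; apply: eq_bigr => j _.
  by rewrite multidegMn multidegU; case: (hf j) => ->.
rewrite -mprodXE; elim/big_ind: _ => // [x y hx hy /hM[]//|j _].
by rewrite -mpolyXn => /(prime_exp (And3 iP P1 hM)) h; case: (hf j).
Qed.

(** Each multidegree contains a monomial outside P, so the Hilbert function takes no zero value. *)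
Lemma relevant_ndeg0 P : prime_ideal P -> relevant P -> ~ deglt 0 (HF P).
Proof.
move=> prP rel [d0 h0]; have := h0 0%MM; have [iP _ _] := prP.
rewrite addm0 /HF => /eqP; rewrite eqz_nat => /eqP h.
have [m hm nm] := relevant_monomial d0 prP rel.
have := @hilb_indep _ _ _ grd P d0 1 (fun=> 'X_[m]) iP.
rewrite h => H; suff : (0 < 0)%N by []; apply: H => [_|c hc i].
  by rewrite -hm; apply: mhomogX.
apply: NNPP => /eqP c0; apply: nm.
move: hc; rewrite big_ord1 ord1 in c0 * => /(@ideal_mull _ _ (c 0)^-1%:MP _ iP).
by rewrite mul_mpolyC scalerA mulVf // scale1r.
Qed.

Lemma ndeg0_relevant P r : ideal P -> ~ deglt r (HF P) -> relevant P.
Proof.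
move=> iP n; apply: NNPP => /(irrelevant_HF iP) h; apply: n.
exact: (@deglt_leq _ 0).
Qed.

End Varieties.

(** * Hyperplane numbers as differences of Hilbert functions *)

Lemma ev_sum_list k (A : Type) (s : seq A) (F : A -> 'X_{1..k} -> int) (c : A -> int) :
  (forall a, List.In a s -> ev (fun d => F a d = c a)) ->
  ev (fun d => \sum_(a <- s) F a d = \sum_(a <- s) c a).
Proof.
elim: s => [|a s IHs] h; first by apply: evT => d; rewrite !big_nil.
apply: ev_and2 (h a (or_introl erefl)) (IHs (fun b hb => h b (or_intror hb))) => d ha hs.
by rewrite !big_cons ha hs.
Qed.

Section Numbers.
Variables (K : closedFieldType) (T B : finType) (blk : T -> B).
Local Notation vect := {ffun T -> K}.
Local Notation S := {mpoly K[#|T|]}.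
Implicit Types (v w : vect) (V W Y Z : vect -> Prop) (p q x : S) (P J Q : S -> Prop).
Implicit Types (s : seq ('X_{1..#|B|} * (S -> Prop))) (bs : seq B).

Local Notation grd := (grd blk).
Local Notation hideal := (hideal grd).
Local Notation HF := (HF grd).
Local Notation relevant := (relevant grd).
Local Notation zeros := (zeros blk).
Local Notation rk := (map (@enum_rank B)).

Lemma linear_form_homog b c : mhomog grd U_(enum_rank b)%MM (linear_form (K := K) blk b c).
Proof.
rewrite /linear_form -big_filter; set r := filter _ _.
have hr t : t \in r -> blk t == b by rewrite mem_filter => /andP[].
elim: r hr => [|t r IHr] hr; first by rewrite big_nil; case: (subsp_mhomog K grd U_(enum_rank b)%MM).
rewrite big_cons; have [_ h] := subsp_mhomog K grd U_(enum_rank b)%MM; apply: h.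
  have <- : grd (enum_rank t) = enum_rank b by rewrite grdE enum_rankK (eqP (hr t (mem_head _ _))).
  exact: mhomogU.
by apply: IHr => u hu; apply: hr; rewrite inE hu orbT.
Qed.

Lemma sum_one r (F : 'I_r -> S -> Prop) (y : 'I_r -> nat) Q k0 :
  (forall k, F k = F k0 -> k = k0) -> Q = F k0 ->
  \sum_(k < r) (decide_prop (Q = F k) * y k)%N%:Z = (y k0)%:Z :> int.
Proof.
move=> inj ->; rewrite (bigD1 k0) //=; case: pdecP => // _; rewrite mul1n.
rewrite big1 ?addr0 // => k ne; case: pdecP => // e.
by rewrite (inj k (esym e)) eqxx in ne.
Qed.

Lemma sum_none r (F : 'I_r -> S -> Prop) (y : 'I_r -> nat) Q :
  (forall k, Q <> F k) -> \sum_(k < r) (decide_prop (Q = F k) * y k)%N%:Z = 0 :> int.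
Proof. by move=> h; rewrite big1 // => k _; case: pdecP => // /h. Qed.

Lemma sum_occurrences r s (F : 'I_r -> S -> Prop) (y : 'I_r -> nat) :
  \sum_(a <- s) (\sum_(k < r) (decide_prop (a.2 = F k) * y k)%N%:Z) =
  (\sum_(k < r) occurrences (F k) s * y k)%N%:Z :> int.
Proof.
rewrite exchange_big /= -natz natr_sum; apply: eq_bigr => k _.
rewrite natz; elim: s => [|a s IHs]; first by rewrite big_nil.
by rewrite big_cons IHs /occurrences /= mulnDl PoszD.
Qed.

(* The prime quotients of a filtration of S / J that correspond to the listed
   subvarieties are the only ones on which the differences do not vanish. *)
Lemma diffs_pfilt js J s r (F : 'I_r -> S -> Prop) (y : 'I_r -> nat) :
  pfilt grd J s -> hideal J -> injective F ->
  (forall k, deglt (size js).+1 (HF (F k))) ->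
  (forall k, ev (fun d => diffs (js) (HF (F k)) d = (y k)%:Z)) ->
  (forall a, List.In a s -> (forall k, a.2 <> F k) -> deglt (size js) (HF a.2)) ->
  ev (fun d => diffs (js) (HF J) d = (\sum_(k < r) occurrences (F k) s * y k)%N%:Z).
Proof.
move=> hs hJ inj dF hy small.
apply: ev_and2 (diffs_ev (js) (pfilt_HF hs hJ))
  (@ev_sum_list _ _ s (fun a => diffs (js) (sh a.1 (HF a.2)))
    (fun a => \sum_(k < r) (decide_prop (a.2 = F k) * y k)%N%:Z) _).
  by move=> d -> e; rewrite -sum_occurrences -e; apply: diffs_sum.
move=> a ha; have [[k ak]|no] := classic (exists k, a.2 = F k).
  have eq := sum_one y (fun k' (e : F k' = F k) => inj _ _ e) ak.
  rewrite ak in eq *; apply: ev_mono (diffs_sh a.1 (c := (y k)%:Z) _ (hy k)) => //.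
  by move=> d ->; rewrite -eq.
have {}no k : a.2 <> F k by move=> e; apply: no; exists k.
have := diffs_deglt0 (deglt_sh a.1 (small a ha no)).
by apply: ev_mono => d ->; rewrite sum_none.
Qed.

Lemma sat_over_local V W l : local_ideal V W l = sat_over (vanishing W) (adjoin (vanishing V) l).
Proof.
apply: pred_ext => Q; split.
  by move=> [h1 h2 h3 h4]; split=> //; apply: adjoin_sub.
move=> [h1 h2 h3]; split=> //; first by move=> p /(@sub_adjoin _ (vanishing V) l); apply: h3.
by apply/h3/mem_adjoin/ideal_vanishing.
Qed.

Lemma codim1_prime V W a : subvariety blk V -> codim1 blk V W ->
  strict_incl (vanishing V) a -> hideal a -> prime_ideal a -> incl a (vanishing W) -> a = vanishing W.
Proof.
move=> sV [sW ltW max] [le nle] ha pa leW.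
have rel : relevant a.
  by move=> j; have [i h1 h2] := relevant_vanishing sW j; exists i => // /leW.
have sY := zeros_subvariety ha pa rel; have van := vanishing_zeros pa rel.
have WY : incl W (zeros a).
  by rewrite -(zeros_vanishing sW); apply: zeros_incl.
have YV : incl (zeros a) V.
  by rewrite -(zeros_vanishing sV); apply: zeros_incl.
case: (max _ sY WY YV) => /pred_ext e; rewrite -van e //.
by case: nle; rewrite -van e.
Qed.

(** Evaluation at the point identifies every multihomogeneous part of the quotient with K. *)
Lemma single_point_HF V : subvariety blk V -> single_point blk V ->
  ev (fun d => HF (vanishing V) d = 1).
Proof.
move=> sV [v pv hV]; apply: evT => d; rewrite HFE; congr Posz.
have ev0 p : mhomog grd d p -> vanishing V p <-> peval p v = 0.
  move=> hp; split; last by move=> h w /hV [c _ ->]; rewrite (peval_rescale_homog _ _ hp) h mulr0.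
  apply; apply/hV; exists (fun=> 1); first by move=> b; apply: oner_neq0.
  by apply/ffunP => t; rewrite ffunE mul1r.
apply: hilb_eq; first exact: ideal_vanishing.
have [m hm nm] := relevant_monomial d (prime_vanishing sV) (relevant_vanishing sV).
have hX : mhomog grd d ('X_[m] : S) by rewrite -hm; apply: mhomogX.
have {nm} nX : peval ('X_[m] : S) v != 0 by apply/eqP => h; apply/nm/ev0.
have hZ := subspZ _ (subsp_mhomog K grd d); have hB := subspB (subsp_mhomog K grd d).
exists (fun=> 'X_[m]); split=> // [c|p hp].
  rewrite big_ord1 => /(ev0 _ (hZ _ _ hX)) /eqP; rewrite /peval mevalZ mulf_eq0 (negPf nX) orbF.
  by move/eqP => c0 i; rewrite ord1.
exists (fun=> peval p v / peval ('X_[m] : S) v); rewrite big_ord1.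
apply/ev0; first by apply: hB => //; apply: hZ.
by rewrite /peval mevalB mevalZ divfK // subrr.
Qed.

Lemma sub_proper V l W : vanishing W l -> ~ vanishing V l -> incl W V -> strict_incl W V.
Proof. by move=> hW nV le; split=> // h; apply: nV => v /h; apply: hW. Qed.

Theorem hyperplane_diffs bs V z : hyperplane_number blk bs V z -> subvariety blk V ->
  deglt (size bs).+1 (HF (vanishing V)) ->
  ev (fun d => diffs (rk bs) (HF (vanishing V)) d = z%:Z).
Proof.
elim: bs V z => [|b bs IHbs] V z.
  by move=> [pV ->] sV _; apply: single_point_HF.
move=> [c [r [W [m [y [nl [allW injW exW] hm hy ->]]]]]] sV dV.
set l := linear_form blk b c in nl allW exW hm.
have hl : mhomog grd U_(enum_rank b)%MM l by apply: linear_form_homog.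
have hP := subvariety_hideal sV; have prP := prime_vanishing sV; have [iP _] := hP.
have hJ := hideal_adjoin hP hl; have [s hs] := pfilt_ex hJ; have [iJ _] := hJ.
have mem := pfilt_mem hs hJ.
have subV a : List.In a s -> strict_incl (vanishing V) a.2.
  move=> ha; have [_ _ le] := mem a ha; split.
    by move=> p hp; apply/le/sub_adjoin.
  by move=> h; apply/nl/h/le/mem_adjoin.
have sW k : subvariety blk (W k) by have [[]] := allW k.
have ltW k : strict_incl (W k) V by have [[]] := allW k.
have dW k : deglt (size bs).+1 (HF (vanishing (W k))).
  exact: HF_drop hP prP (subvariety_hideal (sW k)) (strict_vanishing (sW k) sV (ltW k)) dV.
(* A prime strictly larger than the ideal of V and contained in that of W equals the latter, by
   codimension one; so the occurrences count the length. *)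
have cntW k : occurrences (vanishing (W k)) s = m k.
  have := hm k; rewrite /ord_along sat_over_local; apply: max_chain_uniq.
  apply: (pfilt_length hs iJ (prime_vanishing (sW k))) => a ha le.
  have [h1 h2 h3] := mem a ha; have lt := subV a ha; have [cW _] := allW k.
  exact: codim1_prime sV cW lt h1 h2 le.
have step : ev (fun d => diffs (rk bs) (HF (adjoin (vanishing V) l)) d
    = (\sum_(k < r) occurrences (vanishing (W k)) s * y k)%N%:Z).
  apply: (diffs_pfilt hs hJ); rewrite ?size_map //.
  - move=> k k' e; apply: injW; rewrite -(zeros_vanishing (sW k)) e zeros_vanishing //.
  - by move=> k; exact: IHbs (hy k) (sW k) (dW k).
  - move=> a ha no; have [h1 h2 h3] := mem a ha; have lt := subV a ha.
    have [rel|nrel] := classic (relevant a.2); last first.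
      by apply: (@deglt_leq _ 0) => //; apply: irrelevant_HF => //; case: h1.
    have sZ := zeros_subvariety h1 h2 rel; have van := vanishing_zeros h2 rel.
    have ltZ : strict_incl (zeros a.2) V.
      apply: (sub_proper (l := l)) => //; first by rewrite van; apply/h3/mem_adjoin.
      by rewrite -(zeros_vanishing sV); apply: zeros_incl; case: lt.
    have [cZ|ncZ] := classic (codim1 blk V (zeros a.2)).
      have [|k hk] := exW (zeros a.2); first by split=> //; rewrite van; apply/h3/mem_adjoin.
      by case: (no k); rewrite -van (pred_ext hk).
    (* A factor of higher codimension: with a subvariety strictly in between, the degree drops
       twice, and the remaining differences vanish. *)
    have [Y [sY ltY1 ltY2]] : exists Y, [/\ subvariety blk Y, strict_incl (zeros a.2) Y & strict_incl Y V].
      apply: NNPP => h; apply: ncZ; split=> // Y sY le1 le2; apply: NNPP => nn; apply: h.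
      exists Y; split=> //; split=> // le3; apply: nn; [left|right] => v; split.
      - exact: le3.
      - exact: le1.
      - exact: le2.
      - exact: le3.
    have dY := HF_drop hP prP (subvariety_hideal sY) (strict_vanishing sY sV ltY2) dV.
    have ltP := strict_vanishing sZ sY ltY1; rewrite van in ltP.
    exact: HF_drop (subvariety_hideal sY) (prime_vanishing sY) h1 ltP dY.
have e : ev (fun d => df (enum_rank b) (HF (vanishing V)) d =
    HF (adjoin (vanishing V) l) (d + U_(enum_rank b))%MM).
  apply: evT => d; rewrite /df !HFE (hilb_adjoin d hP hl) PoszD.
  rewrite (_ : colon (vanishing V) l = vanishing V) ?addrK //.
  case: prP => _ _ hM; apply: pred_ext => p; split; first by case/hM.
  exact: sub_colon.
rewrite /=; apply: ev_and2 (diffs_ev (rk bs) e) (ev_shift U_(enum_rank b)%MM step) => d ->.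
rewrite diffs_add => ->; congr Posz; apply: eq_bigr => k _.
by rewrite cntW.
Qed.

End Numbers.

(** * Dimension and degree *)

Section Dimension.
Variables (K : closedFieldType) (T B : finType) (blk : T -> B).
Local Notation vect := {ffun T -> K}.
Local Notation S := {mpoly K[#|T|]}.
Implicit Types (v w : vect) (V W Y Z : vect -> Prop) (p q x : S) (P J Q : S -> Prop).
Implicit Types (s : seq ('X_{1..#|B|} * (S -> Prop))) (bs : seq B).

Local Notation grd := (grd blk).
Local Notation hideal := (hideal grd).
Local Notation HF := (HF grd).
Local Notation relevant := (relevant grd).
Local Notation zeros := (zeros blk).

Lemma chain_deglt Z r k (c : nat -> vect -> Prop) : hideal (vanishing Z) ->
  strict_chain (fun V => subvariety blk V /\ incl V Z) k c ->
  deglt r.+1 (HF (vanishing Z)) -> (k <= r)%N.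
Proof.
move=> hZ [hc sc] dZ; rewrite leqNgt; apply/negP => lt.
have H j : (j <= r.+1)%N -> deglt (r.+1 - j) (HF (vanishing (c (k - j)%N))).
  elim: j => [_|j IHj hj].
    have [sk le] := hc k (leqnn k); rewrite !subn0.
    by apply: HF_sub hZ (subvariety_hideal sk) _ dZ; apply: vanishing_incl.
  have hk : (k - j.+1 < k)%N by lia.
  have e : (k - j.+1).+1 = (k - j)%N by lia.
  have [s1 _] := hc _ (ltnW hk); have [s2 _] := hc (k - j)%N (leq_subr _ _).
  have := sc _ hk; rewrite e => /(strict_vanishing s1 s2) st.
  have := IHj (ltnW hj); rewrite (_ : r.+1 - j = (r.+1 - j.+1).+1)%N; last by lia.
  exact: HF_drop (subvariety_hideal s2) (prime_vanishing s2) (subvariety_hideal s1) st.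
have := H r.+1 (leqnn _); rewrite subnn.
have [s1 _] := hc (k - r.+1)%N (leq_subr _ _).
exact: relevant_ndeg0 (prime_vanishing s1) (relevant_vanishing s1).
Qed.

Lemma chain_exists r P : hideal P -> prime_ideal P -> ~ deglt r (HF P) ->
  exists2 c, strict_chain (fun V => subvariety blk V /\ incl V (zeros P)) r c & c r = zeros P.
Proof.
elim: r P => [|r IHr] P hP prP nr; have [iP _] := hP.
  have sP := zeros_subvariety hP prP (ndeg0_relevant iP nr).
  by exists (fun=> zeros P) => //; split=> // i _; split.
have [P' [hP' prP' lt nr']] := prime_ndeg_step hP prP nr.
have [c [hc sc] cr] := IHr P' hP' prP' nr'; have [iP' _] := hP'.
have sP := zeros_subvariety hP prP (ndeg0_relevant iP nr).
have rel' := ndeg0_relevant iP' nr'.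
have le := zeros_incl (blk := blk) (proj1 lt).
exists (fun i => if (i <= r)%N then c i else zeros P); last by rewrite ltnn.
split=> i hi.
  case: leqP => h; last by split.
  by have [h1 h2] := hc i h; split=> // v /h2; apply: le.
rewrite ltnS in hi; rewrite hi; have [h|h] := leqP i.+1 r; first exact: sc.
have {h}-> : i = r by apply/eqP; rewrite eqn_leq hi.
rewrite cr; split=> // h; apply: (proj2 lt).
rewrite -(vanishing_zeros prP' rel') -(vanishing_zeros prP (ndeg0_relevant iP nr)).
exact: vanishing_incl.
Qed.

(** The dimension is the degree of the Hilbert function: each strict inclusion lowers the degree,
    and some prime factor of the ideal of Z keeps it and starts a chain of full length. *)
Lemma dimension_exact Z r : mp_set blk Z -> incl (zclosure blk Z) Z ->
  deglt r.+1 (HF (vanishing Z)) -> ~ deglt r (HF (vanishing Z)) -> dimension blk Z r.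
Proof.
move=> mZ cZ dZ nZ; have hZ := hideal_vanishing mZ; split; last first.
  by move=> k c h; apply: chain_deglt h dZ.
have [s hs] := pfilt_ex hZ; have [a [ha na]] := pfilt_ndeg hs hZ nZ.
have [h1 h2 h3] := pfilt_mem hs hZ ha.
have [c [hc sc] _] := chain_exists h1 h2 na; exists c; split=> // i hi.
have [ci le] := hc i hi; split=> // v /le [pv hv]; apply: cZ; split=> // p /h3; exact: hv.
Qed.

Lemma dimension_deg Z r : mp_set blk Z -> incl (zclosure blk Z) Z -> dimension blk Z r ->
  deglt r.+1 (HF (vanishing Z)) /\ ~ deglt r (HF (vanishing Z)).
Proof.
move=> mZ cZ dim; have hZ := hideal_vanishing mZ.
have [r0 h0] := hilbert_serre hZ.
have n0 : ~ deglt 0 (HF (vanishing Z)).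
  have [[c [/(_ 0%N (leq0n _)) [s0 le] _]] _] := dim => h.
  apply: (relevant_ndeg0 (prime_vanishing s0) (relevant_vanishing s0)).
  exact: HF_sub hZ (subvariety_hideal s0) (vanishing_incl le) h.
have [r1 d1 n1] : exists2 r1, deglt r1.+1 (HF (vanishing Z)) & ~ deglt r1 (HF (vanishing Z)).
  elim: r0 h0 => [//|r0 IHr h]; have [h'|h'] := classic (deglt r0 (HF (vanishing Z))).
    exact: IHr.
  by exists r0.
by rewrite (max_chain_uniq dim (dimension_exact mZ cZ d1 n1)).
Qed.

(** S / J is annihilated by the product, over the factors of the filtration, of p for each S / P and
    of an element outside P for each other factor. *)
Lemma pfilt_prod J s P p : pfilt grd J s -> ideal J -> prime_ideal P -> P p ->
  (forall a, List.In a s -> a.2 = P \/ exists2 w : S, a.2 w & ~ P w) ->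
  exists (w : S) (n : nat), ~ P w /\ J (w * p ^+ n).
Proof.
move=> hs iJ prP Pp; have [_ P1 hM] := prP.
elim: hs iJ => {J s} [J J1 iJ _|J x e s hx prx _ IH iJ h].
  by exists 1, 0%N; rewrite expr0 mulr1.
have [|w [n [nw [q Jq [a eq]]]]] := IH (ideal_adjoin x iJ); first by move=> a ha; apply: h; right.
have [eP|[u hu nu]] := h _ (or_introl erefl).
  exists w, n.+1; split=> //; rewrite exprSr mulrA eq mulrDl; apply: idealD => //.
    exact: ideal_mulr.
  rewrite -mulrA; apply: ideal_mull => //; rewrite mulrC.
  by have : P p := Pp; rewrite -eP.
exists (u * w), n; split; first by case/hM.
rewrite -mulrA eq mulrDr; apply: idealD => //; first exact: ideal_mull.
by rewrite mulrCA; apply: ideal_mull.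
Qed.

(* The ideal of Z is radical, hence coincides with P locally at P. *)
Lemma occurrences_component Z s P r : hideal (vanishing Z) -> pfilt grd (vanishing Z) s ->
  hideal P -> prime_ideal P -> incl (vanishing Z) P ->
  deglt r.+1 (HF (vanishing Z)) -> ~ deglt r (HF P) -> occurrences P s = 1%N.
Proof.
move=> hZ hs hP prP le dZ nP; have iZ := ideal_vanishing Z; have [iP P1 hM] := prP.
have mem a : List.In a s -> incl a.2 P -> a.2 = P.
  move=> ha leP; have [h1 h2 h3] := pfilt_mem hs hZ ha.
  apply: pred_ext => p; split; first exact: leP.
  move=> Pp; apply: NNPP => np; apply: nP.
  apply: HF_drop h1 h2 hP _ (HF_sub hZ h1 h3 dZ); split=> // h; exact/np/h.
have loc p : P p -> satur P (vanishing Z) p.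
  move=> Pp; have [|w [n [nw h]]] := pfilt_prod hs iZ prP Pp.
    move=> a ha; have [->|na] := classic (a.2 = P); first by left.
    right; apply: NNPP => h; apply: na; apply: mem => // w hw.
    by apply: NNPP => nw; apply: h; exists w.
  exists w => // v Zv; have := h v Zv; rewrite !pevalM => /eqP.
  rewrite mulf_eq0 => /orP[/eqP->|]; first by rewrite mul0r.
  by rewrite /peval rmorphXn /= expf_eq0 => /andP[_ /eqP->]; rewrite mulr0.
have dich Q : sat_over P (vanishing Z) Q -> Q 1 \/ Q = P.
  move=> [iQ sQ leQ]; have [Q1|Q1] := classic (Q 1); [by left | right].
  apply: pred_ext => p; split=> h.
    by apply: NNPP => np; apply/Q1/(sQ p) => //; rewrite mulr1.
  by have [w nw hw] := loc p h; apply: (sQ w) => //; apply: leQ.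
apply: max_chain_uniq (pfilt_length hs iZ prP mem) _; split.
  exists (fun i => if i is 0 then P else fun=> True); split.
    case=> [|i] _; last by split.
    by split=> // a p na /hM [].
  by case=> // _; split=> // /(_ 1 I).
move=> k c [hc sc]; rewrite leqNgt; apply/negP => lt.
have full i j : (i < k)%N -> j = i.+1 -> c i 1 -> False.
  move=> hi _ h1; case: (sc i hi) => _; apply=> p _; have [iQ _ _] := hc i (ltnW hi).
  by rewrite -[p]mulr1; apply: ideal_mull.
have k0 : (0 < k)%N by apply: ltnW.
have [h|h0] := dich _ (hc 0%N (leq0n _)); first exact: (full 0%N 1%N).
have [h|h1] := dich _ (hc 1%N k0); first exact: (full 1%N 2%N).
by case: (sc 0%N k0) => _; apply; rewrite h0 h1.
Qed.

End Dimension.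

(** Factors of smaller dimension disappear under r differences, and each component of dimension r
    occurs exactly once, the ideal of Z being radical. *)
Theorem proj_degree_diffs (K : closedFieldType) (T : finType) (Z : {ffun T -> K} -> Prop) d :
  mp_set (fun=> tt) Z -> incl (zclosure (fun=> tt) Z) Z -> proj_degree Z d ->
  exists r, [/\ deglt r.+1 (HF (grd (fun=> tt)) (vanishing Z)),
    ~ deglt r (HF (grd (fun=> tt)) (vanishing Z)) &
    ev (fun e => diffs (nseq r (enum_rank tt)) (HF (grd (fun=> tt)) (vanishing Z)) e = d%:Z)].
Proof.
move=> mZ cZ [r [k [Y [z [dim [allY injY exY] hz ->]]]]].
have hZ := hideal_vanishing mZ; have [dZ nZ] := dimension_deg mZ cZ dim.
exists r; split=> //; have [s hs] := pfilt_ex hZ.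
have sY i : subvariety (fun=> tt) (Y i) by have [] := allY i.
have leY i : incl (Y i) Z by have [] := allY i.
have dY i : deglt r.+1 (HF (grd (fun=> tt)) (vanishing (Y i))) /\
    ~ deglt r (HF (grd (fun=> tt)) (vanishing (Y i))).
  have [_ _] := allY i; apply: dimension_deg; by case: (sY i).
have cY i : occurrences (vanishing (Y i)) s = 1%N.
  apply: (occurrences_component hZ hs (subvariety_hideal (sY i)) (prime_vanishing (sY i)) _ dZ).
    exact: vanishing_incl.
  by case: (dY i).
have := @diffs_pfilt K T unit (fun=> tt) (nseq r (enum_rank tt)) _ s k
  (fun i => vanishing (Y i)) z hs hZ.
rewrite size_nseq => H; rewrite (eq_bigr (fun i => occurrences (vanishing (Y i)) s * z i)%N); last first.
  by move=> i _; rewrite cY mul1n.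
apply: H => [i j e|i|i|a ha no].
- by apply: injY; rewrite -(zeros_vanishing (sY i)) e zeros_vanishing.
- by case: (dY i).
- have := hyperplane_diffs (hz i) (sY i); rewrite size_nseq map_nseq; apply.
  by case: (dY i).
have [h1 h2 h3] := pfilt_mem hs hZ ha; apply: NNPP => na.
have rel := ndeg0_relevant (proj1 h1) na.
have sa := zeros_subvariety h1 h2 rel; have van := vanishing_zeros h2 rel.
have [i hi] : exists i, same (zeros (fun=> tt) a.2) (Y i).
  apply: exY; split=> //.
    by move=> v [pv hv]; apply: cZ; split=> // p /h3; apply: hv.
  case: (sa) => m1 _ c1 _; apply: dimension_exact => //; rewrite van //.
  exact: HF_sub hZ h1 h3 dZ.
by apply: (no i); rewrite -van (pred_ext hi).
Qed.

(** * Symmetric matrices *)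

Section SymmetricMatrices.
Variable K : closedFieldType.
Hypothesis two0 : 2%:R != 0 :> K.

Lemma closed_sqrt (a : K) : exists b, b ^+ 2 = a.
Proof.
have [|b /rootP] := closed_rootP ('X^2 - a%:P : {poly K}) _.
  by rewrite size_XnsubC.
by rewrite !hornerE => /eqP; rewrite subr_eq0 => /eqP; exists b.
Qed.

(** By polarization, where 2 is inverted, a symmetric Q with v^T Q v = 0 for all v is zero; a square
    root normalizes the value to 1. *)
Lemma sym_nonzero_form m (Q : 'M[K]_m) : Q^T = Q -> Q != 0 ->
  exists v : 'cV[K]_m, (v^T *m Q *m v) 0 0 = 1.
Proof.
move=> symQ Q0.
have val (v w : 'cV[K]_m) : (v^T *m Q *m w) 0 0 = (w^T *m Q *m v) 0 0 :> K.
  have : (v^T *m Q *m w)^T = w^T *m Q *m v by rewrite !trmx_mul symQ trmxK mulmxA.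
  by move/matrixP/(_ 0 0); rewrite [LHS]mxE.
have [v hv] : exists v : 'cV[K]_m, (v^T *m Q *m v) 0 0 != 0.
  apply: NNPP => h; move/negP: Q0; apply; apply/eqP/matrixP => i j.
  have {}h (v : 'cV[K]_m) : (v^T *m Q *m v) 0 0 = 0 :> K.
    by apply/eqP; apply: contraT => hv; case: h; exists v.
  pose d l : 'cV[K]_m := delta_mx l 0.
  have dQ l l' : ((d l)^T *m Q *m d l') 0 0 = Q l l'.
    by rewrite trmx_delta -rowE -colE !mxE.
  have := h (d i + d j).
  have trD : (d i + d j)^T = (d i)^T + (d j)^T by apply/matrixP => a b; rewrite !mxE.
  rewrite trD !mulmxDl !mulmxDr mxE [X in X + _ = _]mxE [X in _ + X = _]mxE.
  rewrite h h add0r addr0 (val (d j)) dQ -mulr2n -mulr_natl => /eqP.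
  by rewrite mulf_eq0 (negPf two0) /= mxE => /eqP.
have [b hb] := closed_sqrt ((v^T *m Q *m v) 0 0).
have b0 : b != 0 by apply: contraNneq hv => b0; rewrite -hb b0 expr0n.
have trZ : (b^-1 *: v)^T = b^-1 *: v^T by apply/matrixP => a c; rewrite !mxE.
exists (b^-1 *: v); rewrite trZ -!scalemxAl -scalemxAr scalerA mxE.
by rewrite -expr2 exprVn -hb mulVf // expf_neq0.
Qed.

(** Splitting off one square: if v^T Q v = 1, then Q - (Q v)(Q v)^T kills v while Q does not, so its
    rank is smaller. *)
Lemma sym_factor_rank m r (Q : 'M[K]_m) : Q^T = Q -> (\rank Q <= r)%N ->
  exists Y : 'M[K]_(r, m), Q = Y^T *m Y.
Proof.
elim: r Q => [|r IHr] Q symQ rQ.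
  exists 0; rewrite mulmx0; apply/eqP; by rewrite -mxrank_eq0 -leqn0.
have [->|Q0] := eqVneq Q 0; first by exists 0; rewrite mulmx0.
have [v hv] := sym_nonzero_form symQ Q0.
have hv' : v^T *m Q *m v = 1%:M by apply/matrixP => i j; rewrite !ord1 hv mxE.
pose Q' := Q - Q *m v *m (Q *m v)^T.
have symQ' : Q'^T = Q' by rewrite /Q' linearB /= symQ trmx_mul trmxK.
have eQ' : Q' = (1%:M - Q *m v *m v^T) *m Q.
  by rewrite /Q' trmx_mul symQ mulmxBl mul1mx !mulmxA.
have Q'v : Q' *m v = 0.
  by rewrite /Q' mulmxBl trmx_mul symQ -(mulmxA (Q *m v)) hv' mulmx1 subrr.
have Qv : Q *m v != 0.
  apply: contra_eq_neq hv => h; rewrite -mulmxA h mulmx0 mxE eq_sym; exact: oner_neq0.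
have lt : (\rank Q' < \rank Q)%N.
  rewrite ltn_neqAle eQ' mxrankM_maxr andbT -eQ'; apply: contra Qv => /eqP e.
  have le : (Q' <= Q)%MS by rewrite eQ' submxMl.
  have /submxP [A ->] : (Q <= Q')%MS by rewrite -(geq_leqif (mxrank_leqif_sup le)) e.
  by rewrite -mulmxA Q'v mulmx0.
have [Y' hY'] := IHr Q' symQ' (leq_trans lt rQ).
have e : Q = (col_mx (Q *m v)^T Y')^T *m col_mx (Q *m v)^T Y'.
  by rewrite tr_col_mx mul_row_col trmxK -hY' /Q' addrC subrK.
by exists (col_mx (Q *m v)^T Y').
Qed.

Lemma sym_factor m (Q : 'M[K]_m) : Q^T = Q -> exists Y : 'M[K]_m, Q = Y^T *m Y.
Proof. by move=> symQ; apply: sym_factor_rank symQ (rank_leq_row Q). Qed.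

Definition upper m (T : 'M[K]_m) := forall i j : 'I_m, (j < i)%N -> T i j = 0.

Definition lead_minor m (Q : 'M[K]_m.+1) k :=
  \det (\matrix_(i < k, j < k) Q (inord i) (inord j)).

(** The new column solves a triangular system, and its diagonal entry tau is a square root of the
    rest of q m m. The minor of size m + 1 has tau as a factor, so tau is nonzero. Indexing by
    natural numbers lets the size grow without casts. *)
Lemma cholesky_nat m (q : nat -> nat -> K) : (forall i j, q i j = q j i) ->
  (forall k, (k <= m)%N -> \det (\matrix_(i < k, j < k) q i j) != 0) ->
  exists t : nat -> nat -> K, [/\ forall i j, (j < i)%N -> t i j = 0,
    forall i, (i < m)%N -> t i i != 0 &
    forall i j, (i < m)%N -> (j < m)%N -> q i j = \sum_(l < m) t l i * t l j].
Proof.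
move=> symq; elim: m => [|m IHm] hq; first by exists (fun _ _ => 0).
have [|t [ut dt ht]] := IHm; first by move=> k hk; apply: hq; rewrite (leq_trans hk).
pose Tm := \matrix_(i < m, j < m) t i j.
have uTm : Tm^T \in unitmx.
  rewrite unitmx_tr unitmxE unitfE -det_tr det_trig.
    by apply/prodf_neq0 => i _; rewrite !mxE dt.
  by apply/is_trig_mxP => i j ij; rewrite !mxE ut.
pose u := invmx Tm^T *m \col_i q i m.
have hu (i : 'I_m) : \sum_(l < m) t l i * u l 0 = q i m.
  have : Tm^T *m u = \col_i q i m by rewrite mulmxA mulmxV // mul1mx.
  move/colP/(_ i); rewrite [RHS]mxE => <-; rewrite mxE; apply: eq_bigr => l _.
  by rewrite !mxE.
have [tau htau] := closed_sqrt (q m m - \sum_(l < m) u l 0 ^+ 2).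
pose t' i j := if (j < m)%N then t i j else if j == m then
  (if insub i is Some l then u l 0 else if i == m then tau else 0) else 0.
have t'l i j : (j < m)%N -> t' i j = t i j by rewrite /t' => ->.
have t'u (l : 'I_m) : t' l m = u l 0.
  by rewrite /t' ltnn eqxx insubT //= => h; congr (u _ 0); apply: val_inj.
have t'm : t' m m = tau by rewrite /t' ltnn eqxx insubF ?ltnn.
have ut' i j : (j < i)%N -> t' i j = 0.
  move=> ji; rewrite /t'; case: ltnP => jm; first exact: ut.
  case: eqP => // ejm; rewrite insubF ?(gtn_eqF _) -?ejm //.
  by apply/negbTE; rewrite -leqNgt ltnW.
have ht' i j : (i < m.+1)%N -> (j < m.+1)%N -> q i j = \sum_(l < m.+1) t' l i * t' l j.
  rewrite !ltnS => hi hj; rewrite big_ord_recr /=.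
  wlog ij : i j hi hj / (i <= j)%N.
    move=> H; have [le|/ltnW le] := leqP i j; first exact: H.
    rewrite symq (H j i) //; congr (_ + _); last exact: mulrC.
    by apply: eq_bigr => l _; rewrite mulrC.
  have [jm|jm] := ltnP j m.
    have im := leq_ltn_trans ij jm; rewrite ut' // mul0r addr0 ht //.
    by apply: eq_bigr => l _; rewrite !t'l.
  have {jm hj} -> : j = m by apply/eqP; rewrite eqn_leq hj.
  have [im|im] := ltnP i m.
    rewrite ut' // mul0r addr0 -(hu (Ordinal im)); apply: eq_bigr => l _.
    by rewrite t'u t'l.
  have {im hi ij} -> : i = m by apply/eqP; rewrite eqn_leq hi.
  rewrite t'm -expr2 htau; under eq_bigr do rewrite t'u -expr2.
  by rewrite addrC subrK.
exists t'; split=> // i; rewrite ltnS leq_eqVlt => /predU1P[->|im]; last by rewrite t'l ?dt.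
rewrite t'm; apply: contraNneq (hq m.+1 (leqnn _)) => tau0.
pose T' := \matrix_(i < m.+1, j < m.+1) t' i j.
have -> : \matrix_(i < m.+1, j < m.+1) q i j = T'^T *m T'.
  by apply/matrixP => i' j; rewrite mxE ht' // mxE; apply: eq_bigr => l _; rewrite !mxE.
rewrite det_mulmx det_tr -[\det T']det_tr det_trig.
  by rewrite big_ord_recr /= !mxE t'm tau0 mulr0 mul0r.
by apply/is_trig_mxP => i' j ij; rewrite !mxE ut'.
Qed.

Lemma cholesky m (Q : 'M[K]_m.+1) : Q^T = Q ->
  (forall k, (k <= m.+1)%N -> lead_minor Q k != 0) ->
  exists T : 'M[K]_m.+1, [/\ upper T, forall i, T i i != 0 & Q = T^T *m T].
Proof.
move=> symQ hQ; have [||t [ut dt ht]] := @cholesky_nat m.+1 (fun i j => Q (inord i) (inord j)).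
- by move=> i j; rewrite -[in LHS]symQ mxE.
- exact: hQ.
exists (\matrix_(i, j) t i j); split.
- by move=> i j ij; rewrite mxE ut.
- by move=> i; rewrite mxE dt.
apply/matrixP => i j; have := ht i j (ltn_ord i) (ltn_ord j); rewrite !inord_val => ->.
by rewrite mxE; apply: eq_bigr => l _; rewrite !mxE.
Qed.

Lemma upper_unit m (T : 'M[K]_m) : upper T -> (forall i, T i i != 0) -> T \in unitmx.
Proof.
move=> uT dT; rewrite unitmxE unitfE -det_tr det_trig.
  by apply/prodf_neq0 => i _; rewrite !mxE dT.
by apply/is_trig_mxP => i j ij; rewrite !mxE uT.
Qed.

End SymmetricMatrices.

(** Expanding along the column of a new point y gives a combination of the functions in which the
    last one has the previous determinant as coefficient, up to sign; by independence it is nonzero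
    at some y in O. *)
Lemma indep_points (K : fieldType) (X : Type) (O : X -> Prop) h (rho : 'I_h -> X -> K) :
  (forall c : 'I_h -> K, (forall x, O x -> \sum_i c i * rho i x = 0) -> forall i, c i = 0) ->
  exists x : 'I_h -> X, (forall j, O (x j)) /\ \det (\matrix_(i, j) rho i (x j)) != 0.
Proof.
elim: h rho => [|h IHh] rho ind.
  have x0 : 'I_0 -> X by case.
  by exists x0; split; [case | rewrite det_mx00 oner_neq0].
have [|x [Ox dx]] := IHh (fun i => rho (lift ord_max i)).
  move=> c hc i; have := ind (fun j => if unlift ord_max j is Some j' then c j' else 0) _ (lift ord_max i).
  rewrite liftK; apply=> y Oy; rewrite (bigD1_ord ord_max) //= unlift_none mul0r add0r.
  rewrite -[RHS](hc y Oy).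
  by apply: eq_bigr => j _; rewrite liftK.
pose M y := \matrix_(i < h.+1, j < h.+1) rho i (if unlift ord_max j is Some j' then x j' else y).
pose cof i : K := cofactor (\matrix_(i < h.+1, j < h.+1)
  (if unlift ord_max j is Some j' then rho i (x j') else 0)) i ord_max.
have detM y : \det (M y) = \sum_i cof i * rho i y.
  rewrite (expand_det_col _ ord_max); apply: eq_bigr => i _; rewrite mulrC mxE unlift_none.
  congr (_ * _); rewrite /cof /cofactor; congr (_ * \det _).
  by apply/matrixP => i' j'; rewrite !mxE liftK.
have cof0 : cof ord_max != 0.
  rewrite /cof /cofactor mulf_neq0 ?signr_eq0 //; congr (\det _ != 0): dx.
  by apply/matrixP => i j; rewrite !mxE liftK.
have [y Oy dy] : exists2 y, O y & \det (M y) != 0.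
  apply: NNPP => no; move/negP: cof0; apply; apply/eqP/ind => y Oy.
  by rewrite -detM; apply/eqP; apply: contraT => hy; case: no; exists y.
exists (fun j => if unlift ord_max j is Some j' then x j' else y); split=> //.
by move=> j; case: unliftP.
Qed.

(** * Quadratic forms and their coefficients *)

Definition qcoord n : finType := Finite.clone (monom n 2) _.

Section QuadraticForms.
Variables (K : closedFieldType) (n : nat).
Hypothesis two0 : 2%:R != 0 :> K.
Local Notation I := 'I_n.+1.
Local Notation MT := (qcoord n).
Local Notation S3 := {mpoly K[#|MT|]}.
Implicit Types (i j k l r : I) (G T Y : 'M[K]_n.+1).

Definition quad_form G : {mpoly K[n.+1]} := \sum_j \sum_k G j k *: ('X_j * 'X_k).

Definition quad_coef G (m : MT) : K := (quad_form G)@_(val m).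

Lemma mdeg_pair j k : mdeg (U_(j) + U_(k))%MM == 2%N.
Proof. by rewrite mdegD !mdeg1. Qed.

Fact bmdeg_pair j k : (mdeg (U_(j) + U_(k))%MM < 3)%N.
Proof. by rewrite (eqP (mdeg_pair j k)). Qed.

Definition pairm j k : MT := exist _ (BMultinom (bmdeg_pair j k)) (mdeg_pair j k).

Lemma mnm_pair_eq (a b j k : I) : (U_(a) + U_(b) == U_(j) + U_(k))%MM =
  (a == j) && (b == k) || (a == k) && (b == j).
Proof.
apply/eqP/orP => [e|[/andP[/eqP-> /eqP->] //|/andP[/eqP-> /eqP->]]]; last by rewrite addmC.
have := congr1 (fun m : 'X_{1..n.+1} => m a) e.
rewrite !mnmDE !mnm1E eqxx; case: (eqVneq j a) => [ja|nja].
  rewrite ja in e *; move/eqP: e; rewrite eqm_add2l eq_mnm1 => /eqP->; left.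
  by rewrite !eqxx.
case: (eqVneq k a) => [ka|nka]; last by rewrite /= addn0; case: (b == a).
move=> _; right; rewrite ka [in RHS]addmC in e *; move/eqP: e.
by rewrite eqm_add2l eq_mnm1 => /eqP->; rewrite !eqxx.
Qed.

Lemma pairmP (m : MT) : exists j k, m = pairm j k.
Proof.
case: m => m hm; have m0 : (val m) != 0%MM by rewrite -mdeg_eq0 (eqP hm).
have [j hj] : exists j, m j != 0%N.
  apply: NNPP => h; move/negP: m0; apply; apply/eqP/mnmP => j; rewrite mnm0E.
  by apply/eqP; apply: contraT => hj; case: h; exists j.
have le : (U_(j) <= m)%MM by rewrite lep1mP.
have /mdeg1P [k /eqP hk] : mdeg (m - U_(j))%MM == 1%N.
  have := eqP hm; rewrite -{1}(submK le) mdegD mdeg1 addn1 => -[->] //.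
exists k, j; apply: val_inj; apply: val_inj => /=; by rewrite -hk submK.
Qed.

Lemma mcoeff_quad_form G m : (quad_form G)@_m = \sum_j \sum_k G j k * (U_(j) + U_(k) == m)%MM%:R.
Proof.
rewrite raddf_sum /=; apply: eq_bigr => j _; rewrite raddf_sum /=; apply: eq_bigr => k _.
by rewrite mcoeffZ -mpolyXD mcoeffX.
Qed.

Lemma quad_coef_pair G j k : G^T = G -> quad_coef G (pairm j k) = (if j == k then 1 else 2%:R) * G j k.
Proof.
move=> symG; rewrite /quad_coef mcoeff_quad_form /=.
under eq_bigr do under eq_bigr do rewrite mnm_pair_eq.
rewrite pair_big /= (bigID (fun p : I * I => p == (j, k))) /= big_pred1_eq !eqxx /= mulr1.
have [<-|jk] := eqVneq j k.
  rewrite mul1r big1 ?addr0 // => -[a b] /=; rewrite xpair_eqE orbb => /negPf->.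
  by rewrite mulr0.
rewrite (bigD1 (k, j)) /=; last by rewrite xpair_eqE eq_sym (negPf jk).
rewrite !eqxx orbT mulr1 big1 ?addr0; last first.
  move=> -[a b] /= /andP[]; rewrite !xpair_eqE => /negPf-> /negPf->.
  by rewrite mulr0.
by rewrite mulrDl mul1r; congr (_ + _); rewrite -{1}symG mxE.
Qed.

Lemma quad_coef_entry G j k : G^T = G ->
  G j k = (if j == k then 1 else 2%:R)^-1 * quad_coef G (pairm j k).
Proof.
move=> symG; rewrite quad_coef_pair // mulrA mulVf ?mul1r //.
by case: ifP => _; rewrite ?oner_neq0.
Qed.

Lemma pairmC j k : pairm j k = pairm k j.
Proof. by apply: val_inj; apply: val_inj; rewrite /= addmC. Qed.

Lemma quad_coef_surj (y : MT -> K) : exists2 G, G^T = G & quad_coef G =1 y.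
Proof.
pose G := \matrix_(j, k) ((if j == k then 1 else 2%:R)^-1 * y (pairm j k)) : 'M[K]_n.+1.
have symG : G^T = G by apply/matrixP => j k; rewrite !mxE eq_sym pairmC.
exists G => // m; have [j [k ->]] := pairmP m; rewrite quad_coef_pair // mxE mulrA mulfV ?mul1r //.
by case: ifP => _; rewrite ?oner_neq0.
Qed.

Lemma quad_form_eq0 G : G^T = G -> (quad_form G == 0) = (G == 0).
Proof.
move=> symG; apply/eqP/eqP => [h|->]; last first.
  by rewrite /quad_form big1 // => j _; rewrite big1 // => k _; rewrite mxE scale0r.
by apply/matrixP => j k; rewrite quad_coef_entry // /quad_coef h mcoeff0 mulr0 mxE.
Qed.

Definition quad_coefs G : 'I_#|MT| -> K := fun a => quad_coef G (enum_val a).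

Lemma sym_gram T : (T^T *m T)^T = T^T *m T.
Proof. by rewrite trmx_mul trmxK. Qed.

(** ** Polynomials in the Gram matrix of an upper triangular matrix *)

(** The degree is tracked because it is the source of the shift kappa a in the upper bound. *)
Definition GG m (phi : 'M[K]_n.+1 -> K) := exists2 P : S3, P \is m.-homog &
  forall T, upper T -> phi T = P.@[quad_coefs (T^T *m T)].

Lemma GG_ext m phi psi : (forall T, upper T -> phi T = psi T) -> GG m phi -> GG m psi.
Proof. by move=> h [P hP eP]; exists P => // T uT; rewrite -h // eP. Qed.

Lemma GG_mul m m' phi psi : GG m phi -> GG m' psi -> GG (m + m') (fun T => phi T * psi T).
Proof.
move=> [P hP eP] [P' hP' eP']; exists (P * P'); first exact: dhomogM.
by move=> T uT; rewrite mevalM eP // eP'.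
Qed.

Lemma GG_lin m a phi psi : GG m phi -> GG m psi -> GG m (fun T => a * phi T + psi T).
Proof.
move=> [P hP eP] [P' hP' eP']; exists (a *: P + P').
  by rewrite rpredD // rpredZ.
by move=> T uT; rewrite mevalD mevalZ eP // eP'.
Qed.

Lemma GG0 m : GG m (fun=> 0).
Proof. by exists 0; rewrite ?rpred0 // => T _; rewrite meval0. Qed.

Lemma GG1 : GG 0 (fun=> 1).
Proof. by exists 1; rewrite ?dhomog1 // => T _; rewrite meval1. Qed.

Lemma GG_scale m a phi : GG m phi -> GG m (fun T => a * phi T).
Proof. by move=> h; apply: GG_ext (GG_lin a h (GG0 m)) => T _; rewrite addr0. Qed.

Lemma GG_sum m (J : Type) (s : seq J) (Q : pred J) (phi : J -> 'M[K]_n.+1 -> K) :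
  (forall u, Q u -> GG m (phi u)) -> GG m (fun T => \sum_(u <- s | Q u) phi u T).
Proof.
move=> h; elim: s => [|u s IHs].
  by apply: GG_ext (GG0 m) => T _; rewrite big_nil.
have [Qu|Qu] := boolP (Q u); last first.
  by apply: GG_ext IHs => T _; rewrite big_cons (negPf Qu).
by apply: GG_ext (GG_lin 1 (h u Qu) IHs) => T _; rewrite big_cons Qu mul1r.
Qed.

Lemma GG_yco (m : MT) : GG 1 (fun T => quad_coef (T^T *m T) m).
Proof.
exists 'X_(enum_rank m); first by rewrite dhomogX /= mdeg1.
by move=> T _; rewrite mevalXU /quad_coefs enum_rankK.
Qed.

Lemma GG_gram j k : GG 1 (fun T => (T^T *m T) j k).
Proof.
apply: GG_ext (GG_scale ((if j == k then 1 else 2%:R)^-1) (GG_yco (pairm j k))) => T _.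
by rewrite -quad_coef_entry // sym_gram.
Qed.

(* Row by row, t_rr t_rk = (T^T T)_rk - \sum_(l < r) t_lr t_lk, and
   t_rr^2 (t_rj t_rk) = (t_rr t_rj) (t_rr t_rk). *)
Lemma GG_denom : exists delta D, [/\ GG delta D,
  forall T, (forall i, T i i != 0) -> D T != 0 &
  forall i j k, GG delta.+1 (fun T => D T * (T i j * T i k))].
Proof.
suff H (r : nat) : (r <= n.+1)%N -> exists delta D, [/\ GG delta D,
    forall T, (forall i, T i i != 0) -> D T != 0 &
    forall i j k, (i < r)%N -> GG delta.+1 (fun T => D T * (T i j * T i k))].
  have [delta [D [h1 h2 h3]]] := H n.+1 (leqnn _).
  by exists delta, D; split=> // i j k; apply: h3.
elim: r => [_|r IHr hr].
  by exists 0%N, (fun=> 1); split=> // [|T _]; [exact: GG1 | exact: oner_neq0].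
have [delta [D [gD nD hD]]] := IHr (ltnW hr).
pose ro : I := Ordinal hr.
have hrow k : GG delta.+1 (fun T => D T * (T ro ro * T ro k)).
  have h1 : GG delta.+1 (fun T => D T * (T^T *m T) ro k).
    by rewrite -addn1; apply: GG_mul (GG_gram ro k).
  have h2 : GG delta.+1 (fun T => \sum_(l : I | (l < r)%N) D T * (T l ro * T l k)).
    by apply: GG_sum => l hl; apply: hD.
  apply: GG_ext (GG_lin (-1) h2 h1) => T uT.
  rewrite mulN1r addrC mxE (bigID (fun l : I => (l < r)%N)) /= mulrDr.
  rewrite mulr_sumr; under [X in X + _ - _]eq_bigr do rewrite mxE.
  rewrite addrAC subrr add0r (bigD1 ro) ?ltnn //= mxE big1 ?addr0 // => l /andP[hl ne].
  rewrite mxE uT ?mul0r // ltn_neqAle [(_ <= _)%N]leqNgt hl andbT.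
  by apply: contra ne => /eqP e; apply/eqP/val_inj.
(* The new denominator D (D t_rr^2) times t_rj t_rk is the product of D t_rr t_rj and D t_rr t_rk,
   of degree 2 (delta + 1). *)
exists (delta + delta.+1)%N, (fun T => D T * (D T * (T ro ro * T ro ro))); split.
- exact: GG_mul.
- by move=> T hT; rewrite !mulf_neq0 ?nD.
move=> i j k; rewrite ltnS leq_eqVlt => /predU1P[ir|ir]; last first.
  rewrite -addSn; apply: GG_ext (GG_mul (hD i j k ir) (hrow ro)) => T _; ring.
have -> : i = ro by apply: val_inj.
rewrite -addSn; apply: GG_ext (GG_mul (hrow j) (hrow k)) => T _; ring.
Qed.

(** Each row occurs an even number of times, so the entries can be paired within rows, every pair
    using one factor D. *)
Lemma GG_even delta D p (L : seq (I * I)) : GG delta D ->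
  (forall i j k, GG delta.+1 (fun T => D T * (T i j * T i k))) ->
  size L = p.*2 -> (forall r, ~~ odd (count (fun a => a.1 == r) L)) ->
  GG (p * delta.+1) (fun T => D T ^+ p * \prod_(a <- L) T a.1 a.2).
Proof.
move=> gD hD; elim: p L => [|p IHp] L sL ev.
  rewrite (size0nil sL); apply: GG_ext GG1 => T _; by rewrite big_nil expr0 mulr1.
case: L sL ev => // -[i b] L /= [sL] ev.
have /hasP [[i' b'] inL /= /eqP ei] : has (fun a => a.1 == i) L.
  by have := ev i; rewrite /= eqxx add1n /= negbK has_count; case: count.
rewrite {i'}ei in inL; have pL := perm_to_rem inL.
have {}IHp := IHp (rem (i, b') L) _ _.
rewrite mulSn; apply: GG_ext (GG_mul (hD i b b') (IHp _ _)) => [T _||r].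
- rewrite big_cons /= (perm_big _ pL) big_cons /= exprS; ring.
- by rewrite size_rem // sL.
- by have := ev r; rewrite /= (permP pL) /= addnA addnn oddD odd_double.
Qed.

End QuadraticForms.

(** * Polynomial functions of a matrix *)

Lemma indep_subfamily (K : fieldType) (E : lmodType K) (J : E -> Prop) n (b : 'I_n -> E) :
  subsp J -> exists m (s : 'I_m -> 'I_n), indep J (b \o s) /\
    forall i, exists c : 'I_m -> K, J (b i - \sum_j c j *: b (s j)).
Proof.
move=> hJ.
have [m [s [h hmax]]] : exists m (s : 'I_m -> 'I_n), indep J (b \o s) /\
    forall m' (s' : 'I_m' -> 'I_n), indep J (b \o s') -> (m' <= m)%N.
  have bound m (s : 'I_m -> 'I_n) : indep J (b \o s) -> (m <= n)%N.
    move=> hs; apply: (indep_le (b := b) hJ hs) => i; exists (fun j => (j == s i)%:R).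
    rewrite (bigD1 (s i)) //= eqxx scale1r big1 ?addr0 ?subrr; first by case: hJ.
    by move=> j /negPf->; rewrite scale0r.
  suff H k : (exists m (s : 'I_m -> 'I_n), indep J (b \o s) /\ (n - m <= k)%N) ->
      exists m (s : 'I_m -> 'I_n), indep J (b \o s) /\
      forall m' (s' : 'I_m' -> 'I_n), indep J (b \o s') -> (m' <= m)%N.
    have s0 : 'I_0 -> 'I_n by case.
    by apply: (H n); exists 0%N, s0; split; [move=> c _ [] | rewrite subn0].
  elim: k => [|k IHk] [m [s [hs hm]]].
    by exists m, s; split=> // m' s' /bound; lia.
  have [h|h] := classic (exists m' (s' : 'I_m' -> 'I_n), indep J (b \o s') /\ (m < m')%N).
    by case: h => m' [s' [hs' lt]]; apply: IHk; exists m', s'; split=> //; have := bound _ _ hs'; lia.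
  exists m, s; split=> // m' s' hs'; rewrite leqNgt; apply/negP => lt; apply: h.
  by exists m', s'.
exists m, s; split=> // i; apply: NNPP => no.
pose s' (j : 'I_m.+1) := if unlift ord_max j is Some j' then s j' else i.
suff /hmax : indep J (b \o s') by rewrite ltnn.
move=> c; rewrite (bigD1_ord ord_max) //= {1}/s' unlift_none => hc.
have c0 : c ord_max = 0.
  apply/eqP; apply: contraT => c0; case: no; exists (fun j => - (c ord_max)^-1 * c (lift ord_max j)).
  have := subspZ (c ord_max)^-1 hJ hc; rewrite scalerDr scalerA mulVf // scale1r.
  congr (J (_ + _)); rewrite -sumrN scaler_sumr; apply: eq_bigr => j _.
  by rewrite /s' liftK mulNr scaleNr opprK scalerA.
move=> j; case: (unliftP ord_max j) => [j' ->|->] //.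
apply: (h (fun j => c (lift ord_max j))); move: hc; rewrite c0 scale0r add0r.
by congr J; apply: eq_bigr => l _ /=; rewrite /s' liftK.
Qed.

Definition hmons N d : seq 'X_{1..N} := [seq s2m s | s : d.-tuple 'I_N <- enum (basis N d)].

Lemma hmons_size N k d : N = k.+1 -> size (hmons N d) = 'C(d + k, k).
Proof. by move=> ->; rewrite size_basis -bin_sub ?leq_addr // addKn. Qed.

Lemma hmons_span (K : fieldType) N d (p : {mpoly K[N]}) : p \is d.-homog ->
  p = \sum_(j < size (hmons N d)) p@_(nth 0%MM (hmons N d) j) *: 'X_[(nth 0%MM (hmons N d) j)].
Proof.
move=> hp; rewrite {1}[p]mpolyE.
rewrite -(big_mkord xpredT (fun j => p@_(nth 0%MM (hmons N d) j) *: 'X_[(nth 0%MM (hmons N d) j)])).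
rewrite -(big_nth 0%MM xpredT (fun m => p@_m *: 'X_[m])).
rewrite [RHS](bigID (fun m => m \in msupp p)) /= [X in _ + X]big1 ?addr0; last first.
  by move=> m /memN_msupp_eq0 ->; rewrite scale0r.
rewrite -[RHS]big_filter; apply: perm_big; apply: uniq_perm.
- exact: msupp_uniq.
- by rewrite filter_uniq // uniq_basis.
move=> m; rewrite mem_filter -basis_cover andb_idr // => hm.
by rewrite (elimT (dhomogP _ _ _) hp m hm).
Qed.

Lemma homog_count (K : fieldType) N k d n (p : 'I_n -> {mpoly K[N]}) : N = k.+1 ->
  (forall i, p i \is d.-homog) -> indep (fun x => x = 0) p -> (n <= 'C(d + k, k))%N.
Proof.
move=> eN hp ip; rewrite -(hmons_size d eN).
apply: (indep_le (b := fun j : 'I_(size (hmons N d)) => 'X_[(nth 0%MM (hmons N d) j)]) _ ip).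
  by split=> // a x y -> ->; rewrite scaler0 addr0.
move=> i; exists (fun j => (p i)@_(nth 0%MM (hmons N d) j)).
by rewrite -hmons_span ?subrr.
Qed.

Lemma prod_homog (K : fieldType) N d b (f : 'I_b -> {mpoly K[N]}) :
  (forall l, f l \is d.-homog) -> \prod_l f l \is (b * d)%N.-homog.
Proof.
elim: b f => [|b IHb] f hf; first by rewrite big_ord0 dhomog1.
by rewrite big_ord_recl mulSn; apply: dhomogM => //; apply: IHb.
Qed.

Section PolyFunctions.
Variables (K : closedFieldType) (n : nat).
Local Notation I := 'I_n.+1.
Local Notation M := 'M[K]_n.+1.
Definition mxcoord : finType := ('I_n.+1 * 'I_n.+1)%type.
Local Notation T1 := mxcoord.
Local Notation S1 := {mpoly K[#|T1|]}.
Implicit Types (X : M) (phi psi : M -> K).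

Definition mvec X : {ffun T1 -> K} := [ffun ij => X ij.1 ij.2].

Definition polyfun phi := exists p : S1, forall X, phi X = peval p (mvec X).

Lemma polyfun_ext phi psi : phi =1 psi -> polyfun phi -> polyfun psi.
Proof. by move=> e [p hp]; exists p => X; rewrite -e. Qed.

Lemma polyfun_const c : polyfun (fun=> c).
Proof. by exists c%:MP => X; rewrite /peval mevalC. Qed.

Lemma polyfun_entry i j : polyfun (fun X => X i j).
Proof. by exists 'X_(enum_rank ((i, j) : T1)) => X; rewrite /peval mevalXU enum_rankK ffunE. Qed.

Lemma polyfunD phi psi : polyfun phi -> polyfun psi -> polyfun (fun X => phi X + psi X).
Proof. by move=> [p hp] [q hq]; exists (p + q) => X; rewrite /peval mevalD hp hq. Qed.

Lemma polyfunM phi psi : polyfun phi -> polyfun psi -> polyfun (fun X => phi X * psi X).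
Proof. by move=> [p hp] [q hq]; exists (p * q) => X; rewrite /peval mevalM hp hq. Qed.

Lemma polyfun_sum (J : Type) (s : seq J) (phi : J -> M -> K) :
  (forall j, polyfun (phi j)) -> polyfun (fun X => \sum_(j <- s) phi j X).
Proof.
move=> h; elim: s => [|j s IHs].
  by apply: polyfun_ext (polyfun_const 0) => X; rewrite big_nil.
by apply: polyfun_ext (polyfunD (h j) IHs) => X; rewrite big_cons.
Qed.

Lemma polyfun_prod (J : Type) (s : seq J) (phi : J -> M -> K) :
  (forall j, polyfun (phi j)) -> polyfun (fun X => \prod_(j <- s) phi j X).
Proof.
move=> h; elim: s => [|j s IHs].
  by apply: polyfun_ext (polyfun_const 1) => X; rewrite big_nil.
by apply: polyfun_ext (polyfunM (h j) IHs) => X; rewrite big_cons.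
Qed.

Lemma polyfunX phi k : polyfun phi -> polyfun (fun X => phi X ^+ k).
Proof.
move=> h; elim: k => [|k IHk]; first exact: polyfun_const.
by apply: polyfun_ext (polyfunM h IHk) => X; rewrite exprS.
Qed.

Lemma polyfun_meval N (p : {mpoly K[N]}) (phi : 'I_N -> M -> K) :
  (forall i, polyfun (phi i)) -> polyfun (fun X => p.@[fun i => phi i X]).
Proof.
move=> h; apply: polyfun_ext (polyfun_sum (phi := fun m X => p@_m * \prod_(i < N) phi i X ^+ m i) (msupp p) _).
  by move=> X; rewrite mevalE.
move=> m; apply: polyfunM; first exact: polyfun_const.
by apply: polyfun_prod => i; apply: polyfunX.
Qed.

Lemma polyfun_det k (A : M -> 'M[K]_k) :
  (forall i j, polyfun (fun X => A X i j)) -> polyfun (fun X => \det (A X)).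
Proof.
move=> h; apply: polyfun_sum => s; apply: polyfunM; first exact: polyfun_const.
exact: polyfun_prod.
Qed.

Lemma polyfun_mulmx k l m (A : M -> 'M[K]_(k, l)) (B : M -> 'M[K]_(l, m)) :
  (forall i j, polyfun (fun X => A X i j)) -> (forall i j, polyfun (fun X => B X i j)) ->
  forall i j, polyfun (fun X => (A X *m B X) i j).
Proof.
move=> hA hB i j; apply: polyfun_ext (polyfun_sum (phi := fun l X => A X i l * B X l j) _ _).
  by move=> X; rewrite mxE.
by move=> l'; apply: polyfunM.
Qed.

Lemma mvec_surj v : exists X, mvec X = v.
Proof.
exists (\matrix_(i, j) v (i, j)); apply/ffunP => -[i j]; by rewrite ffunE mxE.
Qed.

(** Polynomial functions on matrices form a domain. This serves as a density argument: psi is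
    examined only where phi is nonzero. *)
Lemma polyfun_dom phi psi : polyfun phi -> polyfun psi -> (exists X, phi X != 0) ->
  (forall X, phi X * psi X = 0) -> forall X, psi X = 0.
Proof.
move=> [p hp] [q hq] [X0 h0] h X.
have pq : p * q = 0.
  apply/eqP; apply: contraT => /mpoly_nonzero [c].
  pose v : {ffun T1 -> K} := [ffun t => c (enum_rank t)].
  have [Y hY] := mvec_surj v.
  have e r : r.@[c] = peval r (mvec Y) by rewrite hY; apply: meval_eq => i; rewrite ffunE enum_valK.
  by rewrite mevalM !e -hp -hq h eqxx.
have p0 : p != 0 by apply: contraNneq h0 => p0; rewrite hp p0 /peval meval0.
have q0 : q = 0 by move/eqP: pq; rewrite mulf_eq0 (negPf p0) => /eqP.
by rewrite hq q0 /peval meval0.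
Qed.

End PolyFunctions.

Section Lift.
Variables (K : closedFieldType) (T T' : finType) (f : T -> T').

Definition lmnm (m : 'X_{1..#|T|}) : 'X_{1..#|T'|} :=
  (\sum_i U_(enum_rank (f (enum_val i))) *+ m i)%MM.

Definition lift_mpoly (p : {mpoly K[#|T|]}) : {mpoly K[#|T'|]} :=
  \sum_(m <- msupp p) p@_m *: 'X_[lmnm m].

Lemma peval_lmnm m v : peval ('X_[lmnm m] : {mpoly K[#|T'|]}) v =
  \prod_i v (f (enum_val i)) ^+ m i.
Proof.
rewrite /lmnm -mprodXnE /peval rmorph_prod /=; apply: eq_bigr => i _.
by rewrite rmorphXn /= mevalXU enum_rankK.
Qed.

Lemma peval_lift p v : peval (lift_mpoly p) v = peval p [ffun t => v (f t)].
Proof.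
rewrite /lift_mpoly peval_sum [in RHS]/peval mevalE; apply: eq_bigr => m _.
rewrite /peval mevalZ; congr (_ * _); rewrite -/(peval _ _) peval_lmnm.
by apply: eq_bigr => i _; rewrite ffunE.
Qed.

Lemma multideg_lmnm (B : finType) (blk : T' -> B) b m : (forall t, blk (f t) = b) ->
  multideg (grd blk) (lmnm m) = (U_(enum_rank b) *+ mdeg m)%MM.
Proof.
move=> hb; have multidegMn u k : multideg (grd blk) (u *+ k)%MM = (multideg (grd blk) u *+ k)%MM.
  by elim: k => [|k IHk]; rewrite ?mulm0n ?multideg0 // !mulmS multidegD IHk.
rewrite /lmnm (big_morph _ (multidegD (grd blk)) (multideg0 (grd blk))).
under eq_bigr do rewrite multidegMn multidegU /grd enum_rankK hb.
apply/mnmP => j; rewrite mnm_sumE mulmnE mdegE big_distrr /=.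
by apply: eq_bigr => i _; rewrite mulmnE.
Qed.

Lemma mhomog_lift (B : finType) (blk : T' -> B) b d p : (forall t, blk (f t) = b) ->
  p \is d.-homog -> mhomog (grd blk) (U_(enum_rank b) *+ d)%MM (lift_mpoly p).
Proof.
move=> hb hp; rewrite /lift_mpoly; have [h0 h] := subsp_mhomog K (grd blk) (U_(enum_rank b) *+ d)%MM.
rewrite big_seq; elim/big_ind: _ => // [x y hx hy|m hm].
  by rewrite -[x]scale1r; apply: h.
rewrite -[_ *: _]addr0; apply: h => //.
rewrite -(elimT (dhomogP _ _ _) hp m hm) -(multideg_lmnm m hb); exact: mhomogX.
Qed.

End Lift.

(** * The graph of X |-> X^T F X and the orthogonal group of F *)

Definition gcoord n : finType := Finite.clone (graph_coord n 2) _.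

Lemma seq_ffun (A : Type) a (r : seq A) : size r = a -> exists s : {ffun 'I_a -> A},
  forall (R : comNzRingType) (f : A -> R), \prod_(x <- r) f x = \prod_l f (s l).
Proof.
move=> <-; exists [ffun l => tnth (in_tuple r) l] => R f; rewrite big_tnth.
by apply: eq_bigr => l _; rewrite ffunE.
Qed.

Section Bounds.
Variables (K : closedFieldType) (n : nat).
Hypothesis two0 : 2%:R != 0 :> K.
Variables (F C : 'M[K]_n.+1).
Hypotheses (eF : F = C^T *m C) (uC : C \in unitmx).

Local Notation I := 'I_n.+1.
Local Notation T1 := (mxcoord n).
Local Notation MT := (qcoord n).
Local Notation T2 := (gcoord n).
Local Notation S1 := {mpoly K[#|T1|]}.
Local Notation S2 := {mpoly K[#|T2|]}.
Local Notation S3 := {mpoly K[#|MT|]}.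
Local Notation blk2 := (@graph_block n 2 : T2 -> bool).
Local Notation g2 := (grd blk2).
Local Notation g1 := (grd (fun _ : T1 => tt)).
Implicit Types (X g T : 'M[K]_n.+1) (P : S2) (p : S1).

Definition gvec X (G : 'M[K]_n.+1) (a : K) : {ffun T2 -> K} :=
  [ffun t => match t with inl ij => X ij.1 ij.2 | inr m => a * quad_coef G m end].

Definition gram X := X^T *m F *m X.

Definition graph_set (v : {ffun T2 -> K}) :=
  exists X a, [/\ quad_form (gram X) != 0, a != 0 & v = gvec X (gram X) a].

Definition orth_set (v : {ffun T1 -> K}) :=
  exists X a, [/\ gram X = F, a != 0 & v = [ffun ij => a * X ij.1 ij.2]].

Definition dd a b : 'X_{1..#|{: bool}|} :=
  (U_(enum_rank false) *+ a + U_(enum_rank true) *+ b)%MM.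
Definition d1 a : 'X_{1..#|{: unit}|} := (U_(enum_rank tt) *+ a)%MM.

Definition graph_eval P X : K := peval P (gvec X (gram X) 1).

Lemma dd_false a b : dd a b (enum_rank false) = a.
Proof. by rewrite mnmDE !mulmnE !mnm1E eqxx (inj_eq enum_rank_inj) /= mul1n mul0n addn0. Qed.

Lemma dd_true a b : dd a b (enum_rank true) = b.
Proof. by rewrite mnmDE !mulmnE !mnm1E eqxx (inj_eq enum_rank_inj) /= mul1n mul0n. Qed.

Lemma gram_sym X : (gram X)^T = gram X.
Proof. by rewrite /gram eF !trmx_mul !trmxK !mulmxA. Qed.

Lemma gramE X : gram X = (C *m X)^T *m (C *m X).
Proof. by rewrite /gram eF trmx_mul !mulmxA. Qed.

Lemma gram_Cinv Y : gram (invmx C *m Y) = Y^T *m Y.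
Proof. by rewrite gramE mulKVmx. Qed.

Lemma graph_eval_scale P a b X c : mhomog g2 (dd a b) P ->
  peval P (gvec X (gram X) c) = c ^+ b * graph_eval P X.
Proof.
move=> hP; pose cc (b : bool) := if b then c else 1.
have -> : gvec X (gram X) c = rescale blk2 cc (gvec X (gram X) 1).
  by apply/ffunP => -[ij|m]; rewrite !ffunE /= ?mul1r.
rewrite (peval_rescale_homog _ _ hP); congr (_ * _).
rewrite (reindex (@enum_rank bool)) /=; last by exists enum_val => i _; rewrite ?enum_rankK ?enum_valK.
rewrite (bigD1 true) //= (bigD1 false) //= big1 ?mulr1; last by case.
by rewrite !enum_rankK dd_true /= expr1n mulr1.
Qed.

Lemma polyfun_gram j k : polyfun (fun X => gram X j k).
Proof.
apply: polyfun_mulmx j k => j k; last exact: polyfun_entry.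
apply: polyfun_mulmx j k => j k; last exact: polyfun_const.
by apply: polyfun_ext (polyfun_entry K k j) => X; rewrite mxE.
Qed.

Lemma polyfun_quad_coef m : polyfun (fun X => quad_coef (gram X) m).
Proof.
apply: polyfun_ext (polyfun_sum (phi := fun j X => \sum_k gram X j k *
  (U_(j) + U_(k) == val m)%MM%:R) _ _) => [X|j]; first by rewrite /quad_coef mcoeff_quad_form.
apply: polyfun_sum => k; apply: polyfunM; [exact: polyfun_gram | exact: polyfun_const].
Qed.

Lemma polyfun_graph_eval P : polyfun (graph_eval P).
Proof.
apply: polyfun_ext (polyfun_meval P (phi := fun i X => gvec X (gram X) 1 (enum_val i)) _) => [X //|i].
case: (enum_val i) => [ij|m].
  by apply: polyfun_ext (polyfun_entry K ij.1 ij.2) => X; rewrite ffunE.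
by apply: polyfun_ext (polyfun_quad_coef m) => X; rewrite ffunE mul1r.
Qed.

Lemma graph_eval_dense P : (forall X, quad_form (gram X) != 0 -> graph_eval P X = 0) -> forall X, graph_eval P X = 0.
Proof.
move=> h; apply: (polyfun_dom (polyfun_quad_coef (pairm ord0 ord0)) (polyfun_graph_eval P)).
  exists (invmx C); rewrite -[invmx C]mulmx1 gram_Cinv trmx1 mulmx1.
  by rewrite quad_coef_pair ?trmx1 // eqxx mul1r mxE eqxx oner_neq0.
move=> X; have [q0|q0] := eqVneq (quad_form (gram X)) 0; last by rewrite h ?mulr0.
by rewrite /quad_coef q0 mcoeff0 mul0r.
Qed.

Lemma vanishing_graph P a b : mhomog g2 (dd a b) P ->
  vanishing graph_set P <-> (forall X, graph_eval P X = 0).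
Proof.
move=> hP; split=> [h|h v [X [c [_ _ ->]]]]; last by rewrite (graph_eval_scale _ _ hP) h mulr0.
by apply: graph_eval_dense => X q0; apply: h; exists X, 1; rewrite oner_neq0.
Qed.

Lemma vanishing_orth p a : mhomog g1 (d1 a) p ->
  vanishing orth_set p <-> (forall X, gram X = F -> peval p (mvec X) = 0).
Proof.
move=> hp; split=> [h X hX|h v [X [c [hX _ ->]]]].
  apply: h; exists X, 1; rewrite oner_neq0; split=> //.
  by apply/ffunP => ij; rewrite !ffunE mul1r.
have -> : [ffun ij => c * X ij.1 ij.2] = rescale (fun _ : T1 => tt) (fun=> c) (mvec X).
  by apply/ffunP => ij; rewrite !ffunE.
by rewrite (peval_rescale_homog _ _ hp) h // mulr0.
Qed.

Lemma mnm_seq N (m : 'X_{1..N}) : exists r : seq 'I_N, m = (\sum_(i <- r) U_(i))%MM.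
Proof.
elim/mnm_ind: m => [|m i [r ->]]; first by exists [::]; rewrite big_nil.
by exists (i :: r); rewrite big_cons addmC.
Qed.

(** Monomials of bidegree (a, b) as words, so that products of sums expand over functions; different
    words may give the same monomial. *)
Definition mon2 a b (su : {ffun 'I_a -> T1} * {ffun 'I_b -> MT}) : S2 :=
  (\prod_l 'X_(enum_rank (inl (su.1 l) : T2))) * \prod_l 'X_(enum_rank (inr (su.2 l) : T2)).

Lemma mon2P a b m : multideg g2 m = dd a b -> exists su, 'X_[m] = @mon2 a b su.
Proof.
have [r ->] := mnm_seq m => hm.
suff [rl [rr [e sl sr]]] : exists (rl : seq T1) (rr : seq MT),
    [/\ 'X_[\sum_(i <- r) U_(i)] = (\prod_(x <- rl) 'X_(enum_rank (inl x : T2))) *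
       \prod_(x <- rr) 'X_(enum_rank (inr x : T2)) :> S2,
     size rl = multideg g2 (\sum_(i <- r) U_(i))%MM (enum_rank false) &
     size rr = multideg g2 (\sum_(i <- r) U_(i))%MM (enum_rank true)].
  rewrite hm dd_false in sl; rewrite hm dd_true in sr.
  have [s hs] := seq_ffun sl; have [u hu] := seq_ffun sr.
  by exists (s, u); rewrite e hs hu.
elim: r {hm} => [|i r [rl [rr [e sl sr]]]].
  by exists [::], [::]; rewrite !big_nil multideg0 !mnm0E mpolyX0 mulr1.
have ei : 'X_i = 'X_(enum_rank (enum_val i)) :> S2 by rewrite enum_valK.
have gi : g2 i = enum_rank (blk2 (enum_val i)) by [].
case hi: (enum_val i) => [x|x]; rewrite hi /= in ei gi.
  exists (x :: rl), rr; rewrite !big_cons mpolyXD e ei mulrA /= sl sr multidegD multidegU gi.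
  by rewrite !mnmDE !mnm1E eqxx (inj_eq enum_rank_inj).
exists rl, (x :: rr); rewrite !big_cons mpolyXD e ei mulrCA /= sl sr multidegD multidegU gi.
by rewrite !mnmDE !mnm1E eqxx (inj_eq enum_rank_inj).
Qed.

Lemma span_mon2 a b P : mhomog g2 (dd a b) P ->
  exists c, P = \sum_su c su *: @mon2 a b su.
Proof.
move=> hP; rewrite [P]mpolyE big_seq; elim/big_ind: _ => [|x y [c ->] [c' ->]|m hm].
- by exists (fun=> 0); rewrite big1 // => su _; rewrite scale0r.
- by exists (fun su => c su + c' su); rewrite -big_split; apply: eq_bigr => su _; rewrite scalerDl.
have [|su0 ->] := @mon2P a b m; first by apply: hP; rewrite -mcoeff_msupp.
exists (fun su => P@_m * (su == su0)%:R); rewrite (bigD1 su0) //= eqxx mulr1 big1 ?addr0 //.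
by move=> su /negPf->; rewrite mulr0 scale0r.
Qed.

Definition entry_prod a (s : {ffun 'I_a -> T1}) X : K := \prod_l X (s l).1 (s l).2.

Lemma peval_mon2 a b su X G : peval (@mon2 a b su) (gvec X G 1) =
  entry_prod su.1 X * \prod_l quad_coef G (su.2 l).
Proof.
rewrite pevalM /peval !rmorph_prod /=; congr (_ * _); apply: eq_bigr => l _.
  by rewrite mevalXU enum_rankK ffunE.
by rewrite mevalXU enum_rankK ffunE mul1r.
Qed.

(** ** Lower bounds *)

Definition inlT (t : T1) : T2 := inl t.
Definition inrT (t : MT) : T2 := inr t.

Lemma peval_inl p X G a : peval (lift_mpoly inlT p) (gvec X G a) = peval p (mvec X).
Proof.
by rewrite peval_lift; congr peval; apply/ffunP => ij; rewrite !ffunE.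
Qed.

Lemma peval_inr (q : S3) X G : peval (lift_mpoly inrT q) (gvec X G 1) = q.@[quad_coefs G].
Proof.
by rewrite peval_lift; apply: meval_eq => i; rewrite !ffunE /= mul1r.
Qed.

Lemma mhomog_bi u v (p : S1) (q : S3) : p \is u.-homog -> q \is v.-homog ->
  mhomog g2 (dd u v) (lift_mpoly inlT p * lift_mpoly inrT q).
Proof. by move=> hp hq; apply: mhomogM; apply: mhomog_lift. Qed.

Lemma homog_d1 u p : mhomog g1 (d1 u) p -> p \is u.-homog.
Proof.
move=> hp; apply/dhomogP => m; rewrite mcoeff_msupp => /hp hm.
by rewrite /= -(mdeg_multideg g1) hm mdegMn mdeg1 mul1n.
Qed.

Lemma d1_homog u p : p \is u.-homog -> mhomog g1 (d1 u) p.
Proof.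
move=> hp m; rewrite -mcoeff_msupp => /(elimT (dhomogP _ _ _) hp) /= hm.
apply/mnmP => j; rewrite -hm -(mdeg_multideg g1) mulmnE mnm1E.
have hj j' : j' = enum_rank tt by apply: enum_val_inj; case: (enum_val _); case: (enum_val _).
rewrite (hj j) eqxx mul1n mdegE (bigD1 (enum_rank tt)) //= big1 ?addn0 // => j' /eqP.
by case; apply: hj.
Qed.

Lemma polyfun_quad_coefs (q : S3) : polyfun (fun X => q.@[quad_coefs (gram X)]).
Proof. by apply: polyfun_meval => i; apply: polyfun_quad_coef. Qed.

Lemma quad_coefs_zero (q : S3) : (forall X, q.@[quad_coefs (gram X)] = 0) -> q = 0.
Proof.
move=> h; apply/eqP; apply: contraT => /mpoly_nonzero [v /eqP []].
have [G symG hG] := quad_coef_surj two0 (fun m => v (enum_rank m)).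
have [Y hY] := sym_factor two0 symG.
rewrite -[RHS](h (invmx C *m Y)) gram_Cinv -hY; apply: meval_eq => i.
by rewrite /quad_coefs hG enum_valK.
Qed.

Section Counts.
Variables (N M : nat).
Hypotheses (eN : #|{: T1}| = N.+1) (eM : #|{: MT}| = M.+1).

Lemma hmons_nth k d (j : 'I_(size (hmons k d))) : mdeg (nth 0%MM (hmons k d) j) = d.
Proof. by apply/eqP; rewrite basis_cover mem_nth. Qed.

Lemma hmons_indep k d (c : 'I_(size (hmons k d)) -> K) :
  \sum_j c j *: 'X_[(nth 0%MM (hmons k d) j)] = 0 :> {mpoly K[k]} -> forall j, c j = 0.
Proof.
move=> h j; have := congr1 (mcoeff (nth 0%MM (hmons k d) j)) h.
rewrite mcoeff0 raddf_sum /= (bigD1 j) //= mcoeffZ mcoeffX eqxx mulr1 big1 ?addr0 //.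
move=> i ne; rewrite mcoeffZ mcoeffX nth_uniq ?uniq_basis //.
by rewrite (negPf (_ : nat_of_ord i != j)) ?mulr0.
Qed.

(** Forms of degree a in the entries, times a power of one coefficient of X^T F X, stay independent
    on the graph because X is arbitrary. At b = 0 this gives growth of degree N in a. *)
Lemma hilb_graph_ge_mon a b : ('C(a + N, N) <= hilb g2 (vanishing graph_set) (dd a b))%N.
Proof.
rewrite -(hmons_size a eN); set s := hmons _ _.
pose m0 : MT := pairm ord0 ord0.
pose b' (j : 'I_(size s)) : S2 := lift_mpoly inlT 'X_[(nth 0%MM s j)] *
  lift_mpoly inrT ('X_(enum_rank m0) ^+ b).
have hb j : mhomog g2 (dd a b) (b' j).
  apply: mhomog_bi; first by rewrite dhomogX /= hmons_nth.
  by rewrite -[X in X.-homog]mul1n; apply: dhomogMn; rewrite dhomogX /= mdeg1.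
apply: (hilb_indep (b := b')) => //; first exact: ideal_vanishing.
move=> c hc; apply: hmons_indep.
set q := \sum_j _.
have hV : subsp (mhomog g2 (dd a b)) := subsp_mhomog K g2 (dd a b).
have {}hc : forall X, graph_eval (\sum_i c i *: b' i) X = 0.
  apply/(vanishing_graph (a := a) (b := b)) => //.
  by apply: (subsp_sum hV) => j; apply: (subspZ _ hV).
have hq X : peval q (mvec X) * quad_coef (gram X) m0 ^+ b = 0.
  rewrite -[RHS](hc X) /graph_eval peval_sum /q peval_sum mulr_suml; apply: eq_bigr => j _.
  rewrite !pevalZ pevalM peval_inl peval_inr mulrA.
  by rewrite rmorphXn /= mevalXU /quad_coefs enum_rankK.
apply/eqP; apply: contraT => /mpoly_nonzero [v].
have [X hX] := mvec_surj ([ffun t => v (enum_rank t)] : {ffun T1 -> K}).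
have -> : q.@[v] = peval q (mvec X) by rewrite hX; apply: meval_eq => i; rewrite ffunE enum_valK.
suff -> : peval q (mvec X) = 0 by rewrite eqxx.
move: X {hX}; apply: (polyfun_dom (phi := fun X => quad_coef (gram X) m0 ^+ b)).
- exact/polyfunX/polyfun_quad_coef.
- by exists q.
- exists (invmx C); rewrite expf_neq0 // -[invmx C]mulmx1 gram_Cinv trmx1 mulmx1.
  by rewrite quad_coef_pair ?trmx1 // eqxx mul1r mxE eqxx oner_neq0.
- by move=> X; rewrite mulrC.
Qed.

Lemma hilb_graph_ge a b :
  (hilb g1 (vanishing orth_set) (d1 a) * 'C(b + M, M) <= hilb g2 (vanishing graph_set) (dd a b))%N.
Proof.
have [p [hp ip _]] := hilbP g1 (d1 a) (ideal_vanishing orth_set).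
set h := hilb g1 _ _ in p hp ip *; rewrite -(hmons_size b eM); set s := hmons _ _.
pose G (j : 'I_(size s)) : S3 := 'X_[(nth 0%MM s j)].
have [|g [Og dg]] := @indep_points K _ (fun X => gram X = F) h (fun i X => peval (p i) (mvec X)).
  have hV : subsp (mhomog g1 (d1 a)) := subsp_mhomog K g1 (d1 a).
  move=> c hc; apply: ip; apply/(vanishing_orth (a := a)).
    by apply: (subsp_sum hV) => i; apply: (subspZ _ hV).
  move=> X /hc <-; rewrite peval_sum; apply: eq_bigr => i _; by rewrite /peval mevalZ.
pose J : finType := ('I_h * 'I_(size s))%type.
pose b' (ij : J) : S2 := lift_mpoly inlT (p ij.1) * lift_mpoly inrT (G ij.2).
have hb ij : mhomog g2 (dd a b) (b' ij).
  by apply: mhomog_bi; [exact: homog_d1 | rewrite dhomogX /= hmons_nth].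
have -> : (h * size s = #|J|)%N by rewrite card_prod !card_ord.
apply: (hilb_indep (b := b' \o enum_val)) => [||c hc]; first exact: ideal_vanishing.
  by move=> i; apply: hb.
have hV : subsp (mhomog g2 (dd a b)) := subsp_mhomog K g2 (dd a b).
have {}hc : forall X, graph_eval (\sum_i c i *: b' (enum_val i)) X = 0.
  apply/(vanishing_graph (a := a) (b := b)) => //.
  by apply: (subsp_sum hV) => j; apply: (subspZ _ hV).
pose q i := \sum_j c (enum_rank ((i, j) : J)) *: G j.
(* Multiplying X by g_l leaves X^T F X unchanged, so one relation on the graph becomes a system of
   linear equations, one for each l, in the same unknowns q_i(X^T F X). *)
have hq X l : \sum_i peval (p i) (mvec (g l *m X)) * (q i).@[quad_coefs (gram X)] = 0.
  have eg : gram (g l *m X) = gram X by rewrite {2}/gram -[X in _ = _ *m X *m _](Og l) /gram trmx_mul !mulmxA.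
  rewrite -[RHS](hc (g l *m X)) /graph_eval peval_sum (reindex (@enum_rank J)) /=; last first.
    by exists enum_val => i _; rewrite ?enum_rankK ?enum_valK.
  pose Phi i j := peval (c (enum_rank ((i, j) : J)) *: b' (enum_val (enum_rank ((i, j) : J))))
    (gvec (g l *m X) (gram (g l *m X)) 1).
  rewrite (eq_bigr (fun p : J => Phi p.1 p.2)); last by case.
  rewrite -(pair_bigA _ Phi) /Phi /=.
  apply: eq_bigr => i _; rewrite raddf_sum mulr_sumr; apply: eq_bigr => j _.
  rewrite enum_rankK !pevalZ pevalM peval_inl peval_inr eg.
  by rewrite /= mevalZ mulrCA.
have q0 i : q i = 0.
  apply: quad_coefs_zero; apply: (polyfun_dom (phi := fun X =>
    \det (\matrix_(i, l) peval (p i) (mvec (g l *m X))))).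
  - apply: polyfun_det => i' l; apply: polyfun_ext (polyfun_meval (p i')
      (phi := fun t X => (g l *m X) (enum_val t).1 (enum_val t).2) _) => [X|t].
      by rewrite mxE; apply: meval_eq => t; rewrite ffunE.
    apply: polyfun_mulmx => j k; [exact: polyfun_const | exact: polyfun_entry].
  - exact: polyfun_quad_coefs.
  - exists 1%:M; apply: contra dg => /eqP e; apply/eqP; rewrite -[RHS]e; congr (\det _).
    by apply/matrixP => i' l; rewrite !mxE mulmx1.
  (* The adjugate turns u A = 0 into (det A) u = 0, and the determinant is nonzero at X = 1 by the
     choice of the g_l. *)
  move=> X; set A := \matrix_(_, _) _; pose u := \row_i (q i).@[quad_coefs (gram X)].
  have uA : u *m A = 0.
    apply/rowP => l; rewrite !mxE -[RHS](hq X l); apply: eq_bigr => i' _.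
    by rewrite !mxE mulrC.
  have : u *m A *m \adj A = 0 by rewrite uA mul0mx.
  rewrite -mulmxA mul_mx_adj mul_mx_scalar => /rowP/(_ i); by rewrite !mxE.
move=> t; rewrite -[t]enum_valK; case: (enum_val t) => i j.
exact: (hmons_indep (q0 i)).
Qed.

Lemma quad_coef_poly m : exists Q : S1, Q \is 2.-homog /\ forall X, peval Q (mvec X) = quad_coef (gram X) m.
Proof.
pose x (j k : I) : S1 := 'X_(enum_rank ((j, k) : T1)).
exists (\sum_j \sum_k (U_(j) + U_(k) == val m)%MM%:R *: \sum_d \sum_c F c d *: (x c j * x d k)).
split.
  apply: rpred_sum => j _; apply: rpred_sum => k _; apply: rpredZ.
  apply: rpred_sum => d _; apply: rpred_sum => c _; apply: rpredZ.
  by rewrite -[2%N]/(1 + 1)%N; apply: dhomogM; rewrite dhomogX /= mdeg1.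
move=> X; rewrite /quad_coef mcoeff_quad_form peval_sum; apply: eq_bigr => j _.
rewrite peval_sum; apply: eq_bigr => k _; rewrite /peval mevalZ mulrC -/(peval _ _); congr (_ * _).
rewrite /gram mxE peval_sum; apply: eq_bigr => d _; rewrite mxE mulr_suml peval_sum.
apply: eq_bigr => c _; rewrite /peval mevalZ mevalM !mevalXU !enum_rankK !ffunE mxE /=; ring.
Qed.

Lemma graph_eval_poly u v P : mhomog g2 (dd u v) P -> exists q : S1, q \is (u + v * 2)%N.-homog /\
  forall X, peval q (mvec X) = graph_eval P X.
Proof.
move=> /span_mon2 [c ->].
have [Q hQ] := functional_choice quad_coef_poly.
exists (\sum_su c su *: ((\prod_l 'X_(enum_rank (su.1 l))) * \prod_l Q (su.2 l))); split.
  apply: rpred_sum => su _; apply: rpredZ; apply: dhomogM.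
    by rewrite -[X in X.-homog]muln1; apply: prod_homog => l; rewrite dhomogX /= mdeg1.
  by apply: prod_homog => l; case: (hQ (su.2 l)).
move=> X; rewrite /graph_eval !peval_sum; apply: eq_bigr => su _.
rewrite !pevalZ peval_mon2 pevalM; congr (_ * (_ * _)).
  by rewrite /peval rmorph_prod; apply: eq_bigr => l _; rewrite /= mevalXU enum_rankK ffunE.
by rewrite /peval rmorph_prod; apply: eq_bigr => l _; case: (hQ (su.2 l)) => _ <-.
Qed.

(** Substituting X^T F X, quadratic in X, turns a form of bidegree (a, b) into a form of degree a +
    2 b in N + 1 variables. *)
Lemma hilb_graph_le_poly a b :
  (hilb g2 (vanishing graph_set) (dd a b) <= 'C(a + b * 2 + N, N))%N.
Proof.
have [P [hP iP _]] := hilbP g2 (dd a b) (ideal_vanishing graph_set).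
have [q hq] := functional_choice (fun i => graph_eval_poly (hP i)).
apply: (homog_count (p := q) eN) => [i|c hc]; first by case: (hq i).
have hV : subsp (mhomog g2 (dd a b)) := subsp_mhomog K g2 (dd a b).
apply: iP; apply/(vanishing_graph (a := a) (b := b)).
  by apply: (subsp_sum hV) => j; apply: (subspZ _ hV).
move=> X; have := congr1 (fun p => peval p (mvec X)) hc.
rewrite {2}/peval meval0 => <-; rewrite /graph_eval !peval_sum; apply: eq_bigr => i _.
by rewrite /peval !mevalZ; congr (_ * _); have [_ hqi] := hq i; exact: (esym (hqi X)).
Qed.

(** ** Upper bound *)

Definition orth1 g := g^T *m g = 1%:M.
Definition sgn (r : I) : 'M[K]_n.+1 := diag_mx (\row_j (if j == r then -1 else 1)).

Lemma mul_sgn g r i j : (g *m sgn r) i j = (if j == r then -1 else 1) * g i j.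
Proof. by rewrite mul_mx_diag !mxE mulrC. Qed.

Lemma orth1_sgn g r : orth1 g -> orth1 (g *m sgn r).
Proof.
move=> hg; rewrite /orth1 trmx_mul tr_diag_mx -mulmxA (mulmxA g^T) hg mul1mx mulmx_diag.
apply/matrixP => i j; rewrite !mxE; case: (i == r); by rewrite ?mulrNN mulr1.
Qed.

Lemma entry_prod_basis a : exists h (s : 'I_h -> {ffun 'I_a -> T1}),
  (forall c : 'I_h -> K, (forall g, orth1 g -> \sum_i c i * entry_prod (s i) g = 0) ->
    forall i, c i = 0) /\
  forall t : {ffun 'I_a -> T1}, exists c : 'I_h -> K, forall g, orth1 g -> entry_prod t g = \sum_i c i * entry_prod (s i) g.
Proof.
pose J (p : S1) := forall g, orth1 g -> peval p (mvec g) = 0.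
have hJ : subsp J.
  split; first by move=> g _; exact: meval0.
  by move=> c p q hp hq g hg; rewrite pevalD pevalZ hp // hq // mulr0 addr0.
pose X := {ffun 'I_a -> T1}.
pose b (i : 'I_#|{: X}|) : S1 := \prod_l 'X_(enum_rank ((enum_val i : X) l)).
have eb i g : peval (b i) (mvec g) = entry_prod (enum_val i : X) g.
  by rewrite /peval rmorph_prod; apply: eq_bigr => l _; rewrite /= mevalXU enum_rankK ffunE.
have es h (t : 'I_h -> 'I_#|{: X}|) c g : peval (\sum_j c j *: b (t j)) (mvec g) =
    \sum_j c j * entry_prod (enum_val (t j) : X) g.
  by rewrite peval_sum; apply: eq_bigr => j _; rewrite pevalZ eb.
have [h [t [it st]]] := indep_subfamily b hJ.
exists h, (fun j => enum_val (t j)); split.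
  by move=> c hc; apply: it => g hg; rewrite es hc.
move=> u; have [c hc] := st (enum_rank u); exists c => g hg.
have := hc g hg; rewrite pevalD /peval mevalN -/(peval _ _) -/(peval _ _) es eb enum_rankK.
by move/eqP; rewrite subr_eq0 => /eqP.
Qed.

(** The conjugation X |-> C X C^-1 carries the orthogonal group of F to that of the identity and
    preserves the degree of forms. *)
Lemma entry_prod_basis_le a h (s : 'I_h -> {ffun 'I_a -> T1}) :
  (forall c : 'I_h -> K, (forall g, orth1 g -> \sum_i c i * entry_prod (s i) g = 0) ->
    forall i, c i = 0) -> (h <= hilb g1 (vanishing orth_set) (d1 a))%N.
Proof.
move=> hs; pose L (jk : T1) : S1 := \sum_d \sum_c
  (C jk.1 c * invmx C d jk.2) *: 'X_(enum_rank ((c, d) : T1)).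
have hL jk : L jk \is 1.-homog.
  by apply: rpred_sum => d _; apply: rpred_sum => c _; apply: rpredZ; rewrite dhomogX /= mdeg1.
have eL jk X : peval (L jk) (mvec X) = (C *m X *m invmx C) jk.1 jk.2.
  rewrite mxE peval_sum; apply: eq_bigr => d _; rewrite mxE mulr_suml peval_sum.
  apply: eq_bigr => c _; rewrite /peval mevalZ mevalXU enum_rankK ffunE /=; ring.
pose p i : S1 := \prod_l L (s i l).
have hp i : mhomog g1 (d1 a) (p i).
  by apply: d1_homog; rewrite -[X in X.-homog]muln1; apply: prod_homog.
have ep i X : peval (p i) (mvec X) = entry_prod (s i) (C *m X *m invmx C).
  by rewrite /peval rmorph_prod; apply: eq_bigr => l _; exact: eL.
apply: (hilb_indep (b := p)) => //; first exact: ideal_vanishing.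
have hV : subsp (mhomog g1 (d1 a)) := subsp_mhomog K g1 (d1 a).
move=> c hc; apply: hs => g hg.
have {}hc : forall X, gram X = F -> peval (\sum_i c i *: p i) (mvec X) = 0.
  apply/(vanishing_orth (a := a)) => //.
  by apply: (subsp_sum hV) => i; apply: (subspZ _ hV).
rewrite -[RHS](hc (invmx C *m (g *m C))); last first.
  by rewrite gram_Cinv trmx_mul -mulmxA (mulmxA g^T) hg mul1mx eF.
rewrite peval_sum; apply: eq_bigr => i _; rewrite pevalZ ep.
by rewrite mulKVmx // mulmxK.
Qed.

Lemma entry_prod_sgn a (t : {ffun 'I_a -> T1}) g r :
  entry_prod t (g *m sgn r) = (-1) ^+ (\sum_l ((t l).2 == r))%N * entry_prod t g.
Proof.
rewrite /entry_prod -prodrXr -big_split; apply: eq_bigr => l _.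
by rewrite mul_sgn; case: eqP.
Qed.

Lemma sgn_parity (p q : nat) : (-1) ^+ p = (-1) ^+ q :> K -> odd p = odd q.
Proof.
rewrite -signr_odd -[in RHS]signr_odd => /eqP.
have n1 : 1 != -1 :> K.
  by rewrite -subr_eq0 opprK -[1 + 1]/(2%:R : K).
by case: (odd p); case: (odd q); rewrite ?expr0 ?expr1 // ?[-1 == _]eq_sym (negPf n1).
Qed.

(** * Expansion of forms along X = C^-1 g T *)

Section Expansion.
Variables (a h : nat) (s : 'I_h -> {ffun 'I_a -> T1}).
Hypothesis s_indep : forall c : 'I_h -> K,
  (forall g, orth1 g -> \sum_i c i * entry_prod (s i) g = 0) -> forall i, c i = 0.
Hypothesis s_span : forall t : {ffun 'I_a -> T1}, exists c : 'I_h -> K,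
  forall g, orth1 g -> entry_prod t g = \sum_i c i * entry_prod (s i) g.

(** The factor depending on g in a monomial of C^-1 g T, once J has selected a summand in each entry
    of the product with T. *)
Definition ws (t : {ffun 'I_a -> T1}) (J : {ffun 'I_a -> I}) g : K :=
  \prod_l (invmx C *m g) (t l).1 (J l).

Lemma entry_prod_expand t g T : entry_prod t (invmx C *m g *m T) =
  \sum_(J : {ffun 'I_a -> I}) ws t J g * \prod_l T (J l) (t l).2.
Proof.
rewrite /entry_prod; under eq_bigr do rewrite mxE.
by rewrite bigA_distr_bigA; apply: eq_bigr => J _; rewrite -big_split.
Qed.

Lemma ws_span t J : exists c : 'I_h -> K,
  forall g, orth1 g -> ws t J g = \sum_i c i * entry_prod (s i) g.
Proof.
pose tt' (A : {ffun 'I_a -> I}) : {ffun 'I_a -> T1} := [ffun l => (A l, J l)].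
have [c hc] := functional_choice (fun A => s_span (tt' A)).
exists (fun i => \sum_(A : {ffun 'I_a -> I}) (\prod_l invmx C (t l).1 (A l)) * c A i) => g hg.
rewrite /ws; under eq_bigr do rewrite mxE.
rewrite bigA_distr_bigA /=; under [RHS]eq_bigr do rewrite mulr_suml.
rewrite exchange_big /=; apply: eq_bigr => A _.
rewrite big_split /=; under [RHS]eq_bigr do rewrite -mulrA.
rewrite -mulr_sumr -hc //; congr (_ * _); apply: eq_bigr => l _.
by rewrite ffunE.
Qed.

(** Changing the sign of column r of g multiplies [ws t J] and each basis monomial by a sign; by
    independence only basis monomials with the same sign as [ws t J] occur. *)
Lemma ws_parity t J (c : 'I_h -> K) i r :
  (forall g, orth1 g -> ws t J g = \sum_i c i * entry_prod (s i) g) -> c i != 0 ->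
  odd (\sum_l (J l == r))%N = odd (\sum_l ((s i l).2 == r))%N.
Proof.
move=> hc ci; apply: sgn_parity; apply/eqP; rewrite -subr_eq0.
suff /eqP : c i * ((-1) ^+ (\sum_l (J l == r))%N - (-1) ^+ (\sum_l ((s i l).2 == r))%N) = 0.
  by rewrite mulf_eq0 (negPf ci).
move: i {ci}; apply: s_indep => g hg.
have := hc _ (orth1_sgn r hg).
have -> : ws t J (g *m sgn r) = (-1) ^+ (\sum_l (J l == r))%N * ws t J g.
  rewrite /ws -prodrXr -big_split; apply: eq_bigr => l _.
  by rewrite mulmxA mul_sgn; case: eqP.
rewrite hc // mulr_sumr => /eqP; rewrite -subr_eq0 -sumrB => /eqP h0.
by rewrite -[RHS]h0; apply: eq_bigr => i _; rewrite entry_prod_sgn; ring.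
Qed.

(** Multiplying the i-th coefficient by t_jj for each column index j in the basis monomial makes
    every row of T occur an even number of times, by [ws_parity]. This gives 2 a entries, hence D^a
    and degree a (delta + 1); the b coefficients of T^T T contribute b. *)
Lemma expand_coef delta D b P : GG delta D ->
  (forall i j k, GG delta.+1 (fun T => D T * (T i j * T i k))) ->
  mhomog g2 (dd a b) P -> exists Co : 'I_h -> 'M[K]_n.+1 -> K,
    (forall g T, orth1 g -> peval P (gvec (invmx C *m g *m T) (T^T *m T) 1) =
       \sum_i Co i T * entry_prod (s i) g) /\
    forall i, GG (a * delta.+1 + b)
      (fun T => D T ^+ a * (\prod_l T (s i l).2 (s i l).2) * Co i T).
Proof.
move=> gD hD /span_mon2 [c ->].
pose be t J := proj1_sig (constructive_indefinite_description _ (ws_span t J)).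
have hbe t J g : orth1 g -> ws t J g = \sum_i be t J i * entry_prod (s i) g.
  exact: (proj2_sig (constructive_indefinite_description _ (ws_span t J))).
exists (fun i T => \sum_su c su * ((\sum_(J : {ffun 'I_a -> I}) be su.1 J i * \prod_l T (J l) (su.1 l).2)
  * \prod_l quad_coef (T^T *m T) (su.2 l))); split=> [g T hg|i].
  rewrite peval_sum; under [RHS]eq_bigr do rewrite mulr_suml.
  rewrite exchange_big /=; apply: eq_bigr => su _.
  rewrite pevalZ peval_mon2 entry_prod_expand.
  pose A i := \sum_(J : {ffun 'I_a -> I}) be su.1 J i * \prod_l T (J l) (su.1 l).2.
  transitivity (c su * ((\sum_i A i * entry_prod (s i) g) * \prod_l quad_coef (T^T *m T) (su.2 l))); last first.
    by rewrite mulr_suml mulr_sumr; apply: eq_bigr => i _; rewrite /A; ring.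
  congr (_ * (_ * _)); rewrite /A; under [RHS]eq_bigr do rewrite mulr_suml.
  rewrite exchange_big /=; apply: eq_bigr => J _; rewrite hbe // mulr_suml.
  by apply: eq_bigr => i _; rewrite mulrAC.
have gy (u : {ffun 'I_b -> MT}) : GG b (fun T => \prod_l quad_coef (T^T *m T) (u l)).
  elim: (b) u => [|b' IHb] u; first by apply: GG_ext (GG1 K n) => T _; rewrite big_ord0.
  have := GG_mul (GG_yco K (u ord0)) (IHb [ffun l => u (lift ord0 l)]).
  by apply: GG_ext => T _; rewrite big_ord_recl; congr (_ * _); apply: eq_bigr => l _; rewrite ffunE.
apply: (GG_ext (phi := fun T => \sum_su c su * ((\sum_(J : {ffun 'I_a -> I}) be su.1 J i *
   (D T ^+ a * ((\prod_l T (s i l).2 (s i l).2) * \prod_l T (J l) (su.1 l).2)))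
   * \prod_l quad_coef (T^T *m T) (su.2 l)))).
  move=> T _; rewrite [RHS]mulr_sumr; apply: eq_bigr => su _.
  rewrite [RHS]mulrCA; congr (_ * _); rewrite [RHS]mulrA; congr (_ * _); rewrite mulr_sumr.
  by apply: eq_bigr => J _; ring.
apply: GG_sum => su _; apply: GG_scale; apply: GG_mul => //; apply: GG_sum => J _.
have [->|bi] := eqVneq (be su.1 J i) 0.
  by apply: GG_ext (GG0 _ _ _) => T _; rewrite mul0r.
apply: GG_scale; pose Ls := [seq ((s i l).2, (s i l).2) | l <- enum 'I_a] ++
  [seq (J l, (su.1 l).2) | l <- enum 'I_a].
apply: GG_ext (GG_even (p := a) (L := Ls) gD hD _ _) => [T _||r].
- by rewrite big_cat !big_map -enumT !big_enum.
- by rewrite size_cat !size_map -enumT size_enum_ord addnn.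
have occurrences (f : 'I_a -> I * I) : count (fun x => x.1 == r) [seq f l | l <- enum 'I_a] =
    (\sum_l ((f l).1 == r))%N.
  by rewrite count_map -sum1_count big_mkcond /= big_enum /=; apply: eq_bigr => l _; case: eqP.
by rewrite count_cat !occurrences oddD /= (ws_parity r (hbe su.1 J) bi) addbb.
Qed.

End Expansion.

(** Where the leading minors of X^T F X are nonzero, it equals T^T T with T triangular and
    invertible, and g = C X T^-1 is orthogonal. *)
Lemma graph_eval_dense_upper P : (forall g T, orth1 g -> upper T -> (forall i, T i i != 0) ->
  peval P (gvec (invmx C *m g *m T) (T^T *m T) 1) = 0) -> forall X, graph_eval P X = 0.
Proof.
move=> h; apply: (polyfun_dom (phi := fun X => \prod_(k < n.+2) lead_minor (gram X) k)).
- apply: polyfun_prod => k; apply: polyfun_det => i j.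
  by apply: polyfun_ext (polyfun_gram (inord i) (inord j)) => X; rewrite mxE.
- exact: polyfun_graph_eval.
- exists (invmx C); rewrite -[invmx C]mulmx1 gram_Cinv trmx1 mulmx1.
  apply/prodf_neq0 => k _; rewrite /lead_minor (_ : \matrix_(_, _) _ = 1%:M) ?det1 ?oner_neq0 //.
  apply/matrixP => i j; rewrite !mxE; congr (_ %:R); congr nat_of_bool.
  rewrite -val_eqE /= !inordK //; have := ltn_ord k; have := ltn_ord i; have := ltn_ord j; lia.
move=> X; have [->|nz] := eqVneq (\prod_(k < n.+2) lead_minor (gram X) k) 0; first by rewrite mul0r.
rewrite /graph_eval.
have [|T [uT dT eT]] := cholesky (gram_sym X).
  by move=> k hk; move/prodf_neq0: nz => /(_ (inord k) isT); rewrite inordK.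
have uTu := upper_unit uT dT; pose g := C *m X *m invmx T.
have hg : orth1 g.
  have eZ : (C *m X)^T *m (C *m X) = T^T *m T by rewrite -gramE.
  rewrite /orth1 /g; move: (C *m X) eZ => Z eZ.
  rewrite trmx_mul -mulmxA (mulmxA Z^T) eZ mulmxK //.
  by rewrite -trmx_mul mulmxV // trmx1.
have := h g T hg uT dT; rewrite /g !mulmxA mulVmx // mul1mx mulmxKV // -eT => ->.
by rewrite mulr0.
Qed.

(** Each basis form P has a tuple of h forms representing its cleared coefficients. A linear
    relation between these tuples holds between the coefficients at every invertible T, hence
    between the P on the graph; so the dimension of the space of tuples bounds the number of the
    P. *)
Lemma hilb_graph_le : exists kappa, forall a b,
  (hilb g2 (vanishing graph_set) (dd a b) <=
   hilb g1 (vanishing orth_set) (d1 a) * 'C(b + a * kappa + M, M))%N.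
Proof.
have [delta [D [gD nD hD]]] := GG_denom n two0; exists delta.+1 => a b.
have [h [s [s_ind s_span]]] := entry_prod_basis a.
apply: leq_trans (leq_mul (entry_prod_basis_le s_ind) (leqnn _)).
have [P [hP iP _]] := hilbP g2 (dd a b) (ideal_vanishing graph_set).
set H := hilb g2 _ _ in P hP iP *.
have ex j := expand_coef s_ind s_span gD hD (hP j).
have [Co hCo] := functional_choice ex.
have exG j i : exists G : S3, G \is (a * delta.+1 + b)%N.-homog /\ forall T, upper T ->
    D T ^+ a * (\prod_l T (s i l).2 (s i l).2) * Co j i T = G.@[quad_coefs (T^T *m T)].
  by case: (hCo j) => _ /(_ i) [G h1 h2]; exists G.
pose G j i := proj1_sig (constructive_indefinite_description _ (exG j i)).
have hG j i : G j i \is (a * delta.+1 + b)%N.-homog /\ forall T, upper T ->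
    D T ^+ a * (\prod_l T (s i l).2 (s i l).2) * Co j i T = (G j i).@[quad_coefs (T^T *m T)].
  exact: (proj2_sig (constructive_indefinite_description _ (exG j i))).
rewrite [(b + _)%N]addnC -(hmons_size _ eM); set ms := hmons _ _.
pose J : finType := ('I_h * 'I_(size ms))%type.
have -> : (h * size ms = #|J|)%N by rewrite card_prod !card_ord.
pose E : lmodType K := {ffun 'I_h -> S3}.
pose av (j : 'I_H) : E := [ffun i => G j i].
pose bv (ik : J) : E := [ffun i => if i == ik.1 then 'X_[(nth 0%MM ms ik.2)] else 0].
apply: (@indep_le K E (fun x => x = 0) H #|J| av (bv \o enum_val)).
- by split=> // x y z -> ->; rewrite scaler0 addr0.
- move=> la hla; apply: iP; have hV : subsp (mhomog g2 (dd a b)) := subsp_mhomog K g2 (dd a b).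
  apply/(vanishing_graph (a := a) (b := b)).
    by apply: (subsp_sum hV) => j; apply: (subspZ _ hV).
  apply: graph_eval_dense_upper => g T hg uT dT; rewrite peval_sum.
  have h0 i : \sum_j la j * Co j i T = 0.
    have := congr1 (fun x : E => (x i).@[quad_coefs (T^T *m T)]) hla.
    rewrite sum_ffunE ffunE raddf_sum raddf0 /= => h1.
    have nz : D T ^+ a * (\prod_l T (s i l).2 (s i l).2) != 0.
      by rewrite mulf_neq0 ?expf_neq0 ?nD //; apply/prodf_neq0 => l _.
    apply: (mulfI nz); rewrite mulr0 -[RHS]h1 mulr_sumr; apply: eq_bigr => j _.
    by rewrite !ffunE mevalZ; case: (hG j i) => _ <- //; rewrite mulrCA.
  transitivity (\sum_j la j * \sum_i Co j i T * entry_prod (s i) g).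
    by apply: eq_bigr => j _; rewrite /peval mevalZ; congr (_ * _); case: (hCo j) => h1 _; apply: h1.
  under eq_bigr do rewrite mulr_sumr.
  rewrite exchange_big /= big1 // => i _.
  by under eq_bigr do rewrite mulrA; rewrite -mulr_suml h0 mul0r.
move=> j; exists (fun t => (G j (enum_val t : J).1)@_(nth 0%MM ms (enum_val t : J).2)).
apply/eqP; rewrite subr_eq0; apply/eqP/ffunP => i; rewrite sum_ffunE !ffunE.
rewrite (reindex (@enum_rank J)) /=; last by exists enum_val => ? _; rewrite ?enum_rankK ?enum_valK.
pose Phi i' (k : 'I_(size ms)) := ((G j i')@_(nth 0%MM ms k) *: bv (i', k)) i.
rewrite (eq_bigr (fun p : J => Phi p.1 p.2)); last by move=> [i' k] _; rewrite enum_rankK.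
rewrite -(pair_bigA _ Phi) /Phi /= (bigD1 i) //= [X in _ + X]big1 ?addr0; last first.
  by move=> i' ne; rewrite big1 // => k _; rewrite !ffunE /= eq_sym (negPf ne) scaler0.
have [hGj _] := hG j i; rewrite {1}(hmons_span hGj); apply: eq_bigr => k _.
by rewrite !ffunE /= eqxx.
Qed.

End Counts.

End Bounds.

(** * Comparison of the two Hilbert functions *)

Section Binomials.
Variable k : nat.
Implicit Types (d : 'X_{1..k}).

Lemma deglt_nseq r (j : 'I_k) (F : 'X_{1..k} -> int) : deglt r F ->
  ev (fun d => diffs (nseq r j) F d = 0).
Proof. by move=> h; apply: diffs_deglt0; rewrite size_nseq. Qed.

Definition binf r s d : int := 'C(mdeg d + s, r)%:Z.

Lemma df_binf j r s d : df j (binf r.+1 s) d = binf r s d.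
Proof. by rewrite /df /binf mdegDU addSn binS PoszD addrAC subrr add0r. Qed.

Lemma diffs_binf bs r s d : (size bs <= r)%N -> diffs bs (binf r s) d = binf (r - size bs) s d.
Proof.
elim: bs r => [|j bs IHb] [|r] //= hs; rewrite ?subn0 // subSS -IHb //.
by apply: eq_diffs => d'; apply: df_binf.
Qed.

Lemma diffs_binf_full bs s d : diffs bs (binf (size bs) s) d = 1.
Proof. by rewrite diffs_binf // subnn /binf bin0. Qed.

Lemma deglt_binf r s : deglt r.+1 (binf r s).
Proof.
elim: r => [|r IHr] j; last by apply: deglt_eq IHr => d; rewrite df_binf.
by apply: evT => d; rewrite /df /binf !bin0 subrr.
Qed.

Lemma growth_mul r s (F G : 'X_{1..k} -> int) : growth r.+1 F -> growth s.+1 G ->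
  growth (r + s).+1 (fun d => F d * G d).
Proof.
move=> [A [d0 hA]] [B [d1 hB]].
exists (A * (mdeg d1).+1 ^ r * (B * (mdeg d0).+1 ^ s))%N, (d0 + d1)%MM => d.
have h1 : (`|F (d0 + d1 + d)%MM| <= A * ((mdeg d1).+1 * (mdeg d).+1) ^ r)%N.
  have := hA (d1 + d)%MM; rewrite addmA (expnSr _ r) mulnA leq_pmul2r // => /leq_trans.
  by apply; apply: leq_mulX; rewrite mdegD; nia.
have h2 : (`|G (d0 + d1 + d)%MM| <= B * ((mdeg d0).+1 * (mdeg d).+1) ^ s)%N.
  have := hB (d0 + d)%MM; rewrite addmA (addmC d1) (expnSr _ s) mulnA leq_pmul2r // => /leq_trans.
  by apply; apply: leq_mulX; rewrite mdegD; nia.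
rewrite abszM expnSr mulnA leq_pmul2r //; apply: leq_trans (leq_mul h1 h2) _.
by rewrite !expnMn expnD; apply/eq_leq; ring.
Qed.

End Binomials.

(** Factor by factor, q m + j <= q (m + j). *)
Lemma bin_scale q m r : (0 < q)%N -> ('C(q * m + r, r) <= q ^ r * 'C(m + r, r))%N.
Proof.
move=> q0; elim: r => [|r IHr]; first by rewrite !bin0.
rewrite -(leq_pmul2l (ltn0Sn r)) !addnS -mul_bin_diag /= [leqRHS]mulnCA -mul_bin_diag /=.
rewrite expnSr -mulnA [leqRHS]mulnA mulnCA [leqRHS]mulnC.
apply: leq_trans (leq_mul (leqnn _) IHr) _; rewrite [leqRHS]mulnC.
set x := 'C(_, _); set y := (q ^ r)%N; nia.
Qed.

Section Comparison.
Local Notation jf := (enum_rank false : 'I_#|{: bool}|).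
Local Notation jt := (enum_rank true : 'I_#|{: bool}|).
Local Notation j0 := (enum_rank tt : 'I_#|{: unit}|).
Implicit Types (F : 'X_{1..#|{: bool}|} -> int) (G : 'X_{1..#|{: unit}|} -> int).

Lemma ddE (d : 'X_{1..#|{: bool}|}) : d = dd (d jf) (d jt).
Proof.
apply/mnmP => j; rewrite -[j]enum_valK.
by case: (enum_val j); rewrite ?dd_true ?dd_false.
Qed.

Lemma dd_add_false a b m : (dd a b + m)%MM jf = (a + m jf)%N.
Proof. by rewrite mnmDE dd_false. Qed.

Lemma dd_add_true a b m : (dd a b + m)%MM jt = (b + m jt)%N.
Proof. by rewrite mnmDE dd_true. Qed.

Lemma dd_add a b a' b' : (dd a b + dd a' b')%MM = dd (a + a') (b + b').
Proof. by rewrite [LHS]ddE dd_add_false dd_add_true dd_false dd_true. Qed.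

Lemma dd_Ut a b : (dd a b + U_(jt))%MM = dd a b.+1.
Proof.
rewrite [LHS]ddE dd_add_false dd_add_true !mnm1E eqxx (inj_eq enum_rank_inj).
by rewrite addn0 addn1.
Qed.

Lemma unit_j0 (j : 'I_#|{: unit}|) : j = j0.
Proof. by apply: enum_val_inj; case: (enum_val _); case: (enum_val _). Qed.

Lemma d1E (e : 'X_{1..#|{: unit}|}) : e = d1 (mdeg e).
Proof.
apply/mnmP => j; rewrite mulmnE mnm1E (unit_j0 j) eqxx mul1n mdegE.
by rewrite (bigD1 j0) //= big1 ?addn0 // => i; rewrite (unit_j0 i) eqxx.
Qed.

Lemma mdeg_d1 a : mdeg (d1 a) = a.
Proof. by rewrite mdegMn mdeg1 mul1n. Qed.

Lemma d1_U a : (d1 a + U_(j0))%MM = d1 a.+1.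
Proof. by rewrite [LHS]d1E mdegDU mdeg_d1. Qed.

Lemma deglt_unit r G : ev (fun e => diffs (nseq r j0) G e = 0) -> deglt r G.
Proof.
move=> h; apply: deglt_diffs => bs hb.
suff -> : bs = nseq r j0 by [].
by rewrite -hb; apply/all_pred1P/allP => j _; rewrite /= (unit_j0 j).
Qed.

(** The restriction to a fixed a, as a function of multidegrees with one component, so that [deglt]
    applies to it. *)
Definition slice F a : 'X_{1..#|{: unit}|} -> int := fun e => F (dd a (mdeg e)).

Lemma diffs_slice s F a e : diffs (nseq s j0) (slice F a) e = diffs (nseq s jt) F (dd a (mdeg e)).
Proof.
elim: s F => //= s IHs F; rewrite -IHs; apply: eq_diffs => e'.
by rewrite /df /slice mdegDU dd_Ut.
Qed.

Lemma ev_dd (Q : 'X_{1..#|{: bool}|} -> Prop) : ev Q <->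
  exists a0 b0, forall a b, (a0 <= a)%N -> (b0 <= b)%N -> Q (dd a b).
Proof.
split=> [[d0 h]|[a0 [b0 h]]].
  exists (d0 jf), (d0 jt) => a b ha hb; have := h (dd (a - d0 jf) (b - d0 jt)).
  by rewrite {1}[d0]ddE dd_add !subnKC.
by exists (dd a0 b0) => d; rewrite [d]ddE dd_add; apply: h; apply: leq_addr.
Qed.

Lemma ev_d1 (Q : 'X_{1..#|{: unit}|} -> Prop) : ev Q <->
  exists a0, forall a, (a0 <= a)%N -> Q (d1 a).
Proof.
split=> [[d0 h]|[a0 h]].
  exists (mdeg d0) => a ha; have := h (d1 (a - mdeg d0)).
  by rewrite [(_ + _)%MM]d1E mdegD mdeg_d1 subnKC.
by exists (d1 a0) => d; rewrite [(_ + _)%MM]d1E mdegD mdeg_d1; apply: h; apply: leq_addr.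
Qed.

(** The threshold b1 may depend on a, while b0 does not. For each a the function is polynomial in b
    from b0 on, so its vanishing far out propagates down to b0. *)
Lemma eventually_zero s F a0 b0 :
  (forall a b, (a0 <= a)%N -> (b0 <= b)%N -> diffs (nseq s jt) F (dd a b) = 0) ->
  (forall a, (a0 <= a)%N -> exists b1, forall b, (b1 <= b)%N -> F (dd a b) = 0) ->
  forall a b, (a0 <= a)%N -> (b0 <= b)%N -> F (dd a b) = 0.
Proof.
elim: s F => [|s IHs] F hs hF //.
have h : forall a b, (a0 <= a)%N -> (b0 <= b)%N -> df jt F (dd a b) = 0.
  apply: IHs => // a ha; have [b1 hb1] := hF a ha; exists b1 => b hb.
  by rewrite /df dd_Ut !hb1 ?subrr // leqW.
move=> a b ha hb; have [b1 hb1] := hF a ha.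
have E t : F (dd a (b + t)) = F (dd a b).
  elim: t => [|t <-]; first by rewrite addn0.
  have := h a (b + t)%N ha (leq_trans hb (leq_addr _ _)).
  by rewrite /df dd_Ut addnS => /eqP; rewrite subr_eq0 => /eqP.
by rewrite -(E b1) hb1 // leq_addl.
Qed.

Variables (H2 : 'X_{1..#|{: bool}|} -> nat) (H1 : 'X_{1..#|{: unit}|} -> nat).
Variables (N M kappa : nat).
Local Notation F2 := (fun d => (H2 d)%:Z).
Local Notation F1 := (fun e => (H1 e)%:Z).
Hypothesis poly2 : exists s, deglt s F2.
Hypothesis ge_mon : forall a b, ('C(a + N, N) <= H2 (dd a b))%N.
Hypothesis ge_fib : forall a b, (H1 (d1 a) * 'C(b + M, M) <= H2 (dd a b))%N.
Hypothesis le_mon : forall a b, (H2 (dd a b) <= 'C(a + b * 2 + N, N))%N.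
Hypothesis le_fib : forall a b, (H2 (dd a b) <= H1 (d1 a) * 'C(b + a * kappa + M, M))%N.

Lemma deglt_F2 : deglt N.+1 F2.
Proof.
have [s hs] := poly2.
(* The constant 2^N comes from a + 2 b <= 2 (a + b). *)
apply: (deglt_dom (G := fun d => (2 ^ N)%N%:Z * binf N N d) hs).
  exact: degltZ (deglt_binf N N).
apply: evT => d; rewrite /binf -PoszM lez_nat /= [d]ddE; set a := d jf; set b := d jt.
apply: leq_trans (le_mon a b) _; rewrite mdegD !mdegMn !mdeg1 !mul1n.
by apply: leq_trans (bin_scale _ _ _) => //; apply: leq_bin2l; lia.
Qed.

(** For fixed a the two bounds differ by a function of b of degree less than M, so the M-th
    difference sees only their common leading term. *)
Lemma slice_deglt a0 b0 a : (forall a b, (a0 <= a)%N -> (b0 <= b)%N ->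
    diffs (nseq N.+1 jt) F2 (dd a b) = 0) -> (a0 <= a)%N ->
  ev (fun e => diffs (nseq M j0) (slice F2 a) e = (H1 (d1 a))%:Z).
Proof.
move=> h ha; pose G e := slice F2 a e - (H1 (d1 a))%:Z * binf M M e.
have dG : deglt (maxn N.+1 M.+1) G.
  apply: degltB.
    apply: (deglt_leq (leq_maxl _ _)); apply: deglt_unit; apply/ev_d1; exists b0 => b hb.
    by rewrite diffs_slice mdeg_d1 h.
  apply: (deglt_leq (leq_maxr _ _)).
  exact: degltZ (deglt_binf M M).
have : deglt M G.
  apply: (deglt_dom (G := fun e => (H1 (d1 a))%:Z * (binf M M (e + d1 (a * kappa))%MM - binf M M e)) dG).
    exact: degltZ (deglt_addB (d1 (a * kappa)) (deglt_binf M M)).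
  apply: evT => e; rewrite /G /slice /binf mdegD mdeg_d1 mulrBr subr_ge0 lerD2r -!PoszM !lez_nat.
  by rewrite ge_fib le_fib.
move/(deglt_nseq j0).
apply: ev_mono => e; rewrite /G.
have -> : diffs (nseq M j0) (fun e => slice F2 a e - (H1 (d1 a))%:Z * binf M M e) e =
    diffs (nseq M j0) (slice F2 a) e - (H1 (d1 a))%:Z.
  rewrite -[in RHS](mulr1 (H1 (d1 a))%:Z) -(diffs_binf_full (nseq M j0) M e) size_nseq -mulNr.
  rewrite -[in RHS](mul1r (diffs _ (slice _ _) _)) -diffs_comb.
  by apply: eq_diffs => e'; rewrite mul1r mulNr.
by move/eqP; rewrite subr_eq0 => /eqP.
Qed.

(** N + 1 differences in b kill H beyond one threshold for all large a; with this, [eventually_zero]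
    makes the threshold of [slice_deglt] independent of a. *)
Lemma diffs_fibre : ev (fun d => diffs (nseq M jt) F2 d = (H1 (d1 (d jf)))%:Z).
Proof.
have : ev (fun d => diffs (nseq N.+1 jt) F2 d = 0).
  by apply: diffs_deglt0; rewrite size_nseq; apply: deglt_F2.
move/ev_dd => [a0 [b0 h]]; apply/ev_dd; exists a0, b0.
pose E d := diffs (nseq M jt) F2 d - (H1 (d1 (d jf)))%:Z.
suff hE a b : (a0 <= a)%N -> (b0 <= b)%N -> E (dd a b) = 0.
  move=> a b ha hb; have := hE a b ha hb; rewrite /E => /eqP.
  by rewrite subr_eq0 => /eqP.
move: a b; apply: (@eventually_zero N.+1).
  move=> a b ha hb; have := h a b ha hb.
  have -> : diffs (nseq N.+1 jt) E (dd a b) =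
      diffs (nseq M jt) (diffs (nseq N.+1 jt) F2) (dd a b).
    rewrite /= -[in RHS]/(diffs (nseq N.+1 jt) F2) -diffs_cat diffsC diffs_cat /=.
    apply: eq_diffs => d; rewrite diffs_df /df /E [d]ddE dd_Ut !dd_false; ring.
  move=> _; have : forall d, diffs (nseq N.+1 jt) F2 (dd a0 b0 + d)%MM = 0.
    by move=> d; rewrite [d]ddE dd_add; apply: h; apply: leq_addr.
  set F := diffs (nseq N.+1 jt) F2 => hF.
  have hM s : forall d, diffs (nseq s jt) F (dd a0 b0 + d)%MM = 0.
    elim: s F hF => //= s IHs F hF; apply: IHs => d.
    by rewrite /df -addmA !hF subrr.
  by have := hM M (dd (a - a0) (b - b0)); rewrite dd_add !subnKC.
move=> a ha; have /ev_d1 [b1 hb1] := slice_deglt h ha; exists b1 => b hb.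
by rewrite /E dd_false -(hb1 b hb) diffs_slice mdeg_d1 subrr.
Qed.

Lemma diffs_pullback s F G : ev (fun d => F d = G (d1 (d jf))) ->
  ev (fun d => diffs (nseq s jf) F d = diffs (nseq s j0) G (d1 (d jf))).
Proof.
elim: s F G => //= s IHs F G h; apply: IHs.
apply: ev_and2 h (ev_shift U_(jf) h) => d h1 h2.
by rewrite /df h1 h2 mnmDE mnm1E eqxx addn1 d1_U.
Qed.

Lemma ev_pullback (Q : 'X_{1..#|{: unit}|} -> Prop) : ev Q <-> ev (fun d => Q (d1 (d jf))).
Proof.
split=> [/ev_d1 [a0 h]|/ev_dd [a0 [b0 h]]].
  by apply/ev_dd; exists a0, 0%N => a b ha _; rewrite dd_false; apply: h.
by apply/ev_d1; exists a0 => a ha; have := h a b0 ha (leqnn _); rewrite dd_false.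
Qed.

(** After M differences in b the function depends on a alone, and one more difference in b kills
    it. *)
Lemma diffs_above i : (M < i)%N -> (i <= N)%N ->
  ev (fun d => diffs (nseq (N - i) jf ++ nseq i jt) F2 d = 0).
Proof.
move=> lt le; apply: (@ev_mono _ (fun d => diffs (nseq i jt ++ nseq (N - i) jf) F2 d = 0)).
  by move=> d <-; apply: diffsC.
rewrite (_ : nseq i jt = nseq M jt ++ jt :: nseq (i - M).-1 jt); last first.
  by rewrite -[jt :: _]/(nseq (i - M).-1.+1 jt) prednK ?subn_gt0 // -nseqD subnKC // ltnW.
rewrite -catA diffs_cat /=.
apply: (@ev_mono _ (fun d => diffs (nseq (i - M).-1 jt ++ nseq (N - i) jf) (fun=> 0) d =
  diffs (nseq (i - M).-1 jt ++ nseq (N - i) jf) (df jt (diffs (nseq M jt) F2)) d)).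
  by move=> d <-; apply: diffs0.
apply: diffs_ev; apply: ev_and2 diffs_fibre (ev_shift U_(jt) diffs_fibre) => d h1 h2.
by rewrite /df h1 h2 mnmDE mnm1E (inj_eq enum_rank_inj) addn0 subrr.
Qed.

Variable r : nat.
Hypotheses (deg1 : deglt r.+1 F1) (ndeg1 : ~ deglt r F1).

(** M + r <= N, since H has degree at most N and M differences in b leave h, of degree r. Conversely
    binom(a + N, N) <= h(a) binom(kappa a + M, M), where the right-hand side grows at most like a^(r
    + M). *)
Lemma fibre_degree : (M + r = N)%N.
Proof.
have MN : (M <= N)%N.
  rewrite leqNgt; apply/negP => lt; apply: ndeg1; apply: (@deglt_leq _ 0) => //.
  apply/ev_pullback; have : ev (fun d => diffs (nseq M jt) F2 d = 0).
    by apply: diffs_deglt0; rewrite size_nseq; apply: deglt_leq deglt_F2.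
  by apply: ev_and2 diffs_fibre => d ->.
apply/eqP; rewrite eqn_leq; apply/andP; split.
  rewrite leqNgt; apply/negP => lt; apply: ndeg1.
  apply: (@deglt_leq _ (N - M).+1); first by lia.
  apply: deglt_unit; apply/ev_pullback.
  have : ev (fun d => diffs (nseq M jt ++ nseq (N - M).+1 jf) F2 d = 0).
    apply: diffs_deglt0; rewrite size_cat !size_nseq addnS subnKC //; exact: deglt_F2.
  rewrite diffs_cat; apply: ev_and2 (diffs_pullback (N - M).+1 (G := F1) diffs_fibre) => d <-; exact.
rewrite leqNgt; apply/negP => lt.
have : deglt N (binf N N : 'X_{1..#|{: unit}|} -> int).
  apply: (deglt_of_growth _ (deglt_binf N N)); first by lia.
  have := growth_mul (deglt_growth deg1) (deglt_growth (@deglt_binf #|{: unit}| M M)).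
  case/(growth_leq (s := N)); first by lia.
  move=> A [d0 hA]; exists (A * kappa.+1 ^ M)%N, d0 => d.
  rewrite -mulnA mulnCA; apply: leq_trans (leq_mul (leqnn (kappa.+1 ^ M)%N) (hA d)).
  rewrite mulnA; apply: leq_mul => //; rewrite [(d0 + d)%MM]d1E; set a := mdeg _.
  rewrite /binf mdeg_d1 abszM !absz_nat mulnCA.
  apply: leq_trans (ge_mon a 0) _; apply: leq_trans (le_fib a 0) _.
  rewrite leq_mul2l; apply/orP; right; rewrite add0n.
  by apply: leq_trans (bin_scale a M (ltn0Sn kappa)); apply: leq_bin2l; nia.
move/(deglt_nseq j0).
case=> d0 /(_ 0%MM); rewrite -{2}(size_nseq N j0) diffs_binf_full => /eqP.
by rewrite oner_eq0.
Qed.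

Lemma diffs_top d : ev (fun e => diffs (nseq r j0) F1 e = d%:Z) ->
  ev (fun e => diffs (nseq (N - M) jf ++ nseq M jt) F2 e = d%:Z).
Proof.
move=> h; have -> : (N - M = r)%N by rewrite -fibre_degree addKn.
apply: (@ev_mono _ (fun e => diffs (nseq M jt ++ nseq r jf) F2 e = d%:Z)).
  by move=> e <-; apply: diffsC.
rewrite diffs_cat.
apply: ev_and2 (diffs_pullback r (G := F1) diffs_fibre) (proj1 (ev_pullback _) h) => e -> //.
Qed.

End Comparison.

(** * The predegree polynomial of a smooth quadric *)

Section Closure.
Variables (K : closedFieldType) (T B : finType) (blk : T -> B).
Implicit Types V : {ffun T -> K} -> Prop.

Lemma vanishing_zclosure V : mp_set blk V -> vanishing (zclosure blk V) = vanishing V.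
Proof.
move=> [hV _]; apply: pred_ext => p; split=> h v; last by move=> [_]; apply.
by move=> Vv; apply: h; split=> [|q]; [exact: hV | apply].
Qed.

Lemma mp_set_zclosure V : mp_set blk V -> mp_set blk (zclosure blk V).
Proof.
move=> hV; have [_ hh] := hideal_vanishing hV; split; first by move=> v [].
move=> c v c0 [pv cv]; split.
  by move=> b; have [t tb vt] := pv b; exists t => //; rewrite ffunE mulf_neq0.
by move=> p hp; rewrite peval_rescale big1 // => d _; rewrite cv ?mulr0 //; apply: hh.
Qed.

Lemma zclosureK V : mp_set blk V -> incl (zclosure blk (zclosure blk V)) (zclosure blk V).
Proof. by move=> hV v [pv cv]; split=> // p hp; apply: cv; rewrite vanishing_zclosure. Qed.

End Closure.

Section GraphVariety.
Variables (K : closedFieldType) (n : nat).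
Hypothesis two0 : 2%:R != 0 :> K.
Variables (F C : 'M[K]_n.+1).
Hypotheses (eF : F = C^T *m C) (uC : C \in unitmx).
Local Notation blk2 := (@graph_block n 2 : gcoord n -> bool).

Lemma gramZ c X : gram F (c *: X) = c ^+ 2 *: gram F X.
Proof.
have e : (c *: X)^T = c *: X^T by apply/matrixP => i j; rewrite !mxE.
by rewrite /gram e -!scalemxAl -scalemxAr scalerA.
Qed.

Lemma qpZ c (G : 'M[K]_n.+1) : quad_form (c *: G) = c *: quad_form G.
Proof.
rewrite /quad_form scaler_sumr; apply: eq_bigr => j _; rewrite scaler_sumr.
by apply: eq_bigr => k _; rewrite mxE scalerA.
Qed.

Lemma ycoZ c (G : 'M[K]_n.+1) m : quad_coef (c *: G) m = c * quad_coef G m.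
Proof. by rewrite /quad_coef qpZ mcoeffZ. Qed.

Lemma graph_mp_set : mp_set blk2 (graph_set F).
Proof.
split=> [v [X [a [q0 a0 ->]]] b|c v c0 [X [a [q0 a0 ->]]]]; last first.
  have cf0 : c false ^+ 2 != 0 by rewrite expf_neq0.
  (* Scaling X by a constant multiplies X^T F X by its square, which the scalar of the second factor
     compensates. *)
  exists (c false *: X), (c true * a / c false ^+ 2); split.
  - by rewrite gramZ qpZ mscalerI negb_or cf0.
  - by rewrite !mulf_neq0 ?invr_eq0.
  apply/ffunP => -[ij|m]; rewrite !ffunE /= ?mxE //.
by rewrite gramZ ycoZ [RHS]mulrA divfK // mulrA.
have [j [k jk]] : exists j k, gram F X j k != 0.
  apply: NNPP => h; move/negP: q0; apply; rewrite quad_form_eq0 ?(gram_sym eF) //.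
  apply/eqP/matrixP => j k; rewrite [RHS]mxE; apply/eqP; apply: contraT => jk.
  by case: h; exists j, k.
case: b.
  exists (inr (pairm j k)) => //; rewrite ffunE mulf_neq0 //.
  by apply: contraNneq jk => y0; rewrite (quad_coef_entry two0) ?(gram_sym eF) // y0 mulr0.
have [i [l il]] : exists i l, X i l != 0.
  apply: NNPP => h; move/negP: jk; apply; rewrite (_ : X = 0) ?/gram ?mulmx0 ?mxE //.
  by apply/matrixP => i l; rewrite mxE; apply/eqP; apply: contraT => il; case: h; exists i, l.
by exists (inl (i, l)) => //; rewrite ffunE.
Qed.

Lemma gram_Cinv1 : gram F (invmx C) = 1%:M.
Proof. by rewrite -[invmx C]mulmx1 (gram_Cinv eF) // trmx1 mulmx1. Qed.

Lemma qp1_neq0 : quad_form (1%:M : 'M[K]_n.+1) != 0.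
Proof.
rewrite quad_form_eq0 ?trmx1 //; apply/negP => /eqP/matrixP/(_ ord0 ord0).
by rewrite !mxE eqxx => /eqP; rewrite oner_eq0.
Qed.

(** The graph is parametrized by matrices, so bihomogeneous polynomials restrict to polynomial
    functions of X, which form a domain. *)
Lemma graph_subvariety : subvariety blk2 (zclosure blk2 (graph_set F)).
Proof.
have mG := graph_mp_set; have hG := hideal_vanishing mG.
have ex : graph_set F (gvec (invmx C) (gram F (invmx C)) 1).
  by exists (invmx C), 1; rewrite oner_neq0 gram_Cinv1 qp1_neq0.
split; [exact: mp_set_zclosure | | exact: zclosureK |].
  by exists (gvec (invmx C) (gram F (invmx C)) 1); split; [apply: (proj1 mG) | move=> p; apply].
rewrite vanishing_zclosure //.
suff [_ _ h] : prime_ideal (vanishing (graph_set F)) by apply: h.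
apply: (hprime_prime hG); first by move=> /(_ _ ex) /eqP; rewrite [peval _ _]meval1 oner_eq0.
move=> d d' p q; rewrite [d]ddE [d']ddE => hp hq; have hpq := mhomogM hp hq.
rewrite dd_add in hpq; rewrite (vanishing_graph eF uC hpq) => h.
have [p0|p0] := classic (forall X, graph_eval F p X = 0).
  by left; apply/(vanishing_graph eF uC hp).
right; apply/(vanishing_graph eF uC hq).
apply: (polyfun_dom (polyfun_graph_eval F p) (polyfun_graph_eval F q)).
  by apply: NNPP => no; apply: p0 => X; apply/eqP; apply: contraT => X0; case: no; exists X.
by move=> X; rewrite /graph_eval -pevalM; apply: h.
Qed.

Lemma orth_mp_set : mp_set (fun _ : mxcoord n => tt) (orth_set F).
Proof.
split=> [v [X [a [gX a0 ->]]] b|c v c0 [X [a [gX a0 ->]]]]; last first.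
  by exists X, (c tt * a); rewrite mulf_neq0 //; split=> //; apply/ffunP => ij; rewrite !ffunE mulrA.
have [i [l il]] : exists i l, X i l != 0.
  apply: NNPP => h; have X0 : X = 0.
    by apply/matrixP => i l; rewrite mxE; apply/eqP; apply: contraT => il; case: h; exists i, l.
  have := uC; rewrite -unitmx_tr unitmxE unitfE => dC.
  have : F = 0 by rewrite -gX X0 /gram mulmx0.
  rewrite eF => /(congr1 determinant); rewrite det_mulmx det0 => /eqP.
  by rewrite mulf_eq0 (negPf dC) -det_tr (negPf dC).
by exists (i, l); [case: b | rewrite ffunE mulf_neq0].
Qed.

Lemma qcoord_card : exists M, #|{: qcoord n}| = M.+1.
Proof.
have : (0 < #|{: qcoord n}|)%N by apply/card_gt0P; exists (pairm ord0 ord0).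
by case: #|_| => // M _; exists M.
Qed.

(** M + 1 is the number of quadratic monomials. That d is nonzero comes from h having degree exactly
    r, and it makes [a M] the leading coefficient. *)
Lemma leading_number (a : nat -> nat) d :
  (forall i, (i <= n ^ 2 + 2 * n)%N -> hyperplane_number blk2
     (nseq (n ^ 2 + 2 * n - i) false ++ nseq i true) (zclosure blk2 (graph_set F)) (a i)) ->
  proj_degree (zclosure (fun _ : mxcoord n => tt) (orth_set F)) d ->
  exists M, [/\ (M <= n ^ 2 + 2 * n)%N, a M = d, d != 0%N &
    forall i, (M < i)%N -> (i <= n ^ 2 + 2 * n)%N -> a i = 0%N].
Proof.
set N := (n ^ 2 + 2 * n)%N => ha hd.
have eN : #|{: mxcoord n}| = N.+1 by rewrite card_prod !card_ord /N; lia.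
have [M eM] := qcoord_card; have sG := graph_subvariety; have mO := orth_mp_set.
have [r [deg1 ndeg1 hr]] := proj_degree_diffs (mp_set_zclosure mO) (@zclosureK _ _ _ _ _ mO) hd.
rewrite (vanishing_zclosure mO) in deg1 ndeg1 hr.
have hG := subvariety_hideal sG.
rewrite (vanishing_zclosure graph_mp_set) in hG.
have [kappa lek] := hilb_graph_le two0 eF uC eN eM.
pose H2 := hilb (grd blk2) (vanishing (graph_set F)).
pose H1 := hilb (grd (fun _ : mxcoord n => tt)) (vanishing (orth_set F)).
have poly2 : exists s, deglt s (fun d => (H2 d)%:Z) := hilbert_serre hG.
have ge_mon := hilb_graph_ge_mon eF uC eN.
have ge_fib := hilb_graph_ge two0 eF uC eM.
have le_mon := hilb_graph_le_poly eF uC eN.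
have num i : (i <= N)%N -> ev (fun e => diffs (nseq (N - i) (enum_rank false) ++ nseq i (enum_rank true))
    (fun d => (H2 d)%:Z) e = (a i)%:Z).
  move=> hi; have := hyperplane_diffs (ha i hi) sG.
  rewrite map_cat !map_nseq size_cat !size_nseq subnK // (vanishing_zclosure graph_mp_set).
  by apply; apply: (deglt_F2 poly2 le_mon).
have eMN := fibre_degree poly2 ge_mon ge_fib le_mon lek deg1 ndeg1.
have MN : (M <= N)%N by rewrite -eMN leq_addr.
exists M; split=> //.
- have := diffs_top poly2 ge_mon ge_fib le_mon lek deg1 ndeg1 hr.
  have := num M MN => h1 h2; apply/eqP; rewrite -eqz_nat; apply/eqP.
  by apply: (@ev_const #|{: bool}|); apply: ev_and2 h1 h2 => e <- <-.
- apply/eqP => d0; apply: ndeg1; apply: deglt_unit; by move: hr; rewrite d0.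
- move=> i lt le; have h1 := num i le; have h2 := diffs_above poly2 ge_fib le_mon lek lt le.
  apply/eqP; rewrite -eqz_nat; apply/eqP.
  by apply: (@ev_const #|{: bool}|); apply: ev_and2 h1 h2 => e <- ->.
Qed.

End GraphVariety.

(** * Quadrics as symmetric matrices *)

Section QuadraticEvaluation.
Variables (K : closedFieldType) (n : nat).
Implicit Types (G : 'M[K]_n.+1).

Lemma meval_quad_form G v : (quad_form G).@[v] = ((\col_i v i)^T *m G *m (\col_i v i)) 0 0.
Proof.
rewrite /quad_form raddf_sum mxE /=; under [RHS]eq_bigr do rewrite [(_ *m G) _ _]mxE mulr_suml.
rewrite exchange_big /=; apply: eq_bigr => j _; rewrite raddf_sum; apply: eq_bigr => k _.
rewrite /= mevalZ mevalM !mevalXU !mxE; ring.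
Qed.

Lemma mpoly_ext (p q : {mpoly K[n.+1]}) : (forall v, p.@[v] = q.@[v]) -> p = q.
Proof.
move=> h; apply/eqP; rewrite -subr_eq0; apply: contraT => /mpoly_nonzero [v].
by rewrite mevalB h subrr eqxx.
Qed.

Lemma quad_form_inj G G' : 2%:R != 0 :> K -> G^T = G -> G'^T = G' -> quad_form G = quad_form G' -> G = G'.
Proof.
move=> two0 sG sG' e; apply/matrixP => j k.
by rewrite (quad_coef_entry two0 _ _ sG) (quad_coef_entry two0 _ _ sG') /quad_coef e.
Qed.

Lemma quadric_quad_form (f : {mpoly K[n.+1]}) : 2%:R != 0 :> K -> f \is 2.-homog ->
  exists2 G, G^T = G & f = quad_form G.
Proof.
move=> two0 hf; have [G sG hG] := quad_coef_surj two0 (fun m : qcoord n => f@_(val m)).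
exists G => //; apply/mpolyP => m; have [m2|m2] := boolP (mdeg m == 2%N); last first.
  rewrite (dhomog_nemf_coeff hf m2) mcoeff_quad_form big1 // => j _; rewrite big1 // => k _.
  rewrite (_ : (_ == m) = false) ?mulr0 //; apply: contraNF m2 => /eqP <-; exact: mdeg_pair.
have lt : (mdeg m < 3)%N by rewrite (eqP m2).
by have := hG (exist _ (BMultinom lt) m2); rewrite /quad_coef /= => ->.
Qed.

Lemma mderiv_quad_form G i v : G^T = G ->
  ((quad_form G)^`M(i)).@[v] = 2%:R * ((\col_i v i)^T *m G) 0 i.
Proof.
move=> sG; have dX j : (('X_j : {mpoly K[n.+1]})^`M(i)).@[v] = (j == i)%:R.
  rewrite mderivX mevalZ mnm1E; case: eqP => [->|_]; last by rewrite mul0r.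
  by rewrite (_ : (U_(i) - U_(i))%MM = 0%MM) ?mpolyX0 ?meval1 ?mulr1 //; apply/mnmP => l; rewrite mnmBE subnn mnm0E.
have dS (u : 'I_n.+1 -> {mpoly K[n.+1]}) :
    ((\sum_j u j)^`M(i)).@[v] = \sum_j ((u j)^`M(i)).@[v].
  by rewrite (big_morph (mderiv i) (mderivD i) (mderiv0 _ i)) raddf_sum.
rewrite /quad_form dS.
transitivity (\sum_j \sum_k (G j k * ((j == i)%:R * v k) + G j k * (v j * (k == i)%:R))).
  apply: eq_bigr => j _; rewrite dS; apply: eq_bigr => k _.
  by rewrite mderivZ mevalZ mderivM mevalD !mevalM !dX !mevalXU mulrDr.
under eq_bigr do rewrite big_split /=.
rewrite big_split /= (mulr_natl _ 2) mulr2n mxE; congr (_ + _).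
  rewrite (bigD1 i) //= [X in _ + X]big1 ?addr0; last first.
    by move=> j /negPf ne; rewrite big1 // => k _; rewrite ne mul0r mulr0.
  by apply: eq_bigr => k _; rewrite eqxx mul1r -{1}sG !mxE mulrC.
apply: eq_bigr => j _; rewrite (bigD1 i) //= [X in _ + X]big1 ?addr0; last first.
  by move=> k /negPf->; rewrite !mulr0.
by rewrite eqxx mulr1 !mxE mulrC.
Qed.

End QuadraticEvaluation.

(** * Endomorphisms as matrices in the basis e *)

Section Coordinates.
Variables (K : closedFieldType) (n : nat) (A : vectType K) (e : n.+1.-tuple A).
Hypothesis basis_e : basis_of fullv e.
Implicit Types (phi : 'End(A)) (x : A).

Definition cvec x : 'cV[K]_n.+1 := \col_i coord e i x.
Definition emx phi : 'M[K]_n.+1 := \matrix_(i, j) end_coord e phi (i, j).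

Lemma coord_sum_basis (u : 'I_n.+1 -> K) i : coord e i (\sum_j u j *: e`_j) = u i.
Proof. by rewrite coord_sum_free // (basis_free basis_e). Qed.

Lemma basis_sum x : x = \sum_j coord e j x *: e`_j.
Proof. exact: (coord_basis basis_e (memvf x)). Qed.

Lemma cvec_app phi x : cvec (phi x) = emx phi *m cvec x.
Proof.
apply/colP => i; rewrite !mxE {1}(basis_sum x) linear_sum linear_sum; apply: eq_bigr => j _.
by rewrite !mxE !linearZ /= ffunE mulrC.
Qed.

Lemma emx_surj X : exists phi, emx phi = X.
Proof.
pose h x := \sum_j coord e j x *: \sum_i X i j *: e`_i.
have h_lin : linear h.
  move=> c x y; rewrite /h scaler_sumr -big_split; apply: eq_bigr => j _ /=.
  by rewrite linearP scalerDl scalerA.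
pose hL : {linear A -> A} := HB.pack h (GRing.isLinear.Build _ _ _ _ _ h_lin).
have eh x : linfun hL x = h x by rewrite lfunE.
have hs (V : 'I_n.+1 -> A) (j : 'I_n.+1) : \sum_k coord e k e`_j *: V k = V j.
  have fr := basis_free basis_e.
  rewrite (bigD1 j) //= coord_free // eqxx scale1r big1 ?addr0 // => k ne.
  by rewrite coord_free // eq_sym (negPf ne) scale0r.
exists (linfun hL); apply/matrixP => i j; rewrite mxE ffunE /= eh /h hs.
exact: coord_sum_basis.
Qed.

Lemma cvec0 x : (cvec x == 0) = (x == 0).
Proof.
apply/eqP/eqP => [h|->]; last by apply/colP => i; rewrite !mxE linear0.
by rewrite (basis_sum x) big1 // => j _; move/colP/(_ j): h; rewrite !mxE => ->; rewrite scale0r.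
Qed.

Lemma cvec_surj u : exists x, cvec x = u.
Proof. by exists (\sum_j u j 0 *: e`_j); apply/colP => i; rewrite mxE coord_sum_basis. Qed.

Lemma form_at_quad_form G x : form_at e (quad_form G) x = ((cvec x)^T *m G *m cvec x) 0 0.
Proof. exact: meval_quad_form. Qed.

Variable F : 'M[K]_n.+1.
Hypotheses (two0 : 2%:R != 0 :> K) (sF : F^T = F).

Lemma gram_symF X : (gram F X)^T = gram F X.
Proof. by rewrite /gram !trmx_mul trmxK sF mulmxA. Qed.

Lemma precomp_quad_form phi : precomp e (quad_form F) phi = quad_form (gram F (emx phi)).
Proof.
apply: mpoly_ext => v; rewrite comp_mpoly_meval !meval_quad_form /gram.
suff -> : \col_i (tnth [tuple \sum_(j < n.+1) end_coord e phi (i, j) *: 'X_j | i < n.+1] i).@[v] =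
    emx phi *m \col_i v i by rewrite trmx_mul !mulmxA.
apply/colP => i; rewrite !mxE tnth_mktuple raddf_sum /=; apply: eq_bigr => j _.
by rewrite mevalZ mevalXU !mxE.
Qed.

(** The gradient of x^T F x is 2 F x, so a nonzero vector in the kernel of F is a singular point. *)
Lemma smooth_unit : smooth_hypersurface e (quad_form F) -> F \in unitmx.
Proof.
move=> smooth; rewrite unitmxE unitfE; apply/negP => /det0P [v v0 vF].
have [x hx] := cvec_surj v^T.
have x0 : x != 0 by rewrite -cvec0 hx; apply: contra v0 => /eqP h; rewrite -[v]trmxK h trmx0.
have [|i] := smooth x x0; first by rewrite form_at_quad_form hx trmxK vF mul0mx mxE.
by rewrite /form_at mderiv_quad_form // -/(cvec x) hx trmxK vF mxE mulr0 eqxx.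
Qed.

(** Equal quadratic forms have equal symmetric matrices, 2 being invertible; conversely, injectivity
    of phi follows from the invertibility of F. *)
Lemma orthogonal_gram phi : F \in unitmx ->
  orthogonal_group e (quad_form F) phi <-> gram F (emx phi) = F.
Proof.
move=> uF; split=> [[_ h]|h].
  apply: (quad_form_inj two0) => //; first exact: gram_symF.
  apply: mpoly_ext => v; have [x hx] := cvec_surj (\col_i v i).
  have := h x; rewrite !form_at_quad_form cvec_app hx !meval_quad_form /gram trmx_mul !mulmxA => ->.
  by [].
split; last by move=> x; rewrite !form_at_quad_form cvec_app trmx_mul -[in RHS]h /gram !mulmxA.
apply/eqP; rewrite -subv0; apply/subvP => x; rewrite memv_ker memv0 => /eqP hx.
rewrite -cvec0 -[cvec x](mulKmx uF) -{2}h /gram -!mulmxA -cvec_app hx.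
by rewrite (_ : cvec 0 = 0) ?mulmx0 //; apply/eqP; rewrite cvec0.
Qed.

Lemma predegree_graph_set : predegree_graph e (d := 2) (quad_form F) = graph_set F.
Proof.
apply: pred_ext => v; split=> [[phi [a [p0 a0 hl hr]]]|[X [a [q0 a0 ->]]]].
  exists (emx phi), a; rewrite -precomp_quad_form; split=> //.
  apply/ffunP => -[ij|m]; rewrite ffunE /=; first by rewrite hl mxE; case: ij.
  by rewrite hr precomp_quad_form.
have [phi hphi] := emx_surj X; exists phi, a; rewrite precomp_quad_form hphi; split=> //.
  by move=> ij; rewrite ffunE /= -hphi mxE; case: ij.
by move=> m; rewrite ffunE.
Qed.

Lemma proj_image_orth : F \in unitmx ->
  proj_image e (orthogonal_group e (quad_form F)) = orth_set F.
Proof.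
move=> uF; apply: pred_ext => v; split=> [[phi [a [hphi a0 hv]]]|[X [a [hX a0 ->]]]].
  exists (emx phi), a; split=> //; first exact/orthogonal_gram.
  by apply/ffunP => ij; rewrite ffunE hv mxE; case: ij.
have [phi hphi] := emx_surj X; exists phi, a; split=> //.
  by apply/orthogonal_gram => //; rewrite hphi.
by move=> ij; rewrite ffunE -hphi mxE; case: ij.
Qed.

End Coordinates.

Theorem proposition3p1 (K : closedFieldType) (charK : [pchar K] =i pred0)
    (n : nat) (n_ge1 : (1 <= n)%N) (A : vectType K) (e : n.+1.-tuple A)
    (basis_e : basis_of fullv e) (f : {mpoly K[n.+1]})
    (f_quadric : f \is 2.-homog) (f_smooth : smooth_hypersurface e f)
    (P : {poly int}) (d : nat) :
  predegree_polynomial e 2 f P ->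
  group_degree e (orthogonal_group e f) d ->
  lead_coef P = d%:Z.
Proof.
have two0 : 2%:R != 0 :> K.
  by have := charK 2%N; rewrite !inE /= => /negbT.
have [F sF ef] := quadric_quad_form two0 f_quadric.
have uF : F \in unitmx by apply: (smooth_unit basis_e sF); rewrite -ef.
have [C eF] := sym_factor two0 sF.
have uC : C \in unitmx.
  by move: uF; rewrite eF !unitmxE det_mulmx det_tr unitrM => /andP[].
rewrite /predegree_polynomial /group_degree ef predegree_graph_set // proj_image_orth //.
move=> [a ha ->] hd.
have [M [MN aM d0 aabove]] := leading_number two0 eF uC ha hd.
(* The coefficients beyond M vanish, and the one at M is d, which is nonzero. *)
have -> : \poly_(i < (n ^ 2 + 2 * n).+1) (a i)%:Z = \poly_(i < M.+1) (a i)%:Z :> {poly int}.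
  apply/polyP => i; rewrite !coef_poly !ltnS.
  have [iM|iM] := leqP i M; first by rewrite (leq_trans iM MN).
  by case: leqP => // le; rewrite aabove.
by rewrite lead_coef_poly //= aM.
Qed.
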